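(* For any $K\in\mathcal K_2$ and $p\in\operatorname{int}K$, if $K$ has $S\ge 3$ stable points with respect to $p$, then $$\rho^{in}(K,p)\le\frac{1}{2S},$$ with equality if, and only if, $K$ is a regular $S$-gon, and $p$ is its center.
   Context: A convex body is a compact convex set with nonempty interior. $\mathcal K_2$ denotes the family of convex bodies in $\mathbb R^2$ with piecewise smooth ($C^\infty$) boundary. $|\cdot|$ denotes the Euclidean norm. Let $K\in\mathcal K_2$ and $p\in\operatorname{int}K$. A point $q\in\operatorname{bd}K$ is an equilibrium point of $K$ with respect to $p$ if the line passing through $q$ and perpendicular to $q-p$ supports $K$ (if $\operatorname{bd}K$ is smooth at $q$, this is equivalent to $q$ being a critical point of $z\mapsto|z-p|$, $z\in\operatorname{bd}K$). The equilibrium at $q$ is nondegenerate if one of the following holds: $\operatorname{bd}K$ is smooth at $q$ and the second derivative of $z\mapsto|z-p|$, $z\in\operatorname{bd}K$, at $q$ is not zero; or $\operatorname{bd}K$ is not smooth at $q$ and both angles between $p-q$ and one of the two one-sided tangent half lines of $\operatorname{bd}K$ at $q$ are acute. At a smooth point, a nondegenerate equilibrium point $q$ is called stable or unstable if the second derivative at $q$ is positive or negative, respectively; at a nonsmooth point it is called unstable. Standing assumption: only bodies that have only nondegenerate equilibrium points are dealt with. Let $K\in\mathcal K_2$ and $p\in\operatorname{int}K$, and assume that $K$ has $S$ stable points with respect to $p$. Let $R(K,p)\subseteq\mathbb R^2$ denote the set of the points such that $K$ has $S$ stable points with respect to any point of $R(K,p)$. The internal robustness of $K$ with respect to $p$ is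 $$\rho^{in}(K,p)=\frac{\min\{|q-p|:q\notin R(K,p)\}}{\operatorname{perim}K},$$ where $\operatorname{perim}K$ is the perimeter of $K$. *)

(* Defs.v *)
From mathcomp Require Import all_boot all_order all_algebra.
From mathcomp Require Import all_classical all_reals all_analysis.

Set Implicit Arguments.
Unset Strict Implicit.
Unset Printing Implicit Defensive.

Import Order.TTheory GRing.Theory Num.Theory.
Import numFieldNormedType.Exports.

Local Open Scope classical_set_scope.
Local Open Scope card_scope.
Local Open Scope ring_scope.

Section Plane.
Variable R : realType.
Local Notation plane := 'rV[R]_2.
Implicit Types (K : set plane) (p q u v : plane) (c gamma : R -> plane).

Definition dot u v : R := \sum_(i < 2) u 0 i * v 0 i.

(* The library norm `|u| on 'rV[R]_2 is the sup norm: it induces the same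
   topology and the same derivatives, but it is not the Euclidean norm. *)
Definition enorm u : R := Num.sqrt (dot u u).

Definition bd K : set plane := closure K `\` K°.

Definition convex_body K :=
  [/\ compact K, convex_set (K : set (convex_lmodType plane)) & K° !=set0].

Definition smooth_curve c := forall (n : nat) (t : R), derivable (derive1n n c) t 1.

(* gamma restricted to [0, 1] traverses bd K once, and is C^oo and regular, up
   to the endpoints, on each interval [tau i, tau i.+1] of a finite subdivision.
   Only the values of gamma on [0, 1] matter. *)
Definition boundary_param K gamma :=
  [/\ {within `[0, 1], continuous gamma},
      {in `[0, 1[ &, injective gamma},
      gamma 0 = gamma 1,
      gamma @` `[0, 1] = bd K &
      exists (n : nat) (tau : nat -> R),
        [/\ tau 0%N = 0, tau n = 1 &
            forall i, (i < n)%N -> tau i < tau i.+1 /\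
              exists2 c, smooth_curve c &
                forall t, t \in `[tau i, tau i.+1] ->
                  gamma t = c t /\ derive1 c t != 0]].

(* The family K_2 *)
Definition piecewise_smooth_body K :=
  convex_body K /\ exists gamma, boundary_param K gamma.

(* gamma is differentiable on [0, 1] except possibly at finitely many points,
   which do not contribute to the integral. *)
Definition curve_length gamma : R :=
  \int[lebesgue_measure]_(t in `[0, 1]) enorm (derive1 gamma t).

(* All boundary parametrizations have the same length; the default value 0 is
   irrelevant for piecewise smooth bodies. *)
Definition perimeter K : R :=
  xget 0 [set curve_length gamma | gamma in boundary_param K].

(* c is a C^oo regular parametrization, based at q, of bd K near q *)
Definition local_param K q c :=
  [/\ smooth_curve c, c 0 = q, derive1 c 0 != 0,
      \forall t \near 0, bd K (c t) &
      forall e : R, 0 < e ->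
        \forall z \near q, bd K z -> exists2 t, `|t| < e & c t = z].

Definition smooth_at K q := exists c, local_param K q c.

(* u spans one of the one-sided tangent half lines of bd K at q *)
Definition tangent_direction K q u :=
  u != 0 /\ exists c, [/\ smooth_curve c, c 0 = q, derive1 c 0 = u &
                          \forall t \near 0^'+, bd K (c t)].

(* the line through q with normal vector v supports K; every line through q
   is perpendicular to v = 0, and then the condition reduces to q \in K *)
Definition normal_line_supports K q v :=
  K q /\ ((forall z, K z -> dot v (z - q) <= 0) \/
          (forall z, K z -> 0 <= dot v (z - q))).

(* The reference point p ranges over the whole plane: the region of robustness
   below need not be contained in the interior of K. *)
Definition equilibrium K p q := bd K q /\ normal_line_supports K q (q - p).

(* The second derivative at q of z |-> |z - p| along bd K; at an equilibrium
   point q != p the first derivative vanishes, hence the sign of the second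
   one does not depend on the parametrization c. *)
Definition dist_deriv2 p c : R := derive1n 2 (fun t => enorm (c t - p)) 0.

(* If p itself is a smooth boundary point, then z |-> |z - p| has a strict
   minimum at q = p but is not differentiable there (half its square has second
   derivative 1 in arc length); such a q counts as nondegenerate and stable.
   This case cannot occur for p in the interior of K. *)
Definition stable K p q :=
  [/\ equilibrium K p q, smooth_at K q &
      q = p \/ exists2 c, local_param K q c & 0 < dist_deriv2 p c].

(* An angle is acute iff the inner product of its spanning vectors is
   positive. *)
Definition nondegenerate K p q :=
  (smooth_at K q /\
     (q = p \/ exists2 c, local_param K q c & dist_deriv2 p c != 0)) \/
  (~ smooth_at K q /\ forall u, tangent_direction K q u -> 0 < dot (p - q) u).

Definition only_nondegenerate K p :=
  forall q, equilibrium K p q -> nondegenerate K p q.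

(* The set R(K, p): bodies with a degenerate equilibrium with respect to a
   point are excluded from consideration, hence so are such points. *)
Definition robustness_region K p : set plane :=
  [set x | only_nondegenerate K x /\ stable K x #= stable K p].

(* inf is the minimum when the latter is attained *)
Definition internal_robustness K p : R :=
  inf [set enorm (q - p) | q in ~` robustness_region K p] / perimeter K.

Definition polar p (r theta : R) : plane :=
  p + r *: \row_(i < 2) (if i == 0 then cos theta else sin theta).

Definition convex_hull (A : set plane) : set plane :=
  smallest (fun B => convex_set (B : set (convex_lmodType plane))) A.

Definition regular_polygon (n : nat) p K :=
  exists r theta : R, 0 < r /\
    K = convex_hull
          [set polar p r (theta + 2 * pi * k%:R / n%:R) | k in `I_n].

End Plane.

(* Main.v *)
Require Import Defs.
From HB Require Import structures.
From mathcomp Require Import all_boot all_order all_algebra.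
From mathcomp Require Import all_classical all_reals all_analysis.
From mathcomp Require Import measurable_realfun.
From mathcomp Require Import ring lra.

Set Implicit Arguments.
Unset Strict Implicit.
Unset Printing Implicit Defensive.

Import Order.TTheory GRing.Theory Num.Theory.
Import numFieldNormedType.Exports.

Local Open Scope classical_set_scope.
Local Open Scope card_scope.
Local Open Scope ring_scope.

(* Let T(u) be the unit tangent at the boundary point G(u), Lam(u) the arc length
   and w(u) = <G(u) - p, T(u)>, so that x(u) = p + w(u) T(u) is the foot of the
   perpendicular from p to the normal line at G(u). The point G(u) is an
   equilibrium with respect to x(u), and |x(u) - p| = |w(u)|. Hence, if only
   nondegenerate equilibria occur with respect to the points at distance less
   than r from p, then wherever |w| < r the boundary is smooth and w is strictly
   monotone. Where w increases, dw/dLam = 1 - kappa h <= 1, where kappa is the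
   curvature and h the distance from p to the tangent line. Along a maximal arc
   on which w increases it passes from -r to r, so the length of the arc is at
   least 2r. The zeros of w on these arcs are the stable points; hence S stable
   points give S disjoint arcs, and 2 S r <= perim K.

   In case of equality the arcs cover the boundary and kappa vanishes: they are
   segments of length 2r centred at the feet of the perpendiculars from p, which
   forces a regular polygon. Conversely, for a regular S-gon of side 2r the foot
   of the perpendicular from a point at distance less than r from p to the line
   of an edge is interior to the edge, so the open disc of radius r around p is
   contained in the region of robustness. *)

(** Nondegeneracy supplies some parametrization of the boundary near an equilibrium, unrelated to
    the pieces of the given one. No change of parameter is constructed: the sign of the second
    derivative is carried over by the quadratic growth of the distance along the boundary, a
    property of the point set. A corner with |w| < r is impossible because x(u) - G(u) is orthogonal
    to a one-sided tangent, while nondegeneracy at a corner asks for acute angles. At a smooth point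
    the one-sided tangents are opposite, so w has no jump. Where |w| >= r, corners do occur and w
    may jump; hence the curve is handled through one-sided pieces, and the ends of an arc through
    one-sided limits of w. Strict growth of w and its domination by arc length are transitive
    relations, propagated from neighbourhoods to arcs by a supremum argument. In the converse the
    perimeter is the length of an arbitrary parametrization, so the length of the polygon is found
    by running the same decomposition into arcs, now with zero curvature, instead of adding up
    edges. *)

Section EuclideanPlane.
Variable R : realType.
Local Notation plane := 'rV[R]_2.
Implicit Types (K : set plane) (p q u v z : plane).

Lemma dotE u v : dot u v = u 0 0 * v 0 0 + u 0 1 * v 0 1.
Proof.
rewrite /dot big_ord_recl big_ord1; congr (_ * _ + _ * _);
  by congr (_ _ _); apply/val_inj.
Qed.

Lemma row2P u v : u 0 0 = v 0 0 -> u 0 1 = v 0 1 -> u = v.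
Proof.
move=> e0 e1; apply/rowP => -[[|[|//]] lt_i2].
  by rewrite (_ : Ordinal _ = 0) //; apply/val_inj.
by rewrite (_ : Ordinal _ = 1) //; apply/val_inj.
Qed.

Definition row2 (a b : R) : plane := \row_(i < 2) (if i == 0 then a else b).

Lemma row2_0 a b : row2 a b 0 0 = a.
Proof. by rewrite mxE. Qed.

Lemma row2_1 a b : row2 a b 0 1 = b.
Proof. by rewrite mxE. Qed.

Lemma ord2P (i : 'I_2) : i = 0 \/ i = 1.
Proof. by case: i => -[|[|//]] lt_i2; [left|right]; apply/val_inj. Qed.

Lemma dotC u v : dot u v = dot v u.
Proof. by rewrite !dotE; ring. Qed.

Lemma dotDr u v w : dot u (v + w) = dot u v + dot u w.
Proof. by rewrite !dotE !mxE; ring. Qed.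

Lemma dotBr u v w : dot u (v - w) = dot u v - dot u w.
Proof. by rewrite !dotE !mxE; ring. Qed.

Lemma dotZr u v (k : R) : dot u (k *: v) = k * dot u v.
Proof. by rewrite !dotE !mxE; ring. Qed.

Lemma dotDl u v w : dot (u + v) w = dot u w + dot v w.
Proof. by rewrite !dotE !mxE; ring. Qed.

Lemma dotBl u v w : dot (u - v) w = dot u w - dot v w.
Proof. by rewrite !dotE !mxE; ring. Qed.

Lemma dotZl u v (k : R) : dot (k *: u) v = k * dot u v.
Proof. by rewrite !dotE !mxE; ring. Qed.

Lemma dotNl u v : dot (- u) v = - dot u v.
Proof. by rewrite !dotE !mxE; ring. Qed.

Lemma dotNr u v : dot u (- v) = - dot u v.
Proof. by rewrite !dotE !mxE; ring. Qed.

Lemma dot0l u : dot 0 u = 0.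
Proof. by rewrite dotE !mxE; ring. Qed.

Lemma dot0r u : dot u 0 = 0.
Proof. by rewrite dotE !mxE; ring. Qed.

Lemma dot_ge0 u : 0 <= dot u u.
Proof. by rewrite dotE addr_ge0 // -expr2 sqr_ge0. Qed.

Lemma dot_eq0 u : (dot u u == 0) = (u == 0).
Proof.
apply/eqP/eqP => [|->]; last by rewrite dot0l.
rewrite dotE -!expr2 => /eqP; rewrite paddr_eq0 ?sqr_ge0 // !sqrf_eq0.
by case/andP => /eqP e0 /eqP e1; apply: row2P; rewrite mxE.
Qed.

Lemma dot_gt0 u : (0 < dot u u) = (u != 0).
Proof. by rewrite lt_def dot_eq0 dot_ge0 andbT. Qed.

Lemma enorm_ge0 u : 0 <= enorm u.
Proof. exact: sqrtr_ge0. Qed.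

Lemma enorm_sqr u : enorm u ^+ 2 = dot u u.
Proof. by rewrite sqr_sqrtr // dot_ge0. Qed.

Lemma enorm_eq0 u : (enorm u == 0) = (u == 0).
Proof. by rewrite -sqrf_eq0 enorm_sqr dot_eq0. Qed.

Lemma enorm_gt0 u : (0 < enorm u) = (u != 0).
Proof. by rewrite lt_def enorm_eq0 enorm_ge0 andbT. Qed.

Lemma enorm0 : enorm (0 : plane) = 0.
Proof. by apply/eqP; rewrite enorm_eq0. Qed.

Lemma enormZ (k : R) u : enorm (k *: u) = `|k| * enorm u.
Proof.
rewrite /enorm dotZl dotZr mulrA -expr2 sqrtrM ?sqr_ge0 //.
by rewrite sqrtr_sqr.
Qed.

Lemma enormN u : enorm (- u) = enorm u.
Proof. by rewrite /enorm dotNl dotNr opprK. Qed.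

Lemma enormC u v : enorm (u - v) = enorm (v - u).
Proof. by rewrite -enormN opprB. Qed.

Lemma enorm_le_sqr u (a : R) : 0 <= a -> (enorm u <= a) = (dot u u <= a ^+ 2).
Proof.
by move=> a0; rewrite -enorm_sqr ler_pXn2r // nnegrE // enorm_ge0.
Qed.

Lemma cauchy_schwarz u v : `|dot u v| <= enorm u * enorm v.
Proof.
rewrite -(@ler_pXn2r _ 2) ?nnegrE // ?mulr_ge0 ?enorm_ge0 //.
rewrite exprMn !enorm_sqr real_normK ?num_real // !dotE.
have := sqr_ge0 (u 0 0 * v 0 1 - u 0 1 * v 0 0); nra.
Qed.

Lemma dot_le_enorm u v : dot u v <= enorm u * enorm v.
Proof. exact: le_trans (ler_norm _) (cauchy_schwarz u v). Qed.

Lemma enormD u v : enorm (u + v) <= enorm u + enorm v.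
Proof.
rewrite enorm_le_sqr ?addr_ge0 ?enorm_ge0 //.
rewrite dotDl !dotDr sqrrD !enorm_sqr (dotC v u).
have := dot_le_enorm u v; lra.
Qed.

Lemma enormB_tri u v w : enorm (u - w) <= enorm (u - v) + enorm (v - w).
Proof. by rewrite (le_trans _ (enormD _ _)) // subrKA. Qed.

Lemma coord_le_enorm u (i : 'I_2) : `|u 0 i| <= enorm u.
Proof.
rewrite -(@ler_pXn2r _ 2) ?nnegrE // ?enorm_ge0 //.
rewrite enorm_sqr real_normK ?num_real // dotE -!expr2.
by case: (ord2P i) => ->; rewrite ?lerDl ?lerDr sqr_ge0.
Qed.

Lemma enorm_le_coord u (e : R) : (forall i, `|u 0 i| <= e) -> enorm u <= 2 * e.
Proof.
move=> he; have e0 : 0 <= e by apply: le_trans (he 0).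
rewrite enorm_le_sqr ?mulr_ge0 // dotE -!expr2.
have hi i : u 0 i ^+ 2 <= e ^+ 2.
  by rewrite -(real_normK (num_real _)) ler_pXn2r ?nnegrE.
have := hi 0; have := hi 1; have := sqr_ge0 e; rewrite exprMn; lra.
Qed.

Lemma norm_le_enorm u : `|u| <= enorm u.
Proof.
rewrite /Num.norm /= mx_normrE; apply/bigmax_leP; split => [|[i j] _].
  exact: enorm_ge0.
by rewrite /= (ord1 i) coord_le_enorm.
Qed.

Lemma coord_le_norm u (i : 'I_2) : `|u 0 i| <= `|u|.
Proof.
by rewrite [leRHS]/Num.norm /= mx_normrE (le_bigmax _ (fun ij => `|u ij.1 ij.2|) (0, i)).
Qed.

Lemma enorm_le_norm u : enorm u <= 2 * `|u|.
Proof. by apply: enorm_le_coord => i; exact: coord_le_norm. Qed.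

(** The library topology comes from the sup norm; the two norms bound each other up to the factor 2,
    so Euclidean balls can serve as basic neighbourhoods. *)
Lemma nbhs_enormP z (P : set plane) :
  nbhs z P <-> exists2 e : R, 0 < e & forall y, enorm (y - z) < e -> P y.
Proof.
split => [/(@nbhs_normP R plane)[e /= e0 he]|[e e0 he]].
  exists e => // y yz; apply: he; rewrite /ball_ /= distrC.
  exact: le_lt_trans (norm_le_enorm _) yz.
apply/(@nbhs_normP R plane); exists (e / 2); first by rewrite /= divr_gt0.
move=> y /=; rewrite distrC => yz; apply: he.
by apply: le_lt_trans (enorm_le_norm _) _; rewrite mulrC -ltr_pdivlMr.
Qed.

Lemma interiorEP K z :
  K° z <-> exists2 e : R, 0 < e & forall y, enorm (y - z) < e -> K y.
Proof. exact: nbhs_enormP. Qed.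

Lemma convex_setE K : convex_set (K : set (convex_lmodType plane)) ->
  forall u v (l : R), K u -> K v -> 0 <= l <= 1 -> K (l *: u + (1 - l) *: v).
Proof.
move=> cK u v l Ku Kv l01.
have := cK u v (Itv01 (proj1 (andP l01)) (proj2 (andP l01))).
by rewrite !inE => /(_ Ku Kv); rewrite /conv /=.
Qed.

Lemma convexE_set K :
  (forall u v (l : R), K u -> K v -> 0 <= l <= 1 -> K (l *: u + (1 - l) *: v)) ->
  convex_set (K : set (convex_lmodType plane)).
Proof.
move=> cK u v l; rewrite !inE => Ku Kv.
by apply: (cK u v l%:num Ku Kv); rewrite ge0 le1.
Qed.

(* Homothety of the ball around [u] with ratio [l] and center [v]. *)
Lemma convex_interior K : convex_set (K : set (convex_lmodType plane)) ->
  forall u v (l : R), K° u -> K v -> 0 < l <= 1 -> K° (l *: u + (1 - l) *: v).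
Proof.
move=> cK u v l /interiorEP[e e0 he] Kv /andP[l0 l1].
apply/interiorEP; exists (l * e); first exact: mulr_gt0.
move=> y hy.
have -> : y = l *: (u + l^-1 *: (y - (l *: u + (1 - l) *: v))) + (1 - l) *: v.
  rewrite scalerDr scalerA divff ?gt_eqF // scale1r.
  by rewrite addrC addrA [_ + l *: u]addrC [RHS]addrC subrK.
apply: convex_setE => //; last by rewrite ltW.
apply: he; rewrite addrC addKr enormZ gtr0_norm ?invr_gt0 //.
by rewrite mulrC ltr_pdivrMr // mulrC.
Qed.

End EuclideanPlane.

(** * One-variable calculus: mean values and expansions at a point *)

Section RealCalculus.
Variable R : realType.
Implicit Types (f g : R -> R) (a b x t h : R).

Lemma is_derive_continuous f x (l : R) : is_derive x 1 f l -> {for x, continuous f}.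
Proof.
move=> df; have /derivable1_diffP := @ex_derive _ _ _ _ _ _ _ df.
exact: differentiable_continuous.
Qed.

Lemma mean_value f (f1 : R -> R) a b :
  (forall t, t \in `[a, b] -> is_derive t 1 f (f1 t)) -> a <= b ->
  exists2 t, t \in `[a, b] & f b - f a = f1 t * (b - a).
Proof.
move=> df ab.
have dfo t : t \in `]a, b[ -> is_derive t 1 f (f1 t).
  by move/subset_itv_oo_cc; exact: df.
suff cf : {within `[a, b], continuous f} by exact: (MVT_segment ab dfo cf).
apply: derivable_within_continuous => t tab.
by have := df t tab; case.
Qed.

Lemma derive_ge0_le f (f1 : R -> R) a b :
  (forall t, t \in `[a, b] -> is_derive t 1 f (f1 t)) ->
  (forall t, t \in `[a, b] -> 0 <= f1 t) -> a <= b -> f a <= f b.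
Proof.
move=> df f1_ge0 ab; have [t tab e] := mean_value df ab.
by rewrite -subr_ge0 e mulr_ge0 ?f1_ge0 ?subr_ge0.
Qed.

Lemma derive_gt0_lt f (f1 : R -> R) a b :
  (forall t, t \in `[a, b] -> is_derive t 1 f (f1 t)) ->
  (forall t, t \in `[a, b] -> 0 < f1 t) -> a < b -> f a < f b.
Proof.
move=> df f1_gt0 ab; have [t tab e] := mean_value df (ltW ab).
by rewrite -subr_gt0 e mulr_gt0 ?f1_gt0 ?subr_gt0.
Qed.

Lemma is_derive_expansion f x (l : R) : is_derive x 1 f l ->
  forall eta : R, 0 < eta -> exists2 d : R, 0 < d &
    forall h, `|h| < d -> `|f (x + h) - f x - l * h| <= eta * `|h|.
Proof.
move=> df eta eta0.
have e := @derive_val _ _ _ _ _ _ _ df.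
have dfx := @ex_derive _ _ _ _ _ _ _ df.
have : (fun h => h^-1 *: (f (h *: 1 + x) - f x)) @ 0^' --> l.
  by rewrite -e; exact: dfx.
move/cvgrPdist_le => /(_ eta eta0) /nbhs_ballP[d /= d0 hd].
exists d => // h hh; have [->|hN0] := eqVneq h 0.
  by rewrite addr0 subrr mulr0 subr0 normr0 mulr0.
have := hd h; rewrite /ball /= sub0r normrN => /(_ hh hN0).
rewrite /GRing.scale /= mulr1 [h + x]addrC => ineq.
have -> : f (x + h) - f x - l * h = - ((l - h^-1 * (f (x + h) - f x)) * h).
  by field.
by rewrite normrN normrM ler_wpM2r.
Qed.

(** The remainder has Peano's form, since [f1] is only assumed differentiable at 0: the mean value
    theorem is applied to [f] minus its quadratic polynomial, whose derivative is o(t). *)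
Lemma taylor2 f (f1 : R -> R) (m : R) :
  (forall t : R, is_derive t 1 f (f1 t)) -> is_derive (0 : R) 1 f1 m ->
  forall eta : R, 0 < eta -> exists2 d : R, 0 < d & forall h, `|h| < d ->
    `|f h - f 0 - f1 0 * h - m / 2 * h ^+ 2| <= eta * h ^+ 2.
Proof.
move=> df df1 eta eta0.
have [d d0 hd] := is_derive_expansion df1 eta0.
exists d => // h hh.
pose g t : R := f t - f1 0 * t - m / 2 * t ^+ 2.
pose g1 t : R := f1 t - f1 0 - m * t.
have dg t : is_derive t 1 g (g1 t).
  have dft := df t.
  have -> : g = f - f1 0 \*: id - (m / 2) \*: (id : R -> R) ^+ 2 by [].
  apply: is_derive_eq.
  by rewrite /g1 /GRing.scale /=; field.
have hg1 t : `|t| <= `|h| -> `|g1 t| <= eta * `|h|.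
  move=> th; have := hd t (le_lt_trans th hh); rewrite add0r => /le_trans; apply.
  by rewrite ler_pM2l.
suff : exists2 t, `|t| <= `|h| & g h - g 0 = g1 t * h.
  case=> t th e.
  have -> : f h - f 0 - f1 0 * h - m / 2 * h ^+ 2 = g h - g 0 by rewrite /g; ring.
  by rewrite e normrM -[h ^+ 2]real_normK ?num_real // expr2 mulrA ler_wpM2r ?hg1.
have [h0|h0] := leP 0 h.
  have [t + e] := mean_value (fun t _ => dg t) h0.
  rewrite in_itv /= => /andP[t0 th]; exists t; last by rewrite e subr0.
  by rewrite !ger0_norm.
have [t + e] := mean_value (fun t _ => dg t) (ltW h0).
rewrite in_itv /= => /andP[t0 th]; exists t; last by rewrite -[LHS]opprB e; ring.
by rewrite !ler0_norm ?lerN2 // ltW.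
Qed.

(** A pair on opposite sides of [u] is handled by transitivity through [u] itself, which is why both
    one-sided hypotheses include [u]. *)
Lemma glue_at (Q : R -> R -> Prop) (u dr dl : R) : 0 < dr -> 0 < dl ->
  (forall x y z, Q x y -> Q y z -> Q x z) ->
  (forall s t, u <= s -> s < t -> t < u + dr -> Q s t) ->
  (forall s t, u - dl < s -> s < t -> t <= u -> Q s t) ->
  exists2 e, 0 < e & forall s t, `|s - u| < e -> `|t - u| < e -> s < t -> Q s t.
Proof.
move=> dr0 dl0 trQ QR QL; exists (Num.min dr dl); first by rewrite lt_min dr0.
move=> s t; rewrite !lt_min !ltr_norml => /andP[_ /andP[s1 _]].
move=> /andP[/andP[_ t1] _] st.
have {}s1 : u - dl < s by rewrite addrC -ltrBrDr.
have {}t1 : t < u + dr by rewrite addrC -ltrBlDr.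
have [us|su] := leP u s; first exact: QR.
have [tu|ut] := leP t u; first exact: QL.
by apply: (trQ _ u); [exact: QL|exact: QR].
Qed.

End RealCalculus.

(** * Derivatives of plane curves *)

Section CurveCalculus.
Variable R : realType.
Local Notation plane := 'rV[R]_2.
Implicit Types (K : set plane) (p q u v x z : plane) (c : R -> plane).

(** Coordinatewise, so that the derivation rules for real functions apply to inner products and
    norms of curves. *)
Definition is_curve_derive c c1 :=
  forall (t : R) (i : 'I_2), is_derive t 1 (fun s => c s 0 i) (c1 t 0 i).

Lemma smooth_curveP c : smooth_curve c <->
  exists ck : nat -> R -> plane,
    ck 0%N = c /\ forall n, is_curve_derive (ck n) (ck n.+1).
Proof.
split=> [sc|[ck [c0 dck]]].
  exists (fun n => derive1n n c); split; first by rewrite derive1n0.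
  move=> n t i; have /derivable_mxP dn := sc n t.
  apply: DeriveDef; first exact: dn.
  by rewrite derive1nS derive1E derive_mx ?mxE //; exact: sc.
have dc n t : derivable (ck n) t 1.
  apply/derivable_mxP => i j; rewrite (ord1 i).
  exact: (@ex_derive _ _ _ _ _ _ _ (dck n t j)).
have e n : derive1n n c = ck n.
  elim: n => [|n IHn]; first by rewrite derive1n0.
  rewrite derive1nS IHn; apply/funext => t.
  rewrite derive1E derive_mx //; apply/rowP => j; rewrite mxE.
  exact: (@derive_val _ _ _ _ _ _ _ (dck n t j)).
by move=> n t; rewrite e; exact: dc.
Qed.

Lemma smooth_curve_derive c : smooth_curve c ->
  forall n, is_curve_derive (derive1n n c) (derive1n n.+1 c).
Proof.
move=> sc n t i; have /derivable_mxP dn := sc n t.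
apply: DeriveDef; first exact: dn.
by rewrite derive1nS derive1E derive_mx ?mxE //; exact: sc.
Qed.

Lemma is_curve_derive_affine c c1 (a b : R) : is_curve_derive c c1 ->
  is_curve_derive (fun t => c (a + b * t)) (fun t => b *: c1 (a + b * t)).
Proof.
move=> dc t i; rewrite mxE mulrC.
have := dc (a + b * t) i => dct.
apply: (@is_derive1_comp _ (fun s => c s 0 i) (fun t => a + b * t)).
have -> : (fun t => a + b * t) = cst a + b \*: (id : R -> R) by [].
have D := is_deriveD (is_derive_cst a t 1) (is_deriveZ b (is_derive_id t 1)).
by apply: (is_derive_eq D); rewrite add0r /GRing.scale /= mulr1.
Qed.

Lemma smooth_curve_affine c (a b : R) : smooth_curve c ->
  smooth_curve (fun t => c (a + b * t)).
Proof.
move=> sc; apply/smooth_curveP.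
exists (fun n t => b ^+ n *: derive1n n c (a + b * t)); split.
  by apply/funext => t; rewrite expr0 scale1r derive1n0.
move=> n t i.
have := is_curve_derive_affine a b (smooth_curve_derive sc n) t i => d.
have -> : (fun s => (b ^+ n *: derive1n n c (a + b * s)) 0 i) =
          b ^+ n \*: (fun s => derive1n n c (a + b * s) 0 i).
  by apply/funext => s; rewrite mxE.
by apply: is_derive_eq; rewrite !mxE exprSr /GRing.scale /= mulrA.
Qed.

Lemma derive1_curve c c1 : is_curve_derive c c1 -> derive1 c = c1.
Proof.
move=> dc; apply/funext => t; rewrite derive1E derive_mx.
  by apply/rowP => j; rewrite mxE; exact: (@derive_val _ _ _ _ _ _ _ (dc t j)).
apply/derivable_mxP => i j; rewrite (ord1 i).
exact: (@ex_derive _ _ _ _ _ _ _ (dc t j)).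
Qed.

Lemma derive1_affine c (a b t : R) : smooth_curve c ->
  derive1 (fun t => c (a + b * t)) t = b *: derive1 c (a + b * t).
Proof.
move=> sc; have := is_curve_derive_affine a b (smooth_curve_derive sc 0).
by rewrite derive1n0 derive1n1 => /derive1_curve ->.
Qed.

Lemma smooth_line q v : smooth_curve (fun t => q + t *: v).
Proof.
apply/smooth_curveP.
exists (fun n => match n with 0%N => fun t => q + t *: v | 1%N => cst v | _ => cst 0 end).
split=> // -[|[|n]] t i; last by rewrite /cst mxE; exact: is_derive_cst.
  have -> : (fun s => (q + s *: v) 0 i) = cst (q 0 i) + v 0 i \*: id.
    by apply/funext => s; rewrite !mxE mulrC.
  by apply: is_derive_eq; rewrite add0r /GRing.scale /= mulr1.
by rewrite /cst mxE; exact: is_derive_cst.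
Qed.

Lemma is_curve_derive_line q v : is_curve_derive (fun t => q + t *: v) (cst v).
Proof.
move=> t i; have -> : (fun s => (q + s *: v) 0 i) = cst (q 0 i) + v 0 i \*: id.
  by apply/funext => s; rewrite !mxE mulrC.
have D := is_deriveD (is_derive_cst (q 0 i) t 1) (is_deriveZ (v 0 i) (is_derive_id t 1)).
by apply: (is_derive_eq D); rewrite add0r /GRing.scale /= mulr1.
Qed.

Lemma derive1_line q v t : derive1 (fun t => q + t *: v) t = v.
Proof. by rewrite (derive1_curve (is_curve_derive_line q v)). Qed.

Lemma is_derive_dot c c1 d d1 (t : R) :
  is_curve_derive c c1 -> is_curve_derive d d1 ->
  is_derive t 1 (fun s => dot (c s) (d s)) (dot (c1 t) (d t) + dot (c t) (d1 t)).
Proof.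
move=> dc dd.
have -> : (fun s => dot (c s) (d s)) =
  (fun s => c s 0 0) * (fun s => d s 0 0) + (fun s => c s 0 1) * (fun s => d s 0 1).
  by apply/funext => s; rewrite dotE.
have c0 := dc t 0; have cc1 := dc t 1; have d0 := dd t 0; have dd1 := dd t 1.
apply: (is_derive_eq (is_deriveD (is_deriveM c0 d0) (is_deriveM cc1 dd1))).
by rewrite !dotE /GRing.scale /=; ring.
Qed.

Lemma is_curve_deriveB c c1 p : is_curve_derive c c1 ->
  is_curve_derive (fun s => c s - p) c1.
Proof.
move=> dc t i; have d := dc t i.
have -> : (fun s => (c s - p) 0 i) = (fun s => c s 0 i) - cst (p 0 i).
  by apply/funext => s; rewrite !mxE.
by apply: is_derive_eq; rewrite subr0.
Qed.

Lemma is_curve_derive_cst v : is_curve_derive (cst v) (cst 0).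
Proof. by move=> t i; rewrite /cst mxE; exact: is_derive_cst. Qed.

Lemma curve_expansion c c1 (x : R) : is_curve_derive c c1 ->
  forall eta : R, 0 < eta -> exists2 d : R, 0 < d &
    forall h, `|h| < d -> enorm (c (x + h) - c x - h *: c1 x) <= eta * `|h|.
Proof.
move=> dc eta eta0.
(* Half of [eta] for each coordinate pays for the factor 2 in [enorm_le_coord]. *)
have eta20 : 0 < eta / 2 by rewrite divr_gt0.
have [d0 d00 hd0] := is_derive_expansion (dc x 0) eta20.
have [d1 d10 hd1] := is_derive_expansion (dc x 1) eta20.
exists (Num.min d0 d1); first by rewrite lt_min d00.
move=> h; rewrite lt_min => /andP[h0 h1].
rewrite (_ : eta * `|h| = 2 * (eta / 2 * `|h|)); last by field.
apply: enorm_le_coord => i; rewrite !mxE [h * _]mulrC.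
by case: (ord2P i) => ->; [exact: hd0|exact: hd1].
Qed.

End CurveCalculus.

(** * Projection of [p] to a normal line *)

Section Foot.
Variable R : realType.
Local Notation plane := 'rV[R]_2.
Implicit Types (K : set plane) (p q u v x z n : plane) (c : R -> plane).

Lemma perp_collinear n u v : n != 0 -> v != 0 -> dot n v = 0 -> dot n u = 0 ->
  exists l, u = l *: v.
Proof.
move=> n0 v0 nv nu; exists (dot u v / dot v v).
have vv0 : dot v v != 0 by rewrite dot_eq0.
(* Up to the factor |n|^2, the determinant of [u] and [v] is a combination of the two vanishing
   inner products. *)
have key : dot n n * (u 0 0 * v 0 1 - u 0 1 * v 0 0) = 0.
  have -> : dot n n * (u 0 0 * v 0 1 - u 0 1 * v 0 0) =
    dot n u * (n 0 0 * v 0 1 - n 0 1 * v 0 0) -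
    dot n v * (n 0 0 * u 0 1 - n 0 1 * u 0 0) by rewrite !dotE; ring.
  by rewrite nv nu !mul0r subr0.
have {key} uv : u 0 0 * v 0 1 = u 0 1 * v 0 0.
  apply/eqP; rewrite -subr_eq0; move/eqP: key.
  by rewrite mulf_eq0 dot_eq0 (negPf n0).
apply: row2P; rewrite !mxE mulrAC; apply/esym/(canLR (mulfK vv0));
  rewrite !dotE; move: (congr1 ( *%R (v 0 0)) uv) (congr1 ( *%R (v 0 1)) uv); lra.
Qed.

(** The point x(u) of the overview, written so that the tangent vector [v] may have any length. *)
Definition foot p q v : plane := p + (dot (q - p) v / dot v v) *: v.

Lemma foot_perp p q v : v != 0 -> dot (foot p q v - q) v = 0.
Proof.
move=> v0; have vv0 : dot v v != 0 by rewrite dot_eq0.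
have -> : foot p q v - q = (dot (q - p) v / dot v v) *: v - (q - p).
  by rewrite /foot opprB addrCA addrA.
by rewrite [LHS]dotBl [X in X - _]dotZl divfK // subrr.
Qed.

(** Once the foot differs from [q] this product is positive, which makes [foot p q v - q] the inner
    normal: [p] lies strictly on its positive side. *)
Lemma foot_dot p q v : v != 0 ->
  dot (foot p q v - q) (p - q) = dot (foot p q v - q) (foot p q v - q).
Proof.
move=> v0; have {3}-> : foot p q v - q = (p - q) + (dot (q - p) v / dot v v) *: v.
  by rewrite /foot addrAC.
by rewrite [RHS]dotDr [in RHS]dotZr foot_perp // mulr0 addr0.
Qed.

Lemma foot_dist p q v : v != 0 ->
  enorm (foot p q v - p) = `|dot (q - p) v / enorm v|.
Proof.
move=> v0; have v1 : enorm v != 0 by rewrite enorm_eq0.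
rewrite /foot addrC addKr enormZ -enorm_sqr !normrM !normfV.
rewrite normrX (ger0_norm (enorm_ge0 v)).
by field.
Qed.

Lemma footZ p q v (k : R) : k != 0 -> foot p q (k *: v) = foot p q v.
Proof.
move=> k0; rewrite /foot scalerA; congr (_ + _ *: _).
have [->|v0] := eqVneq v 0; first by rewrite scaler0 !dot0r !mul0r.
have vv0 : dot v v != 0 by rewrite dot_eq0.
by rewrite dotZl !dotZr; field; apply/andP.
Qed.

End Foot.

(* The signed distance of [p] from the line normal to [c] at [c t]. The
   definition is locked because unfolding the derivatives in failing conversion
   tests is prohibitively slow. *)
HB.lock Definition tangential (R : realType) (p : 'rV[R]_2) (c : R -> 'rV[R]_2)
    (t : R) : R :=
  dot (c t - p) (derive1 c t) / enorm (derive1 c t).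

(** The quotient rule regrouped around the foot x of [p]: the numerator is the second derivative of
    |z - x|^2 / 2 along [c], with x kept fixed. This ties the sign of the derivative of w to the
    kind of equilibrium with respect to x. *)
HB.lock Definition tangential_derive (R : realType) (p : 'rV[R]_2)
    (c : R -> 'rV[R]_2) (t : R) : R :=
  (dot (derive1 c t) (derive1 c t) +
   dot (c t - foot p (c t) (derive1 c t)) (derive1n 2 c t)) / enorm (derive1 c t).

Section SpeedCalculus.
Variable R : realType.
Local Notation plane := 'rV[R]_2.
Implicit Types (p q u v x z n : plane) (c : R -> plane).

Lemma is_derive_inv (f : R -> R) (x df : R) : f x != 0 -> is_derive x 1 f df ->
  is_derive x 1 (fun y => (f y)^-1) (- df / f x ^+ 2).
Proof.
move=> fx0 dfx; have dfx1 : derivable f x 1 by case: dfx.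
apply: DeriveDef; first exact: derivableV.
have -> : - df / f x ^+ 2 = - (f x) ^- 2 *: 'D_1 f x.
  by rewrite (@derive_val _ _ _ _ _ _ _ dfx) /GRing.scale /=; ring.
exact: deriveV.
Qed.

Lemma is_derive_enorm c c1 t : is_curve_derive c c1 -> c t != 0 ->
  is_derive t 1 (fun s => enorm (c s)) (dot (c t) (c1 t) / enorm (c t)).
Proof.
move=> dc ct0; have d := is_derive_dot t dc dc.
have ct1 : enorm (c t) != 0 by rewrite enorm_eq0.
have dot0 : 0 < dot (c t) (c t) by rewrite dot_gt0.
have ds := is_derive1_sqrt dot0.
have D := @is_derive1_comp _ Num.sqrt (fun s => dot (c s) (c s)) t _ _ ds d.
apply: (is_derive_eq D); rewrite -/(enorm (c t)) (dotC (c1 t)).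
by field.
Qed.

Lemma tangentialE p c t :
  tangential p c t = dot (c t - p) (derive1 c t) / enorm (derive1 c t).
Proof. by rewrite tangential.unlock. Qed.

Lemma tangential_deriveE p c t : tangential_derive p c t =
  (dot (derive1 c t) (derive1 c t) +
   dot (c t - foot p (c t) (derive1 c t)) (derive1n 2 c t)) / enorm (derive1 c t).
Proof. by rewrite tangential_derive.unlock. Qed.

Lemma is_derive_tangential p c t : smooth_curve c -> derive1 c t != 0 ->
  is_derive t 1 (tangential p c) (tangential_derive p c t).
Proof.
move=> sc v0; have vn0 : enorm (derive1 c t) != 0 by rewrite enorm_eq0.
have dc : is_curve_derive c (derive1 c).
  by have := smooth_curve_derive sc 0; rewrite derive1n0 derive1n1.
have dc1 : is_curve_derive (derive1 c) (derive1n 2 c).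
  by have := smooth_curve_derive sc 1; rewrite derive1n1.
have d1 := is_derive_dot t (is_curve_deriveB p dc) dc1.
have d2 := is_derive_inv (f := fun s => enorm (derive1 c s)) vn0
  (is_derive_enorm dc1 v0).
have -> : tangential p c =
  (fun s => dot (c s - p) (derive1 c s)) * (fun s => (enorm (derive1 c s))^-1).
  by apply/funext => s; rewrite tangentialE.
apply: (is_derive_eq (is_deriveM d1 d2)); rewrite tangential_deriveE /GRing.scale /=.
have -> : dot (c t - foot p (c t) (derive1 c t)) (derive1n 2 c t) =
  dot (c t - p) (derive1n 2 c t) - dot (c t - p) (derive1 c t) /
    enorm (derive1 c t) ^+ 2 * dot (derive1 c t) (derive1n 2 c t).
  by rewrite /foot -enorm_sqr opprD addrA; set l := _ / _;
    rewrite [LHS]dotBl [in LHS]dotZl.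
rewrite -enorm_sqr; move: vn0.
by move: (enorm _) (dot _ _) (dot _ _) (dot _ _) => n m1 m2 m3 n0; field.
Qed.

Lemma dist_deriv2E x c : smooth_curve c -> c 0 != x ->
  dot (c 0 - x) (derive1 c 0) = 0 ->
  dist_deriv2 x c = (dot (derive1 c 0) (derive1 c 0) +
     dot (c 0 - x) (derive1n 2 c 0)) / enorm (c 0 - x).
Proof.
move=> sc c0x perp; rewrite /dist_deriv2.
have dc : is_curve_derive c (derive1 c).
  by have := smooth_curve_derive sc 0; rewrite derive1n0 derive1n1.
have dc1 : is_curve_derive (derive1 c) (derive1n 2 c).
  by have := smooth_curve_derive sc 1; rewrite derive1n1.
have dcx := is_curve_deriveB x dc.
have n0 : enorm (c 0 - x) != 0 by rewrite enorm_eq0 subr_eq0.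
have ct0 : c 0 - x != 0 by rewrite subr_eq0.
have dn := is_derive_enorm dcx ct0.
(* The norm is differentiable only off the origin, so the first derivative of the distance has its
   closed form only near 0; that is enough to differentiate once more. *)
have near0 : \forall t \near (0 : R), derive1 (fun t => enorm (c t - x)) t =
    dot (c t - x) (derive1 c t) / enorm (c t - x).
  have /= cn := is_derive_continuous dn.
  have : \forall t \near (0 : R), enorm (c t - x) != 0.
    exact: (cvgr_neq0 _ cn n0).
  apply: filterS => t tn0; rewrite derive1E.
  apply: (@derive_val _ _ _ _ _ _ _ (is_derive_enorm dcx _)).
  by rewrite -enorm_eq0.
rewrite -[derive1n 2 _]/(derive1n 1.+1 _) derive1nS derive1n1 derive1E.
rewrite (near_eq_derive _ near0).
have d1 := is_derive_dot 0 dcx dc1.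
have d2 := is_derive_inv (f := fun s => enorm (c s - x)) n0 dn.
have -> : (fun s => dot (c s - x) (derive1 c s) / enorm (c s - x)) =
  (fun s => dot (c s - x) (derive1 c s)) * (fun s => (enorm (c s - x))^-1).
  by [].
rewrite (@derive_val _ _ _ _ _ _ _ (is_deriveM d1 d2)) /GRing.scale /= perp.
by rewrite mul0r add0r mulrC.
Qed.

End SpeedCalculus.

(** * One-sided boundary curves, supporting lines and quadratic growth *)

Section Branches.
Variable R : realType.
Local Notation plane := 'rV[R]_2.
Implicit Types (K : set plane) (p q u v x z n m : plane) (c : R -> plane).

Lemma bdE K z : convex_body K -> bd K z <-> K z /\ ~ K° z.
Proof.
case=> cK _ _; have clK : closed K by apply: compact_closed => //; exact: norm_hausdorff.
by rewrite /bd -(closure_id K).1.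
Qed.

Lemma bd_sub K z : convex_body K -> bd K z -> K z.
Proof. by move=> bK /(bdE _ bK)[]. Qed.

(** One-sided, so that the same statements apply at corners and to either side of a smooth point. *)
Definition branch K q c :=
  [/\ smooth_curve c, c 0 = q, derive1 c 0 != 0 &
      exists2 e : R, 0 < e & forall s, 0 <= s < e -> bd K (c s)].

Lemma smooth_curve_derive1 c : smooth_curve c -> is_curve_derive c (derive1 c).
Proof. by move=> sc; have := smooth_curve_derive sc 0; rewrite derive1n0 derive1n1. Qed.

Lemma smooth_curve_derive2 c : smooth_curve c ->
  is_curve_derive (derive1 c) (derive1n 2 c).
Proof. by move=> sc; have := smooth_curve_derive sc 1; rewrite derive1n1. Qed.

Lemma smooth_curve_derive3 c : smooth_curve c ->
  is_curve_derive (derive1n 2 c) (derive1n 3 c).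
Proof. by move=> sc; exact: (smooth_curve_derive sc 2). Qed.

Lemma branch_mem K q c : convex_body K -> branch K q c -> bd K q.
Proof.
by move=> bK [_ <- _ [e e0 he]]; apply: he; rewrite lexx e0.
Qed.

(* An interior point on the tangent line would make interior points of the
   cone over a ball around it belong to the boundary: for [l > 0] such a point
   is [c s] itself, for [l < 0] it is [q]. *)
Lemma branch_tangent_not_interior K q c (l : R) :
  convex_body K -> branch K q c -> ~ K° (q + l *: derive1 c 0).
Proof.
move=> bK bc Km; have [cptK cK _] := bK.
have [Kq nKq] := (bdE _ bK).1 (branch_mem bK bc).
case: bc => sc c0 v0 [e e0 he].
set v := derive1 c 0 in v0 Km *.
have [l0|lN0] := eqVneq l 0; first by apply: nKq; rewrite l0 scale0r addr0 in Km.
have [r r0 hr] := (interiorEP _ _).1 Km.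
have Nl0 : 0 < `|l| by rewrite normr_gt0.
have eta0 : 0 < r / (4 * `|l|) by rewrite divr_gt0 // mulr_gt0.
have [d d0 hd] := curve_expansion 0 (smooth_curve_derive1 sc) eta0.
pose s := Num.min (Num.min (d / 2) (e / 2)) `|l|.
have s0 : 0 < s by rewrite !lt_min !divr_gt0 //.
have sd : s < d.
  by rewrite /s !gt_min ltr_pdivrMr // ltr_pMr // ltr1n.
have se : s < e.
  by rewrite /s !gt_min (ltr_pdivrMr _ e) // ltr_pMr // ltr1n orbT.
have sl : s <= `|l| by rewrite ge_min lexx orbT.
pose z := c s; pose m' := q + (l / s) *: (z - q).
have [Kz nKz] := (bdE _ bK).1 (he s (introT andP (conj (ltW s0) se))).
have sN0 : s != 0 by rewrite gt_eqF.
have Km' : K° m'.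
  apply/interiorEP; exists (r / 2); first by rewrite divr_gt0.
  move=> y hy; apply: hr.
  have mm' : enorm (m' - (q + l *: v)) <= r / 4.
    have -> : m' - (q + l *: v) = (l / s) *: (z - q - s *: v).
      by apply: row2P; rewrite !mxE; field.
    rewrite enormZ normrM normfV (gtr0_norm s0).
    have := hd s; rewrite add0r (gtr0_norm s0) c0 => /(_ sd) h.
    have -> : r / 4 = `|l| / s * (r / (4 * `|l|) * s).
      by field; apply/andP; split => //; rewrite normr_eq0.
    by rewrite ler_wpM2l // divr_ge0 // ltW.
  apply: le_lt_trans (enormB_tri y m' _) _.
  by move: hy mm' r0; lra.
have [lpos|lneg] := ltP 0 l.
  apply: nKz; have -> : c s = (s / l) *: m' + (1 - s / l) *: q.
    by apply: row2P; rewrite !mxE /z; field; rewrite sN0 lN0.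
  apply: convex_interior => //.
  by rewrite divr_gt0 // ler_pdivrMr // mul1r -(gtr0_norm lpos).
have {}lneg : l < 0 by rewrite lt_neqAle lN0.
apply: nKq; pose k := s / (s - l).
have sl0 : 0 < s - l by lra.
have -> : q = k *: m' + (1 - k) *: z.
  apply: row2P; rewrite !mxE /k; field; by rewrite sN0 gt_eqF.
apply: convex_interior => //.
by rewrite divr_gt0 // ler_pdivrMr // mul1r; lra.
Qed.

(** If [z] were strictly beyond the tangent line, the segment from the interior point [p] to [z]
    would meet that line in an interior point of [K]. *)
Lemma branch_support K p q c n : convex_body K -> K° p -> branch K q c ->
  dot n (derive1 c 0) = 0 -> 0 < dot n (p - q) ->
  forall z, K z -> 0 <= dot n (z - q).
Proof.
move=> bK Kp bc nv np z Kz; rewrite leNgt; apply/negP => nz.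
have [_ cK _] := bK; have v0 : derive1 c 0 != 0 by case: bc.
have n0 : n != 0 by apply: contraTneq np => ->; rewrite dot0l ltxx.
set a := dot n (p - q) in np; set b := dot n (z - q) in nz.
(* The weight of [p] at the point where the segment crosses the tangent line. *)
pose k := (- b) / (a - b).
have ab : 0 < a - b by lra.
have k01 : 0 < k <= 1 by rewrite divr_gt0 ?ler_pdivrMr ?mul1r //; lra.
have Km := convex_interior cK Kp Kz k01.
have [] := @perp_collinear _ n (k *: p + (1 - k) *: z - q) _ n0 v0 nv.
  have -> : dot n (k *: p + (1 - k) *: z - q) = k * a + (1 - k) * b.
    by rewrite /a /b !dotBr dotDr !dotZr; ring.
  by rewrite /k; field; rewrite gt_eqF.
move=> l e; apply: (@branch_tangent_not_interior K q c l bK bc).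
by rewrite -e addrC subrK.
Qed.

(** Otherwise the interior point [p] itself would lie on the tangent line. *)
Lemma foot_neq K p q c : convex_body K -> K° p -> branch K q c ->
  foot p q (derive1 c 0) != q.
Proof.
move=> bK Kp bc; have v0 : derive1 c 0 != 0 by case: bc.
apply/eqP => e.
apply: (@branch_tangent_not_interior K q c
  (- (dot (q - p) (derive1 c 0) / dot (derive1 c 0) (derive1 c 0))) bK bc).
by rewrite -{1}e /foot scaleNr addrK.
Qed.

Lemma foot_support K p q c : convex_body K -> K° p -> branch K q c ->
  forall z, K z -> 0 <= dot (foot p q (derive1 c 0) - q) (z - q).
Proof.
move=> bK Kp bc; have v0 : derive1 c 0 != 0 by case: bc.
apply: (branch_support bK Kp bc); first exact: foot_perp.
by rewrite foot_dot // dot_gt0 subr_eq0 (foot_neq bK Kp bc).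
Qed.

Lemma foot_equilibrium K p q c : convex_body K -> K° p -> branch K q c ->
  equilibrium K (foot p q (derive1 c 0)) q.
Proof.
move=> bK Kp bc; have bdq := branch_mem bK bc; split => //.
split; first exact: bd_sub bdq.
left => z Kz; rewrite -opprB dotNl oppr_le0.
exact: (foot_support bK Kp bc).
Qed.

(** If [m / 2 < a], the second-order expansion contradicts the growth at a small positive [s]. One
    side suffices because the linear term vanishes. *)
Lemma derive2_ge0 (f f1 : R -> R) (m e a : R) :
  (forall t : R, is_derive t 1 f (f1 t)) -> is_derive (0 : R) 1 f1 m ->
  f1 0 = 0 -> 0 < e ->
  (forall s, 0 <= s < e -> a * s ^+ 2 <= f s - f 0) -> a <= m / 2.
Proof.
move=> df df1 f10 e0 hf; rewrite leNgt; apply/negP => am.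
have eta0 : 0 < (a - m / 2) / 2 by lra.
have [d d0 hd] := taylor2 df df1 eta0.
pose s := Num.min (d / 2) (e / 2).
have s0 : 0 < s by rewrite lt_min !divr_gt0.
have sd : s < d by rewrite gt_min ltr_pdivrMr // ltr_pMr // ltr1n.
have se : s < e by rewrite gt_min (ltr_pdivrMr _ e) // ltr_pMr // ltr1n orbT.
have h1 := hf s (introT andP (conj (ltW s0) se)).
have := hd s; rewrite (gtr0_norm s0) => /(_ sd).
rewrite f10 mul0r subr0 ler_norml => /andP[_ h2].
have s2 : 0 < s ^+ 2 by rewrite exprn_gt0.
have : (a - m / 2) / 2 * s ^+ 2 > 0 by rewrite mulr_gt0.
lra.
Qed.

(** This is the sign of the curvature: the height of [c] over the supporting line is nonnegative to
    the right of 0 and vanishes to first order at 0. *)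
Lemma branch_convex K p q c : convex_body K -> K° p -> branch K q c ->
  0 <= dot (foot p q (derive1 c 0) - q) (derive1n 2 c 0).
Proof.
move=> bK Kp bc; have [sc c0 v0 [e e0 he]] := bc.
set n := foot _ _ _ - q.
have d1 := smooth_curve_derive1 sc; have d2 := smooth_curve_derive2 sc.
pose f t := dot n (c t - q).
pose f1 t := dot n (derive1 c t).
have df (t : R) : is_derive t 1 f (f1 t).
  have D := is_derive_dot t (is_curve_derive_cst n) (is_curve_deriveB q d1).
  by apply: (is_derive_eq D); rewrite /cst dot0l add0r.
have df1 : is_derive (0 : R) 1 f1 (dot n (derive1n 2 c 0)).
  have D := is_derive_dot 0 (is_curve_derive_cst n) d2.
  by apply: (is_derive_eq D); rewrite /cst dot0l add0r.
suff : 0 <= dot n (derive1n 2 c 0) / 2 by rewrite pmulr_lge0 ?invr_gt0.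
apply: (derive2_ge0 df df1 _ e0); first exact: foot_perp.
move=> s hs; rewrite /f c0 subrr dot0r subr0 mul0r.
by apply: (foot_support bK Kp bc); apply: bd_sub => //; exact: he.
Qed.

Lemma branch_tangent_direction K q c : branch K q c ->
  tangent_direction K q (derive1 c 0).
Proof.
move=> [sc c0 v0 [e e0 he]]; split=> //; exists c; split=> //.
near=> t; apply: he; apply/andP; split; first by apply: ltW; near: t; exact: nbhs_right_gt.
by near: t; exact: nbhs_right_lt.
Unshelve. all: by end_near. Qed.

(* The second derivative along [c] of [|z - x|^2 / 2] at [c 0]. *)
Definition half_sqdist_deriv2 x c : R :=
  dot (derive1 c 0) (derive1 c 0) + dot (c 0 - x) (derive1n 2 c 0).

(** Fermat's rule for the height of [c] over the line with normal [n]. It relies on both signs of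
    the parameter; from one side only an inequality would follow. *)
Lemma local_param_support K q n c : local_param K q c ->
  (forall z, bd K z -> 0 <= dot n (z - q)) -> dot n (derive1 c 0) = 0.
Proof.
move=> [sc c0 _ /nbhs_normP[e /= e0 he] _] nK.
have d1 := smooth_curve_derive1 sc.
pose f t := dot n (c t - q).
have df : is_derive (0 : R) 1 f (dot n (derive1 c 0)).
  have D := is_derive_dot 0 (is_curve_derive_cst n) (is_curve_deriveB q d1).
  by apply: (is_derive_eq D); rewrite /cst dot0l add0r.
apply/eqP/negPn/negP => l0; set l := dot n _ in l0 df.
have l20 : 0 < `|l| / 2 by rewrite divr_gt0 // normr_gt0.
have [d d0 hd] := is_derive_expansion df l20.
pose s := Num.min (d / 2) (e / 2).
have s0 : 0 < s by rewrite lt_min !divr_gt0.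
have sd : s < d by rewrite gt_min ltr_pdivrMr // ltr_pMr // ltr1n.
have se : s < e by rewrite gt_min (ltr_pdivrMr _ e) // ltr_pMr // ltr1n orbT.
have f_ge0 t : `|t| < e -> 0 <= f t.
  by move=> te; apply/nK/he; rewrite /ball_ /= sub0r normrN.
have f0 : f 0 = 0 by rewrite /f c0 subrr dot0r.
have h1 := f_ge0 s; have h2 := f_ge0 (- s).
have := hd s; have := hd (- s); rewrite normrN (gtr0_norm s0) !add0r f0 !subr0.
rewrite normrN gtr0_norm // in h2 h1 *.
move=> /(_ sd); rewrite ler_norml => /andP[_ a1].
move=> /(_ sd); rewrite ler_norml => /andP[_ a2].
have {}h1 := h1 se; have {}h2 := h2 se.
have [lp|ln] := ltP 0 l.
  have : 0 < l * s by rewrite mulr_gt0.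
  by move: a1; rewrite gtr0_norm //; lra.
have ln' : l < 0 by rewrite lt_neqAle l0.
have : l * s < 0 by rewrite nmulr_rlt0.
by move: a2; rewrite ltr0_norm //; lra.
Qed.

(** A form of nondegeneracy that mentions no parametrization: [sg] is 1 at a minimum of the distance
    from [x] and -1 at a maximum. By the last clause of [local_param] every boundary point near [q]
    is some [c t], so the expansion along [c] controls all of them. *)
Lemma local_param_growth K q x c (sg : R) : local_param K q c ->
  dot (q - x) (derive1 c 0) = 0 -> 0 < sg * half_sqdist_deriv2 x c ->
  exists a e : R, [/\ 0 < a, 0 < e & forall z, bd K z -> enorm (z - q) < e ->
    a * dot (z - q) (z - q) <=
      sg * (dot (z - x) (z - x) - dot (q - x) (q - x))].
Proof.
move=> [sc c0 v0 _ hz] perp m0.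
have d1 := smooth_curve_derive1 sc; have d2 := smooth_curve_derive2 sc.
set m := half_sqdist_deriv2 x c in m0.
pose f t := sg * dot (c t - x) (c t - x).
pose f1 t := sg * (2 * dot (c t - x) (derive1 c t)).
have df (t : R) : is_derive t 1 f (f1 t).
  have d := is_curve_deriveB x d1.
  have D := is_deriveZ sg (is_derive_dot t d d).
  apply: (is_derive_eq D); rewrite /f1 /GRing.scale /= (dotC (c t - x)).
  by ring.
have df1 : is_derive (0 : R) 1 f1 (2 * (sg * m)).
  have d := is_curve_deriveB x d1.
  have D := is_deriveZ (2 * sg) (is_derive_dot 0 d d2).
  have -> : f1 = (2 * sg) \*: (fun t => dot (c t - x) (derive1 c t)).
    by apply/funext => t; rewrite /f1 /= /GRing.scale /=; ring.
  by apply: (is_derive_eq D); rewrite /m /half_sqdist_deriv2 /GRing.scale /=; ring.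
have f10 : f1 0 = 0 by rewrite /f1 c0 perp !mulr0.
have eta0 : 0 < sg * m / 2 by rewrite divr_gt0.
have [da da0 hda] := taylor2 df df1 eta0.
have [db db0 hdb] := curve_expansion 0 d1 (@ltr01 R).
(* [M] bounds |z - q| / |t| along the curve, which turns growth in the parameter into growth in the
   distance from [q]. *)
pose M := enorm (derive1 c 0) + 1.
have M0 : 0 < M by rewrite ltr_wpDl ?enorm_ge0.
have d0 : 0 < Num.min da db by rewrite lt_min da0.
have /nbhs_enormP[e e0 he] := hz _ d0.
exists (sg * m / 2 / M ^+ 2), e; split => //; first by rewrite divr_gt0 // exprn_gt0.
move=> z bz zq; have [t] := he z zq bz; rewrite lt_min => /andP[ta tb] ctz.
have h1 := hda t ta; have h2 := hdb t tb.
rewrite add0r c0 mul1r in h2.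
have zt : enorm (z - q) <= M * `|t|.
  rewrite -ctz -[c t - q](subrK (t *: derive1 c 0)).
  apply: le_trans (enormD _ _) _; rewrite enormZ /M mulrDl mul1r.
  by move: h2; lra.
have zt2 : dot (z - q) (z - q) <= M ^+ 2 * t ^+ 2.
  rewrite -enorm_sqr -[t ^+ 2]real_normK ?num_real // -exprMn.
  by rewrite ler_pXn2r // ?nnegrE ?enorm_ge0 // mulr_ge0 // ltW.
move: h1; rewrite f10 mul0r subr0 ler_norml => /andP[h1 _].
have -> : sg * (dot (z - x) (z - x) - dot (q - x) (q - x)) = f t - f 0.
  by rewrite /f ctz c0; ring.
apply: (@le_trans _ _ (sg * m / 2 * t ^+ 2)).
  rewrite -mulrA ler_wpM2l //; first exact: ltW.
  by rewrite mulrC ler_pdivrMr ?exprn_gt0 // mulrC.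
have : 0 <= sg * m * t ^+ 2 by rewrite mulr_ge0 ?sqr_ge0 // ltW.
by move: h1; lra.
Qed.

(* The quadratic growth transfers the sign of the second derivative from one
   parametrization to another, without comparing the parametrizations. *)
Lemma branch_growth K q x c (sg a e : R) : branch K q c ->
  dot (q - x) (derive1 c 0) = 0 -> 0 < a -> 0 < e ->
  (forall z, bd K z -> enorm (z - q) < e -> a * dot (z - q) (z - q) <=
      sg * (dot (z - x) (z - x) - dot (q - x) (q - x))) ->
  0 < sg * half_sqdist_deriv2 x c.
Proof.
move=> [sc c0 v0 [e' e'0 he']] perp a0 e0 hz.
have d1 := smooth_curve_derive1 sc; have d2 := smooth_curve_derive2 sc.
set m := half_sqdist_deriv2 x c.
pose g t := sg * dot (c t - x) (c t - x) - a * dot (c t - q) (c t - q).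
pose g1 t := 2 * (sg * dot (c t - x) (derive1 c t) -
                  a * dot (c t - q) (derive1 c t)).
have dg (t : R) : is_derive t 1 g (g1 t).
  have dx := is_curve_deriveB x d1; have dq := is_curve_deriveB q d1.
  have D := is_deriveB (is_deriveZ sg (is_derive_dot t dx dx))
                       (is_deriveZ a (is_derive_dot t dq dq)).
  apply: (is_derive_eq D); rewrite /g1 /GRing.scale /=.
  by rewrite (dotC (c t - x)) (dotC (c t - q)); ring.
pose vv := dot (derive1 c 0) (derive1 c 0).
have dg1 : is_derive (0 : R) 1 g1 (2 * (sg * m - a * vv)).
  have dx := is_curve_deriveB x d1; have dq := is_curve_deriveB q d1.
  have D := is_deriveB (is_deriveZ (2 * sg) (is_derive_dot 0 dx d2))
                       (is_deriveZ (2 * a) (is_derive_dot 0 dq d2)).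
  have -> : g1 = (2 * sg) \*: (fun t => dot (c t - x) (derive1 c t)) -
                 (2 * a) \*: (fun t => dot (c t - q) (derive1 c t)).
    by apply/funext => t; rewrite /g1 !fctE /= /GRing.scale /=; ring.
  apply: (is_derive_eq D).
  rewrite /m /half_sqdist_deriv2 /vv /GRing.scale /= c0 subrr dot0l.
  by ring.
have g10 : g1 0 = 0 by rewrite /g1 c0 perp subrr dot0l !mulr0 subrr mulr0.
have [db db0 hdb] := curve_expansion 0 d1 (@ltr01 R).
pose M := enorm (derive1 c 0) + 1.
have M0 : 0 < M by rewrite ltr_wpDl ?enorm_ge0.
pose e2 := Num.min e' (Num.min db (e / M)).
have e20 : 0 < e2 by rewrite !lt_min e'0 db0 divr_gt0.
have : 0 <= 2 * (sg * m - a * vv) / 2.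
  apply: (derive2_ge0 dg dg1 g10 e20) => s /andP[s0].
  rewrite !lt_min => /and3P[se' sdb seM].
  have bcs : bd K (c s) by apply: he'; rewrite s0.
  have cse : enorm (c s - q) < e.
    have := hdb s; rewrite add0r c0 mul1r ger0_norm // => /(_ sdb) h.
    rewrite -[c s - q](subrK (s *: derive1 c 0)).
    apply: le_lt_trans (enormD _ _) _; rewrite enormZ ger0_norm //.
    have : M * s < e by rewrite mulrC -ltr_pdivlMr.
    by rewrite /M mulrDl mul1r; move: h; lra.
  have := hz _ bcs cse.
  rewrite mul0r /g c0 subrr dot0l mulr0 subr0.
  lra.
have : 0 < a * vv by rewrite mulr_gt0 // dot_gt0.
lra.
Qed.

End Branches.

(** * Equilibria with respect to feet: smoothness and sign of the derivative *)

Section EquilibriumBranches.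
Variable R : realType.
Local Notation plane := 'rV[R]_2.
Implicit Types (K : set plane) (p q u v x z n m : plane) (c : R -> plane).

Lemma tangential_derive0E p c :
  tangential_derive p c 0 =
    half_sqdist_deriv2 (foot p (c 0) (derive1 c 0)) c / enorm (derive1 c 0).
Proof. exact: tangential_deriveE. Qed.

Lemma foot_enorm p c : derive1 c 0 != 0 ->
  enorm (foot p (c 0) (derive1 c 0) - p) = `|tangential p c 0|.
Proof. by move=> v0; rewrite foot_dist // tangentialE. Qed.

(** Both tangent vectors are orthogonal to the normal of the supporting line at [q], by Fermat's
    rule for [c0] and by construction of the foot for [c]. *)
Lemma smooth_branch_collinear K p q c0 c : convex_body K -> K° p ->
  local_param K q c0 -> branch K q c ->
  exists2 l, l != 0 & derive1 c 0 = l *: derive1 c0 0.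
Proof.
move=> bK Kp lc0 bc; have [_ _ v00 _ _] := lc0; have [_ _ v0 _] := bc.
set n := foot p q (derive1 c 0) - q.
have n0 : n != 0 by rewrite subr_eq0 (foot_neq bK Kp bc).
have nv0 : dot n (derive1 c0 0) = 0.
  apply: (local_param_support lc0) => z /(bd_sub bK).
  exact: (foot_support bK Kp bc).
have [l e] := perp_collinear n0 v00 nv0 (foot_perp _ _ v0).
by exists l => //; apply: contra_neq v0 => l0; rewrite e l0 scale0r.
Qed.

Lemma branches_collinear K p q c0 c c' : convex_body K -> K° p ->
  local_param K q c0 -> branch K q c -> branch K q c' ->
  exists2 l, l != 0 & derive1 c' 0 = l *: derive1 c 0.
Proof.
move=> bK Kp lc0 bc bc'.
have [l l0 e] := smooth_branch_collinear bK Kp lc0 bc.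
have [l' l'0 e'] := smooth_branch_collinear bK Kp lc0 bc'.
exists (l' / l); first by rewrite mulf_neq0 // invr_neq0.
by rewrite e e' scalerA divfK.
Qed.

Lemma tangential_derive_sign K p q c0 c (sg : R) : convex_body K -> K° p ->
  local_param K q c0 -> branch K q c ->
  0 < sg * half_sqdist_deriv2 (foot p q (derive1 c 0)) c0 ->
  forall c', branch K q c' -> 0 < sg * tangential_derive p c' 0.
Proof.
move=> bK Kp lc0 bc m0 c' bc'; have [_ cq v0 _] := bc.
have [_ c'q v'0 _] := bc'.
set x := foot p q (derive1 c 0) in m0.
have [l l0 e] := branches_collinear bK Kp lc0 bc bc'.
have xx' : foot p q (derive1 c' 0) = x by rewrite e footZ.
have perp : dot (q - x) (derive1 c0 0) = 0.
  rewrite -opprB dotNl; apply/eqP; rewrite oppr_eq0; apply/eqP.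
  apply: (local_param_support lc0) => z /(bd_sub bK).
  exact: (foot_support bK Kp bc).
have [a [d [a0 d0 hz]]] := local_param_growth lc0 perp m0.
have perp' : dot (q - x) (derive1 c' 0) = 0.
  rewrite e dotZr -opprB dotNl.
  by rewrite /x (foot_perp _ _ v0) oppr0 mulr0.
rewrite tangential_derive0E c'q xx'.
have h1 := branch_growth bc' perp' a0 d0 hz.
have h2 : 0 < enorm (derive1 c' 0) by rewrite enorm_gt0.
by rewrite mulrA; apply: divr_gt0.
Qed.

(** The foot of [p] lies within [r] of [p] and has an equilibrium at [q], which is therefore
    nondegenerate. It cannot be of the corner kind, because the foot is seen from [q] at a right
    angle to the branch, while a corner asks for acute angles. *)
Lemma equilibrium_smooth K p q c (r : R) : convex_body K -> K° p ->
  (forall x, enorm (x - p) < r -> only_nondegenerate K x) ->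
  branch K q c -> `|tangential p c 0| < r ->
  exists2 c0, local_param K q c0 &
    half_sqdist_deriv2 (foot p q (derive1 c 0)) c0 != 0.
Proof.
move=> bK Kp rob bc wr; have [_ cq v0 _] := bc.
set x := foot p q _.
have xp : enorm (x - p) < r by rewrite /x -cq foot_enorm.
have xq : x != q := foot_neq bK Kp bc.
have eqx := foot_equilibrium bK Kp bc.
have [[_ [e|[c0 lc0 d0]]]|[_ ang]] := rob x xp q eqx.
- by rewrite e eqxx in xq.
- have [sc0 c0q v00 _ _] := lc0; exists c0 => //.
  have perp : dot (q - x) (derive1 c0 0) = 0.
    rewrite -opprB dotNl; apply/eqP; rewrite oppr_eq0; apply/eqP.
    apply: (local_param_support lc0) => z /(bd_sub bK).
    exact: (foot_support bK Kp bc).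
  rewrite dist_deriv2E ?c0q 1?eq_sym // in d0.
  by apply: contra_neq d0; rewrite /half_sqdist_deriv2 c0q => ->; rewrite mul0r.
- have := ang _ (branch_tangent_direction bc).
  by rewrite foot_perp // ltxx.
Qed.

Lemma curve_direction c v : smooth_curve c -> 0 < dot (derive1 c 0) v ->
  exists2 d : R, 0 < d & forall h, `|h| < d ->
    (0 < h -> 0 < dot (c h - c 0) v) /\ (h < 0 -> dot (c h - c 0) v < 0).
Proof.
move=> sc; set l := dot _ _ => l0.
have d1 := smooth_curve_derive1 sc.
have df : is_derive (0 : R) 1 (fun t => dot (c t - c 0) v) l.
  have D := is_derive_dot 0 (is_curve_deriveB (c 0) d1) (is_curve_derive_cst v).
  by apply: (is_derive_eq D); rewrite /cst dot0r addr0.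
have l20 : 0 < l / 2 by rewrite divr_gt0.
have [d d0 hd] := is_derive_expansion df l20.
exists d => // h hh; have := hd h hh.
rewrite add0r subrr dot0l subr0 ler_norml => /andP[a1 a2].
split=> h0.
  have : 0 < l * h by rewrite mulr_gt0.
  by move: a1; rewrite gtr0_norm //; lra.
have : l * h < 0 by rewrite pmulr_rlt0.
by move: a2; rewrite ltr0_norm //; lra.
Qed.

(* The two branches of a smooth boundary leave a point in opposite
   directions: otherwise nothing would cover one end of the smooth
   parametrization. *)
Lemma branches_opposite K p q c0 cr cl : convex_body K -> K° p ->
  local_param K q c0 -> branch K q cr -> branch K q cl ->
  (forall e : R, 0 < e -> \forall z \near q, bd K z ->
     exists s, 0 <= s < e /\ (z = cr s \/ z = cl s)) ->
  exists2 l : R, 0 < l & derive1 cl 0 = - (l *: derive1 cr 0).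
Proof.
move=> bK Kp lc0 br bl cov.
have [l l0 e] := branches_collinear bK Kp lc0 br bl.
have [lneg|lpos] := ltP l 0.
  by exists (- l); rewrite ?oppr_gt0 // scaleNr opprK.
have {l0}lpos : 0 < l by rewrite lt_def l0.
(* If [cl] and [cr] leave [q] to the same side of the normal line, all boundary points near [q] are
   on that side, while [c0] has points strictly on both. *)
exfalso.
have [scr crq vr0 _] := br; have [scl clq vl0 _] := bl.
set v := derive1 cr 0 in vr0 e.
have vv : 0 < dot v v by rewrite dot_gt0.
have [sc0 c0q v00 /nbhs_normP[e0 /= e00 he0] _] := lc0.
have [k k0 ek] := smooth_branch_collinear bK Kp lc0 br.
have [dr dr0 hdr] : exists2 d : R, 0 < d & forall s, 0 <= s < d -> 0 <= dot (cr s - q) v.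
  have [|d d0 hd] := @curve_direction cr v scr; first exact: vv.
  exists d => // s /andP[s0 sd]; have [->|sN0] := eqVneq s 0.
    by rewrite crq subrr dot0l.
  have s_gt0 : 0 < s by rewrite lt_def sN0.
  by rewrite -crq; apply/ltW; apply: (hd s _).1; rewrite // ger0_norm.
have [dl dl0 hdl] : exists2 d : R, 0 < d & forall s, 0 <= s < d -> 0 <= dot (cl s - q) v.
  have [|d d0 hd] := @curve_direction cl v scl.
    by rewrite e dotZl; exact: mulr_gt0 lpos vv.
  exists d => // s /andP[s0 sd]; have [->|sN0] := eqVneq s 0.
    by rewrite clq subrr dot0l.
  have s_gt0 : 0 < s by rewrite lt_def sN0.
  by rewrite -clq; apply/ltW; apply: (hd s _).1; rewrite // ger0_norm.
have dm0 : 0 < Num.min dr dl by rewrite lt_min dr0.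
have /nbhs_enormP[ez ez0 hez] := cov _ dm0.
have [|d d0 hd] := @curve_direction c0 (k *: v) sc0.
  rewrite dotZr dotC /v ek dotZl mulrA -expr2.
  by rewrite mulr_gt0 ?dot_gt0 // exprn_even_gt0 //= k0.
have [da da0 hda] := curve_expansion 0 (smooth_curve_derive1 sc0) (@ltr01 R).
pose M := enorm (derive1 c0 0) + 1.
have M0 : 0 < M by rewrite ltr_wpDl ?enorm_ge0.
pose h := Num.min (Num.min (d / 2) (e0 / 2)) (Num.min (da / 2) (ez / M / 2)).
have h0 : 0 < h by rewrite !lt_min !divr_gt0.
have half (a : R) : 0 < a -> a / 2 < a by move=> a0; rewrite ltr_pdivrMr // ltr_pMr // ltr1n.
have hlt_d : h < d by rewrite !gt_min half.
have hlt_e : h < e0 by rewrite !gt_min (half e0) ?orbT.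
have hlt_a : h < da by rewrite !gt_min (half da) ?orbT.
have hlt_z : h < ez / M by rewrite !gt_min (half (ez / M)) ?orbT ?divr_gt0.
have close t : `|t| = h -> enorm (c0 t - q) < ez.
  move=> th; have := hda t; rewrite th add0r c0q mul1r => /(_ hlt_a) a1.
  rewrite -[c0 t - q](subrK (t *: derive1 c0 0)).
  apply: le_lt_trans (enormD _ _) _; rewrite enormZ th.
  have : M * h < ez by rewrite mulrC -ltr_pdivlMr.
  by rewrite /M mulrDl mul1r; move: a1; lra.
have inbd t : `|t| = h -> bd K (c0 t).
  by move=> th; apply: he0; rewrite /ball_ /= sub0r normrN th.
have pos t : `|t| = h -> 0 <= dot (c0 t - q) v.
  move=> th; have [s [/andP[s0]]] := hez _ (close t th) (inbd t th).
  rewrite lt_min => /andP[sr sl] [] ->.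
    by apply: hdr; rewrite s0.
  by apply: hdl; rewrite s0.
have n1 : `|h| = h by rewrite gtr0_norm.
have n2 : `|- h| = h by rewrite normrN.
have p1 := pos _ n1; have p2 := pos _ n2.
have n1d : `|h| < d by rewrite n1.
have n2d : `|- h| < d by rewrite n2.
have [q1 _] := hd _ n1d; have [_ q2] := hd _ n2d.
have h0' : - h < 0 by rewrite oppr_lt0.
have {}q1 := q1 h0; have {}q2 := q2 h0'.
rewrite !dotZr !c0q in q1 q2.
have [kp|kn] := ltP 0 k.
  by move: q2; rewrite pmulr_rlt0 // ltNge p2.
by move: q1; rewrite ltNge mulr_le0_ge0.
Qed.

End EquilibriumBranches.

(** * One-sided pieces of a closed curve with their arc length *)

Section Germs.
Variable R : realType.
Local Notation plane := 'rV[R]_2.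
Implicit Types (K : set plane) (p q v x z n m : plane) (c : R -> plane) (u : R).

(** Continuity is read off from differentiability, which is why the third derivative of the curve
    appears. *)
Lemma tangential_derive_continuous p c : smooth_curve c -> derive1 c 0 != 0 ->
  {for 0, continuous (tangential_derive p c)}.
Proof.
move=> sc v0.
have d1 := smooth_curve_derive1 sc; have d2 := smooth_curve_derive2 sc.
have d3 := smooth_curve_derive3 sc; have dp := is_curve_deriveB p d1.
have vv0 : dot (derive1 c 0) (derive1 c 0) != 0 by rewrite dot_eq0.
have vn0 : enorm (derive1 c 0) != 0 by rewrite enorm_eq0.
have e1 := is_derive_dot 0 d2 d2.
have e2 := is_derive_dot 0 dp d3.
have e3 := is_derive_dot 0 dp d2.
have e4 := is_derive_inv (f := fun s => dot (derive1 c s) (derive1 c s)) vv0 e1.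
have e5 := is_derive_dot 0 d2 d3.
have e6 := is_derive_inv (f := fun s => enorm (derive1 c s)) vn0
  (is_derive_enorm d2 v0).
have D := is_deriveM (is_deriveB (is_deriveD e1 e2)
  (is_deriveM (is_deriveM e3 e4) e5)) e6.
have := is_derive_continuous D; set F := (X in {for _, continuous X}).
suff -> : tangential_derive p c = F by [].
apply/funext => t; rewrite tangential_deriveE /foot opprD addrA.
rewrite /F !fctE; congr (_ * _); set l := dot (c t - p) _ / _.
by rewrite [in LHS]dotBl [in LHS]dotZl addrA.
Qed.

Lemma tangential_monotone p c (sg e : R) : smooth_curve c -> 0 < e ->
  (forall s, 0 <= s < e -> derive1 c s != 0) ->
  0 < sg * tangential_derive p c 0 ->
  exists2 d : R, 0 < d <= e & forall s t, 0 <= s -> s < t -> t < d ->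
    sg * tangential p c s < sg * tangential p c t.
Proof.
move=> sc e0 v0 m0.
have v00 : derive1 c 0 != 0 by apply: v0; rewrite lexx.
have cm : (fun t => sg * tangential_derive p c t) @ 0 --> sg * tangential_derive p c 0.
  by apply: cvgM; [exact: cvg_cst|exact: (tangential_derive_continuous sc v00)].
have near0 : \forall t \near (0 : R), 0 < sg * tangential_derive p c t.
  exact: (cvgr_gt _ cm).
have [d /= d0 hd] := (nbhs_normP _ _).1 near0.
exists (Num.min d e).
  by rewrite ge_min lexx orbT lt_min d0 e0.
move=> s t s0 st; rewrite lt_min => /andP[td te].
have df (a : R) : a \in `[s, t] ->
    is_derive a 1 (sg \*: tangential p c) (sg * tangential_derive p c a).
  rewrite in_itv /= => /andP[sa at_].
  apply: (is_deriveZ sg (is_derive_tangential p sc _)).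
  by apply: v0; rewrite (le_trans s0 sa) (le_lt_trans at_ te).
apply: (derive_gt0_lt df _ st) => a.
rewrite in_itv /= => /andP[sa at_]; apply: hd.
by rewrite /ball_ /= sub0r normrN ger0_norm ?(le_trans s0) // (le_lt_trans at_).
Qed.

(** [sg] is 1 or -1 according to the side of [u]. On both sides [c] starts at [G u] and [P] measures
    the length travelled away from it, so a single set of estimates serves left and right. *)
Definition germ (G : R -> plane) (Lam : R -> R) (u sg : R) c (P : R -> R) (e : R) :=
  [/\ 0 < e, smooth_curve c,
      (forall s, 0 <= s <= e -> is_derive s 1 P (enorm (derive1 c s))) &
      forall s, 0 <= s <= e -> [/\ G (u + sg * s) = c s, derive1 c s != 0 &
        Lam (u + sg * s) - Lam u = sg * P s]].

(* [G] is a 1-periodic parametrization of the boundary of [K], smooth to the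
   right and to the left of every point, and [Lam] is the arc length along
   [G]. *)
Record circuit K (G : R -> plane) (Lam : R -> R) (L : R) : Prop := Circuit {
  circuit_periodic : forall u, G (u + 1) = G u;
  circuit_length : forall u, Lam (u + 1) = Lam u + L;
  circuit_bd : forall u, bd K (G u);
  circuit_inj : forall s t, `|s - t| < 1 -> G s = G t -> s = t;
  circuit_local : forall u (e : R), 0 < e ->
    \forall z \near G u, bd K z -> exists2 t, `|t - u| < e & G t = z;
  circuit_onto : forall z u, bd K z -> exists2 t, u <= t < u + 1 & G t = z;
  circuit_right : forall u, exists c P e, germ G Lam u 1 c P e;
  circuit_left : forall u, exists c P e, germ G Lam u (-1) c P e }.

(* The right derivative of [G]; it does not depend on the choice of a germ. *)
Definition direction (G : R -> plane) (Lam : R -> R) u : plane :=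
  xget 0 [set v | exists c P e, germ G Lam u 1 c P e /\ derive1 c 0 = v].

End Germs.

(* The signed distance of [p] from the normal line of the curve at [G u], i.e.
   the derivative of the support function with respect to [p]. *)
HB.lock Definition normal_distance (R : realType) (G : R -> 'rV[R]_2)
    (Lam : R -> R) (p : 'rV[R]_2) (u : R) : R :=
  dot (G u - p) (direction G Lam u) / enorm (direction G Lam u).

Section Germ.
Variable R : realType.
Local Notation plane := 'rV[R]_2.
Implicit Types (K : set plane) (p q v x z : plane) (c : R -> plane) (u : R).
Variables (G : R -> plane) (Lam : R -> R).
Implicit Types (P : R -> R) (s t e sg : R).
Local Notation dir := (direction G Lam).
Local Notation nd := (normal_distance G Lam).

Lemma normal_distanceE p u :
  nd p u = dot (G u - p) (dir u) / enorm (dir u).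
Proof. by rewrite normal_distance.unlock. Qed.

Lemma is_derive_affine (f : R -> R) (a b x df : R) :
  is_derive (a + b * x) 1 f df -> is_derive x 1 (fun t => f (a + b * t)) (b * df).
Proof.
move=> D; rewrite mulrC.
have D2 := is_deriveD (is_derive_cst a x 1) (is_deriveZ b (is_derive_id x 1)).
have D3 : is_derive x 1 (fun t => a + b * t) b.
  by apply: (is_derive_eq D2); rewrite add0r /GRing.scale /= mulr1.
exact: (@is_derive1_comp _ f (fun t => a + b * t) x _ _ D D3).
Qed.

Lemma germ0 u sg c P e : germ G Lam u sg c P e -> G u = c 0 /\ sg * P 0 = 0.
Proof.
move=> [e0 _ _ hg]; have [] := hg 0; first by rewrite lexx ltW.
by rewrite mulr0 addr0 subrr => -> _ <-.
Qed.

Lemma germ_shift u c P e s : germ G Lam u 1 c P e -> 0 <= s < e ->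
  germ G Lam (u + s) 1 (fun t => c (s + 1 * t)) (fun t => P (s + 1 * t) - P s) (e - s).
Proof.
move=> [e0 sc dP hg] /andP[s0 se]; split.
- by rewrite subr_gt0.
- exact: smooth_curve_affine.
- move=> t /andP[t0 te].
  have hst : 0 <= s + 1 * t <= e by rewrite mul1r; lra.
  have D := is_derive_affine (dP _ hst).
  have D2 := is_deriveB D (is_derive_cst (P s) t 1).
  apply: (is_derive_eq D2); rewrite (derive1_affine s 1 t sc) scale1r.
  by rewrite subr0 [LHS]mul1r.
- move=> t /andP[t0 te].
  have [|Gst v0 Lst] := hg (s + t); first by rewrite addr_ge0 //= -lerBrDl.
  have [|_ _ Ls] := hg s; first by rewrite s0 ltW.
  rewrite derive1_affine // !mul1r scale1r; rewrite mul1r in Gst Lst.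
  split => //; first by rewrite -addrA.
  by rewrite mul1r in Ls; rewrite -addrA; move: Ls Lst; rewrite !mul1r; lra.
Qed.

(** Run backwards, a left germ becomes a right germ at [u - s] that reaches up to [u]. In this way
    [direction], defined from the right, is computed at points to the left of [u]. *)
Lemma germ_flip u c P e s : germ G Lam u (-1) c P e -> 0 < s <= e ->
  germ G Lam (u - s) 1 (fun t => c (s + (-1) * t))
    (fun t => P s - P (s + (-1) * t)) s.
Proof.
move=> [e0 sc dP hg] /andP[s0 se]; split.
- exact: s0.
- exact: smooth_curve_affine.
- move=> t /andP[t0 ts].
  have hst : 0 <= s + (-1) * t <= e.
    by rewrite mulN1r subr_ge0 ts /= lerBlDr (le_trans se) // lerDl.
  have D := is_derive_affine (dP _ hst).
  have D2 := is_deriveB (is_derive_cst (P s) t 1) D.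
  apply: (is_derive_eq D2); rewrite derive1_affine // scaleN1r enormN.
  by ring.
- move=> t /andP[t0 ts].
  have [|Gst v0 Lst] := hg (s + (-1) * t).
    by rewrite mulN1r subr_ge0 ts /= lerBlDr (le_trans se) // lerDl.
  have [|_ _ Ls] := hg s; first by rewrite ltW.
  rewrite derive1_affine // scaleN1r oppr_eq0; split => //.
    by rewrite -Gst; congr (G _); ring.
  have e1 : u - s + 1 * t = u + -1 * (s + -1 * t) by ring.
  have e2 : u - s = u + -1 * s by ring.
  by rewrite e1 e2; move: Lst Ls; lra.
Qed.

Lemma germ_derive_unique u sg c P e c' P' e' :
  germ G Lam u sg c P e -> germ G Lam u sg c' P' e' -> derive1 c 0 = derive1 c' 0.
Proof.
move=> [e0 sc _ hg] [e'0 sc' _ hg'].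
suff H i : derive1 c 0 0 i = derive1 c' 0 0 i by apply: row2P.
have D := is_deriveB (smooth_curve_derive1 sc 0 i) (smooth_curve_derive1 sc' 0 i).
apply/eqP; rewrite -subr_eq0; apply/negPn/negP => l0.
set l := _ - _ in l0 D.
have l20 : 0 < `|l| / 2 by rewrite divr_gt0 // normr_gt0.
have [d d0 hd] := is_derive_expansion D l20.
pose s := Num.min (Num.min (d / 2) e) e'.
have s0 : 0 < s by rewrite !lt_min divr_gt0 // e0.
have sd : s < d by rewrite !gt_min ltr_pdivrMr // ltr_pMr // ltr1n.
have se : 0 <= s <= e by rewrite !ge_min lexx (ltW s0) orbT.
have se' : 0 <= s <= e' by rewrite !ge_min lexx (ltW s0) orbT.
have z0 : 0 <= (0 : R) <= e by rewrite lexx ltW.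
have z0' : 0 <= (0 : R) <= e' by rewrite lexx ltW.
have [g1 _ _] := hg _ se; have [g2 _ _] := hg' _ se'.
have [g3 _ _] := hg _ z0; have [g4 _ _] := hg' _ z0'.
have := hd s; rewrite (gtr0_norm s0) => /(_ sd).
rewrite !fctE add0r -g1 -g2 -g3 -g4 !subrr sub0r normrN normrM.
rewrite (gtr0_norm s0) ler_pM2r //; have : 0 < `|l| by rewrite normr_gt0.
lra.
Qed.

Lemma directionE u c P e : germ G Lam u 1 c P e -> dir u = derive1 c 0.
Proof.
move=> g; rewrite /direction; case: xgetP => [v _|] /=.
  by move=> [c' [P' [e' [g' <-]]]]; exact: (germ_derive_unique g' g).
by move=> /(_ (derive1 c 0)) []; exists c, P, e.
Qed.

Lemma normal_distance_right p u c P e s : germ G Lam u 1 c P e -> 0 <= s < e ->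
  dir (u + s) = derive1 c s /\
  nd p (u + s) = tangential p c s.
Proof.
move=> g hs; have gs := germ_shift g hs.
have [e0 sc _ hg] := g; have [s0 se] := andP hs.
have [|Gs v0 _] := hg s; first by rewrite s0 ltW.
have dE : dir (u + s) = derive1 c s.
  by rewrite (directionE gs) derive1_affine // scale1r mulr0 addr0.
by split=> //; rewrite normal_distanceE tangentialE dE -Gs mul1r.
Qed.

(** The value [s = 0] is excluded: [direction] is one-sided, and at a corner the value at [u] may
    differ from the left limit. *)
Lemma normal_distance_left p u c P e s : germ G Lam u (-1) c P e -> 0 < s <= e ->
  dir (u - s) = - derive1 c s /\
  nd p (u - s) = - tangential p c s.
Proof.
move=> g hs; have gs := germ_flip g hs.
have [e0 sc _ hg] := g; have [s0 se] := andP hs.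
have [|Gs v0 _] := hg s; first by rewrite ltW.
have dE : dir (u - s) = - derive1 c s.
  by rewrite (directionE gs) derive1_affine // scaleN1r mulr0 addr0.
split=> //; rewrite normal_distanceE tangentialE dE -Gs mulN1r.
by rewrite dotNr enormN mulNr.
Qed.

Lemma germ_right p u c P e s : germ G Lam u 1 c P e -> u <= s -> s < u + e ->
  [/\ nd p s = tangential p c (s - u), dir s = derive1 c (s - u), G s = c (s - u) &
      Lam s = Lam u + P (s - u)].
Proof.
move=> g us se; have hs : 0 <= s - u < e by rewrite subr_ge0 us ltrBlDl.
have [_ _ _ /(_ (s - u))[|Gs _ Ls]] := g; first by have /andP[-> /ltW] := hs.
have [dE wE] := normal_distance_right p g hs.
have es : u + (s - u) = s by rewrite addrC subrK.
rewrite mul1r es in Gs Ls; rewrite es in dE wE.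
by split=> //; rewrite -[P _]mul1r -Ls addrC subrK.
Qed.

Lemma germ_left p u c P e s : germ G Lam u (-1) c P e -> u - e < s -> s < u ->
  [/\ nd p s = - tangential p c (u - s), dir s = - derive1 c (u - s),
      G s = c (u - s) & Lam s = Lam u - P (u - s)].
Proof.
move=> g es su; have hs : 0 < u - s <= e by rewrite subr_gt0 su lerBlDl -lerBlDr ltW.
have [_ _ _ /(_ (u - s))[|Gs _ Ls]] := g; first by have /andP[/ltW -> ->] := hs.
have [dE wE] := normal_distance_left p g hs.
have eu : u - (u - s) = s by rewrite opprB addrC subrK.
rewrite mulN1r eu in Gs Ls; rewrite eu in dE wE.
by split=> //; rewrite -mulN1r -Ls addrC subrK.
Qed.

Lemma normal_distance_germ p u c P e : germ G Lam u 1 c P e -> nd p u = tangential p c 0.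
Proof.
move=> g; have [e0 _ _ _] := g; have ue : u < u + e by rewrite ltrDl.
by have [-> _ _ _] := germ_right p g (lexx u) ue; rewrite subrr.
Qed.

End Germ.

(** * Local monotonicity of [w] where it is smaller than [r] *)

Section Circuit.
Variable R : realType.
Local Notation plane := 'rV[R]_2.
Implicit Types (q v x z : plane) (c : R -> plane) (s t u e sg : R) (P : R -> R).

Lemma derive1n_affine c (a b : R) : smooth_curve c ->
  forall n t, derive1n n (fun t => c (a + b * t)) t = b ^+ n *: derive1n n c (a + b * t).
Proof.
move=> sc; elim=> [|n IHn] t; first by rewrite !derive1n0 scale1r.
have D : is_curve_derive (fun t => b ^+ n *: derive1n n c (a + b * t))
    (fun t => b ^+ n.+1 *: derive1n n.+1 c (a + b * t)).
  move=> x i; have d := is_curve_derive_affine a b (smooth_curve_derive sc n) x i.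
  have -> : (fun s => (b ^+ n *: derive1n n c (a + b * s)) 0 i) =
            b ^+ n \*: (fun s => derive1n n c (a + b * s) 0 i).
    by apply/funext => s; rewrite mxE.
  apply: (is_derive_eq (is_deriveZ (b ^+ n) d)).
  by rewrite !mxE exprSr /GRing.scale /= mulrA.
have E : derive1n n (fun t => c (a + b * t)) =
    fun t => b ^+ n *: derive1n n c (a + b * t) by apply/funext.
by rewrite derive1nS E (derive1_curve D).
Qed.

Variables (K : set plane) (p : plane) (G : R -> plane) (Lam : R -> R) (L r : R).
Hypotheses (bK : convex_body K) (Kp : K° p) (cir : circuit K G Lam L).
Hypotheses (r0 : 0 < r) (rob : forall x, enorm (x - p) < r -> only_nondegenerate K x).

Local Notation germ := (germ G Lam).
Local Notation w := (normal_distance G Lam p).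

Lemma germ_bd u sg c P e s : germ u sg c P e -> 0 <= s <= e -> bd K (c s).
Proof.
by move=> [e0 sc dP hg] /hg [<- _ _]; exact: circuit_bd cir _.
Qed.

Lemma germ_branch u sg c P e : germ u sg c P e -> branch K (G u) c.
Proof.
move=> g; have [Gu _] := germ0 g; have [e0 sc _ hg] := g; split => //.
  by have [|] := hg 0; rewrite // lexx ltW.
by exists e => // s /andP[s0 se]; apply: (germ_bd g); rewrite s0 ltW.
Qed.

Lemma germ_branch_shift u sg c P e s : germ u sg c P e -> 0 <= s < e ->
  branch K (c s) (fun t => c (s + 1 * t)).
Proof.
move=> g hs; have [e0 sc _ hg] := g; have /andP[s0 se] := hs; split.
- exact: smooth_curve_affine.
- by rewrite mulr0 addr0.
- rewrite derive1_affine // scale1r mulr0 addr0.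
  by have [|] := hg s; rewrite // s0 ltW.
- exists (e - s); first by rewrite subr_gt0.
  move=> t /andP[t0 te]; apply: (germ_bd g).
  by rewrite mul1r addr_ge0 //= -lerBrDl ltW.
Qed.

(** The difference of the two speeds is kappa h times the speed of the curve, where kappa is the
    curvature and h the distance from [p] to the tangent line; convexity gives its sign. *)
Lemma germ_speed_ge u sg c P e s : germ u sg c P e -> 0 <= s < e ->
  enorm (derive1 c s) - tangential_derive p c s =
    dot (foot p (c s) (derive1 c s) - c s) (derive1n 2 c s) / enorm (derive1 c s) /\
  0 <= dot (foot p (c s) (derive1 c s) - c s) (derive1n 2 c s).
Proof.
move=> g hs; have [e0 sc _ hg] := g; have /andP[s0 se] := hs.
have v0 : derive1 c s != 0 by have [|] := hg s; rewrite // s0 ltW.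
have vn0 : enorm (derive1 c s) != 0 by rewrite enorm_eq0.
split.
  rewrite tangential_deriveE -(opprB (c s)) dotNl -enorm_sqr; field.
  exact: vn0.
have := branch_convex bK Kp (germ_branch_shift g hs).
rewrite (derive1_affine s 1 0 sc) (derive1n_affine s 1 sc 2 0).
by rewrite mulr0 addr0 expr1n !scale1r.
Qed.

Lemma germ_tangential_le u sg c P e s t : germ u sg c P e ->
  0 <= s -> s <= t -> t < e ->
  tangential p c t - tangential p c s <= P t - P s.
Proof.
move=> g s0 st te; have [e0 sc dP hg] := g.
have df a : a \in `[s, t] -> is_derive a 1 (fun t => P t - tangential p c t)
    (enorm (derive1 c a) - tangential_derive p c a).
  rewrite in_itv /= => /andP[sa at_].
  have va : derive1 c a != 0.
    by have [|] := hg a; rewrite // (le_trans s0 sa) ltW // (le_lt_trans at_ te).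
  have ha : 0 <= a <= e by rewrite (le_trans s0 sa) ltW // (le_lt_trans at_ te).
  exact: (is_deriveB (dP a ha) (is_derive_tangential p sc va)).
suff : P s - tangential p c s <= P t - tangential p c t by lra.
apply: (derive_ge0_le df _ st) => a; rewrite in_itv /= => /andP[sa at_].
have ha : 0 <= a < e by rewrite (le_trans s0 sa) (le_lt_trans at_ te).
have [-> h] := germ_speed_ge g ha.
by rewrite divr_ge0 // enorm_ge0.
Qed.

Lemma tangential_small c (b : R) : smooth_curve c -> derive1 c 0 != 0 ->
  `|tangential p c 0| < b ->
  exists2 d : R, 0 < d & forall s, 0 <= s < d -> `|tangential p c s| < b.
Proof.
move=> sc v0 hb; have D := is_derive_tangential p sc v0.
have C : tangential p c t @[t --> 0] --> tangential p c 0 := is_derive_continuous D.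
have near0 : \forall t \near (0 : R), `|tangential p c t| < b.
  exact: (cvgr_norm_lt _ C).
have [d /= d0 hd] := (nbhs_normP _ _).1 near0.
exists d; [exact: d0|move=> s /andP[s0 sd]; apply: hd].
by rewrite /ball_ /= sub0r normrN ger0_norm.
Qed.

Lemma circuit_cover u cr Pr er cl Pl el : germ u 1 cr Pr er ->
  germ u (-1) cl Pl el ->
  forall e, 0 < e -> \forall z \near G u, bd K z ->
     exists s, 0 <= s < e /\ (z = cr s \/ z = cl s).
Proof.
move=> [er0 _ _ hr] [el0 _ _ hl] e e0.
have d0 : 0 < Num.min e (Num.min er el) by rewrite !lt_min e0 er0.
have := circuit_local cir u d0; apply: filterS => z hz bz.
have [t + <-] := hz bz; rewrite !lt_min => /and3P[te tr tl].
have [ut|tu] := leP u t.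
  have tu0 : 0 <= t - u by rewrite subr_ge0.
  rewrite ger0_norm // in te tr tl.
  exists (t - u); split; first by rewrite tu0.
  left; have [|<- _ _] := hr (t - u); first by rewrite tu0 ltW.
  by congr G; ring.
have tu0 : 0 <= u - t by rewrite subr_ge0 ltW.
rewrite distrC ger0_norm // in te tr tl.
exists (u - t); split; first by rewrite tu0.
right; have [|<- _ _] := hl (u - t); first by rewrite tu0 ltW.
by congr G; ring.
Qed.

(** Both clauses are transitive, so they pass from neighbourhoods to whole arcs. *)
Definition rising (s t : R) := w s < w t /\ w t - w s <= Lam t - Lam s.

(** Required on a two-sided neighbourhood, so that the set of such points is open and its components
    are the maximal arcs. *)
Definition Up u := exists2 e, 0 < e & forall s, `|s - u| < e ->
  `|w s| < r /\ forall t, `|t - u| < e -> s < t -> rising s t.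

Definition Down u := exists2 e, 0 < e & forall s t, `|s - u| < e ->
  `|t - u| < e -> s < t -> w t < w s.

(** At a smooth point the two branches leave in opposite directions, so the value of [w], taken from
    the right, is also its left limit, and the monotonicity on the two sides can be glued at [u].
    The bound by arc length holds for either sign. *)
Lemma smooth_local u cr Pr er cl Pl el c0 sg : germ u 1 cr Pr er ->
  germ u (-1) cl Pl el -> local_param K (G u) c0 ->
  (forall c, branch K (G u) c -> 0 < sg * tangential_derive p c 0) ->
  w u = - tangential p cl 0 /\
  exists2 e, 0 < e & forall s t, `|s - u| < e -> `|t - u| < e -> s < t ->
    sg * w s < sg * w t /\ w t - w s <= Lam t - Lam s.
Proof.
move=> gr gl lc0 hsg.
have br := germ_branch gr; have bl := germ_branch gl.
have [er0 scr dPr hr] := gr; have [el0 scl dPl hl] := gl.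
have [Gr Pr0] := germ0 gr; have [Gl Pl0] := germ0 gl.
have vr0 : derive1 cr 0 != 0 by case: br.
have wu := normal_distance_germ p gr.
have wl : w u = - tangential p cl 0.
  have [l l0 e] := branches_opposite bK Kp lc0 br bl (circuit_cover gr gl).
  rewrite wu !tangentialE e dotNr enormN dotZr enormZ gtr0_norm // -Gr -Gl.
  by field; rewrite enorm_eq0 vr0 gt_eqF.
split=> //.
have v_r s : 0 <= s < er -> derive1 cr s != 0.
  by move=> /andP[s0 se]; have [|] := hr s; rewrite // s0 ltW.
have v_l s : 0 <= s < el -> derive1 cl s != 0.
  by move=> /andP[s0 se]; have [|] := hl s; rewrite // s0 ltW.
have [dr /andP[dr0 drer] mr] := tangential_monotone scr er0 v_r (hsg _ br).
have [dl /andP[dl0 dlel] ml] := tangential_monotone scl el0 v_l (hsg _ bl).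
have QR s t : u <= s -> s < t -> t < u + dr ->
    sg * w s < sg * w t /\ w t - w s <= Lam t - Lam s.
  move=> us st tu; have te : t < u + er by apply: lt_le_trans tu _; rewrite lerD2l.
  have [-> _ _ ->] := germ_right p gr us (lt_trans st te).
  have [-> _ _ ->] := germ_right p gr (le_trans us (ltW st)) te.
  split; first by apply: mr; rewrite ?subr_ge0 ?ltrD2r ?ltrBlDl.
  have := germ_tangential_le gr (s := s - u) (t := t - u).
  rewrite subr_ge0 lerD2r ltrBlDl => /(_ us (ltW st) te) h.
  by rewrite [X in _ <= X - _]addrC addrKA.
have wL s : u - el < s -> s <= u ->
    w s = - tangential p cl (u - s) /\ Lam s = Lam u - Pl (u - s).
  move=> us; rewrite le_eqVlt => /predU1P[->|su].
    by move: Pl0; rewrite subrr mulN1r => ->; rewrite addr0.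
  by have [] := germ_left p gl us su.
have QL s t : u - dl < s -> s < t -> t <= u ->
    sg * w s < sg * w t /\ w t - w s <= Lam t - Lam s.
  move=> us st tu; have es : u - el < s by apply: le_lt_trans us; rewrite lerD2l lerN2.
  have [-> ->] := wL s es (le_trans (ltW st) tu).
  have [-> ->] := wL t (lt_trans es st) tu.
  split.
    by rewrite !mulrN ltrN2; apply: ml; rewrite ?subr_ge0 ?ltrD2l ?ltrN2 // ltrBlDr -ltrBlDl.
  have := germ_tangential_le gl (s := u - t) (t := u - s).
  rewrite subr_ge0 lerD2l lerN2 ltrBlDr -ltrBlDl => /(_ tu (ltW st) es) h.
  by move: h; set a := tangential _ _ _; set b := tangential _ _ _; lra.
apply: (glue_at dr0 dl0 _ QR QL) => x y z [a1 a2] [b1 b2].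
by split; [exact: lt_trans a1 b1|lra].
Qed.

Lemma smooth_up_down u cr Pr er cl Pl el c0 sg : germ u 1 cr Pr er ->
  germ u (-1) cl Pl el -> local_param K (G u) c0 -> `|w u| < r ->
  (forall c, branch K (G u) c -> 0 < sg * tangential_derive p c 0) ->
  (sg = 1 -> Up u) /\ (sg = -1 -> Down u).
Proof.
move=> gr gl lc0 wr hsg.
have [wl [e e0 he]] := smooth_local gr gl lc0 hsg.
have [er0 scr dPr hr] := gr; have [el0 scl dPl hl] := gl.
have wu : w u = tangential p cr 0 := normal_distance_germ p gr.
have vr0 : derive1 cr 0 != 0 by case: (germ_branch gr).
have vl0 : derive1 cl 0 != 0 by case: (germ_branch gl).
split=> esg; last first.
  exists e; [exact: e0|move=> s t su tu st]; have [+ _] := he s t su tu st.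
  by rewrite esg !mulN1r ltrN2.
have [dr dr0 hdr] : exists2 d : R, 0 < d & forall s, 0 <= s < d -> `|tangential p cr s| < r.
  have hb : `|tangential p cr 0| < r by rewrite -wu.
  exact: (tangential_small scr vr0 hb).
have [dl dl0 hdl] : exists2 d : R, 0 < d & forall s, 0 <= s < d -> `|tangential p cl s| < r.
  have hb : `|tangential p cl 0| < r by rewrite -normrN -wl.
  exact: (tangential_small scl vl0 hb).
pose d := Num.min (Num.min er el) (Num.min dr dl).
have d0 : 0 < d by rewrite !lt_min er0 el0 dr0.
exists (Num.min e d); first by rewrite lt_min e0.
move=> s; rewrite lt_min => /andP[se sd]; split; last first.
  move=> t; rewrite lt_min => /andP[te _] st.
  by have := he s t se te st; rewrite esg !mul1r.
rewrite !lt_min !ltr_norml in sd.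
move: sd => /andP[/andP[/andP[_ s2] /andP[s3 _]] /andP[/andP[_ s6] /andP[s7 _]]].
have [us|su] := leP u s.
  have [|-> _ _ _] := germ_right p gr us; first by rewrite -ltrBlDl.
  by apply: hdr; rewrite subr_ge0 us.
have [|-> _ _ _] := germ_left p gl _ su; first by rewrite addrC -ltrBrDr.
by rewrite normrN; apply: hdl; rewrite subr_ge0 ltW //= -ltrN2 opprB.
Qed.

Lemma robust_smooth u sg c P e : germ u sg c P e -> `|tangential p c 0| < r ->
  exists c0 sg', [/\ local_param K (G u) c0, sg' = 1 \/ sg' = -1,
    0 < sg' * half_sqdist_deriv2 (foot p (G u) (derive1 c 0)) c0 &
    forall c, branch K (G u) c -> 0 < sg' * tangential_derive p c 0].
Proof.
move=> g tr; have b := germ_branch g.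
have [c0 lc0 h0] := equilibrium_smooth bK Kp rob b tr.
set h := half_sqdist_deriv2 _ _ in h0.
have [hp|hn] := ltP 0 h.
  exists c0, 1; split=> //; [by left|by rewrite mul1r|].
  by apply: (tangential_derive_sign bK Kp lc0 b); rewrite mul1r.
have {}hn : h < 0 by rewrite lt_neqAle h0.
exists c0, (-1); split=> //; [by right|by rewrite mulN1r oppr_gt0|].
by apply: (tangential_derive_sign bK Kp lc0 b); rewrite mulN1r oppr_gt0.
Qed.

Lemma up_or_down_right u : `|w u| < r -> Up u \/ Down u.
Proof.
move=> wr.
have [cr [Pr [er gr]]] := circuit_right cir u.
have [cl [Pl [el gl]]] := circuit_left cir u.
have wu : w u = tangential p cr 0 := normal_distance_germ p gr.
have [|c0 [sg [lc0 sg1 _ hsg]]] := robust_smooth gr; first by rewrite -wu.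
have [h1 h2] := smooth_up_down gr gl lc0 wr hsg.
by case: sg1 => ?; [left; exact: h1|right; exact: h2].
Qed.

(** For the right end of an arc, where only the left limit of [w] is controlled: if it is smaller
    than [r] in absolute value, the boundary is already smooth there, which excludes a jump. *)
Lemma up_or_down_left u c P e : germ u (-1) c P e -> `|tangential p c 0| < r ->
  w u = - tangential p c 0 /\ (Up u \/ Down u).
Proof.
move=> gl tr; have [cr [Pr [er gr]]] := circuit_right cir u.
have [c0 [sg [lc0 sg1 _ hsg]]] := robust_smooth gl tr.
have [wu _] := smooth_local gr gl lc0 hsg.
by split=> //; apply: up_or_down_right; rewrite wu normrN.
Qed.

Lemma up_not_down u : Up u -> ~ Down u.
Proof.
move=> [e e0 he] [d d0 hd].
pose a := Num.min e d / 2.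
have a0 : 0 < a by rewrite divr_gt0 // lt_min e0.
have amin : a < Num.min e d by rewrite ltr_pdivrMr ?ltr_pMr ?ltr1n // lt_min e0.
move: amin; rewrite lt_min => /andP[ae ad].
have h1 : `|u - u| < e by rewrite subrr normr0.
have h2 : `|u + a - u| < e by rewrite addrC addKr gtr0_norm.
have h3 : `|u - u| < d by rewrite subrr normr0.
have h4 : `|u + a - u| < d by rewrite addrC addKr gtr0_norm.
have ua : u < u + a by rewrite ltrDl.
have [_ /(_ _ h2 ua) [+ _]] := he u h1.
by have := hd _ _ h3 h4 ua; rewrite ltNge => /negP + /ltW.
Qed.

(** On the normal line at a stable point the foot of [p] is [p] itself, so [w] vanishes there and
    the second derivative of the distance from [p] has the sign of the derivative of [w]. *)
Lemma stable_up u : stable K p (G u) -> Up u /\ w u = 0.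
Proof.
move=> [[bq [_ nq]] sq [qp|[c0 lc0 d0]]].
  by have [_ []] := (bdE _ bK).1 bq; rewrite qp.
have [cr [Pr [er gr]]] := circuit_right cir u.
have [cl [Pl [el gl]]] := circuit_left cir u.
have br := germ_branch gr; have [scr crq vr0 _] := br.
have qNp : G u != p.
  by apply/eqP => e; have [_ []] := (bdE _ bK).1 bq; rewrite e.
have perp0 : dot (G u - p) (derive1 c0 0) = 0.
  case: nq => nq.
    apply/eqP; rewrite -oppr_eq0 -dotNl opprB; apply/eqP.
    apply: (local_param_support lc0) => z /(bd_sub bK) /nq.
    by rewrite -(opprB p) dotNl oppr_le0.
  by apply: (local_param_support lc0) => z /(bd_sub bK) /nq.
have [k k0 ek] := smooth_branch_collinear bK Kp lc0 br.
have wu : w u = 0.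
  rewrite (normal_distance_germ p gr).
  by rewrite tangentialE crq ek dotZr perp0 mulr0 mul0r.
have footE : foot p (G u) (derive1 cr 0) = p.
  by rewrite /foot ek dotZr perp0 mulr0 mul0r scale0r addr0.
split => //.
have hsg c : branch K (G u) c -> 0 < 1 * tangential_derive p c 0.
  apply: (tangential_derive_sign bK Kp lc0 br).
  have [sc0 c0q _ _ _] := lc0.
  rewrite mul1r footE; move: d0; rewrite dist_deriv2E ?c0q //.
  rewrite /half_sqdist_deriv2 c0q pmulr_lgt0 // invr_gt0 enorm_gt0.
  by rewrite subr_eq0.
have wr : `|w u| < r by rewrite wu normr0.
by have [h _] := smooth_up_down gr gl lc0 wr hsg; exact: h.
Qed.

(** At a zero of [w] the foot is [p], so there is an equilibrium with respect to [p]. It is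
    nondegenerate, and a negative sign is excluded because [w] would decrease. *)
Lemma up_stable u : Up u -> w u = 0 -> stable K p (G u).
Proof.
move=> upu wu; have [cr [Pr [er gr]]] := circuit_right cir u.
have [cl [Pl [el gl]]] := circuit_left cir u.
have br := germ_branch gr; have [scr crq vr0 _] := br.
have wt : tangential p cr 0 = 0 by rewrite -(normal_distance_germ p gr).
have wr : `|w u| < r by rewrite wu normr0.
have [|c0 [sg [lc0 sg1 h0 hsg]]] := robust_smooth gr; first by rewrite wt normr0.
have perp : dot (G u - p) (derive1 cr 0) = 0.
  move/eqP: wt; rewrite tangentialE crq mulf_eq0 invr_eq0 enorm_eq0 (negPf vr0).
  by rewrite orbF => /eqP.
have footE : foot p (G u) (derive1 cr 0) = p.
  by rewrite /foot perp mul0r scale0r addr0.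
have e1 : sg = 1.
  case: sg1 => // e1; have [_ /(_ e1) /(up_not_down upu)] :=
    smooth_up_down gr gl lc0 wr hsg.
  by [].
have eqp := foot_equilibrium bK Kp br; rewrite footE in eqp.
have qNp : G u != p by have := foot_neq bK Kp br; rewrite footE eq_sym.
split=> //; [by exists c0|right; exists c0 => //].
have [sc0 c0q _ _ _] := lc0.
rewrite e1 mul1r footE in h0.
have perp0 : dot (G u - p) (derive1 c0 0) = 0.
  have [k k0 ek] := smooth_branch_collinear bK Kp lc0 br.
  by move/eqP: perp; rewrite ek dotZr mulf_eq0 (negPf k0) /= => /eqP.
rewrite dist_deriv2E ?c0q //; move: h0; rewrite /half_sqdist_deriv2 c0q => h0.
by rewrite divr_gt0 // enorm_gt0 subr_eq0.
Qed.

End Circuit.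

Section LocalToGlobal.
Variable R : realType.

(** Real induction on the supremum of the points reached from [a]: transitivity lets the local
    hypothesis first attain the supremum and then go past it. *)
Lemma local_to_global (Q : R -> R -> Prop) (a b : R) :
  (forall x y z, Q x y -> Q y z -> Q x z) -> a < b ->
  (forall u, a <= u <= b -> exists2 e, 0 < e & forall s t,
     `|s - u| < e -> `|t - u| < e -> s < t -> Q s t) -> Q a b.
Proof.
move=> trQ ab loc.
pose E := [set t | a < t <= b /\ Q a t].
have aa : a <= a <= b by rewrite lexx ltW.
have [ea ea0 hea] := loc a aa.
have half (x : R) : 0 < x -> x / 2 < x by move=> x0; rewrite ltr_pdivrMr // ltr_pMr // ltr1n.
have E0 : E (Num.min (a + ea / 2) b).
  have lt1 : a < Num.min (a + ea / 2) b by rewrite lt_min ab ltrDl divr_gt0.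
  split; first by rewrite lt1 ge_min lexx orbT.
  apply: hea => //; first by rewrite subrr normr0.
  rewrite ger0_norm ?subr_ge0 ?(ltW lt1) // ltrBlDl gt_min ltrD2l half //.
have ubE : ubound E b by move=> t [/andP[_ tb] _].
have supE : has_sup E by split; [exists (Num.min (a + ea / 2) b)|exists b].
pose c := sup E.
have cb : c <= b by apply: ge_sup => //; exists (Num.min (a + ea / 2) b).
have ac : a < c.
  apply: lt_le_trans (sup_upper_bound supE E0).
  by rewrite lt_min ab ltrDl divr_gt0.
have acb : a <= c <= b by rewrite ltW.
have [ec ec0 hec] := loc c acb.
have cc : `|c - c| < ec by rewrite subrr normr0.
have [t Et ct] : exists2 t, E t & c - ec < t by apply: sup_adherent.
have tc : t <= c by exact: (sup_upper_bound supE Et).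
have Qac : Q a c.
  have [_ Qat] := Et; have [<- //|tNc] := eqVneq t c.
  apply: (trQ _ _ _ Qat); apply: hec => //; last by rewrite lt_neqAle tNc.
  by rewrite distrC ger0_norm ?subr_ge0 //; lra.
have [->//|cNb] := eqVneq b c.
have {}cb : c < b by rewrite lt_neqAle eq_sym cNb.
pose t' := Num.min (c + ec / 2) b.
have lt1 : c < t' by rewrite lt_min cb ltrDl divr_gt0.
suff /(sup_upper_bound supE) : E t' by rewrite leNgt lt1.
split; first by rewrite (lt_trans ac lt1) ge_min lexx orbT.
apply: (trQ _ _ _ Qac); apply: hec => //.
rewrite ger0_norm ?subr_ge0 ?(ltW lt1) // ltrBlDl gt_min ltrD2l half //.
Qed.

End LocalToGlobal.

(** * Maximal rising arcs and the length inequality *)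

Section Arcs.
Variable R : realType.
Local Notation plane := 'rV[R]_2.
Implicit Types (c : R -> plane) (s t u e sg a b x y z : R) (P : R -> R).
Variables (K : set plane) (p : plane) (G : R -> plane) (Lam : R -> R) (L r : R).
Hypotheses (bK : convex_body K) (Kp : K° p) (cir : circuit K G Lam L).
Hypotheses (r0 : 0 < r) (rob : forall x : plane, enorm (x - p) < r -> only_nondegenerate K x).

Local Notation germ := (germ G Lam).
Local Notation w := (normal_distance G Lam p).
Local Notation Up := (Up p G Lam r).
Local Notation Down := (Down p G Lam).
Local Notation rising := (rising p G Lam).

Lemma germ_periodic u sg c P e : germ u sg c P e -> germ (u + 1) sg c P e.
Proof.
move=> [e0 sc dP hg]; split; [exact: e0|exact: sc|exact: dP|].
move=> s hs; have [Gs v0 Ls] := hg s hs.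
have -> : u + 1 + sg * s = u + sg * s + 1 by ring.
rewrite (circuit_periodic cir) !(circuit_length cir); split; [exact: Gs|exact: v0|].
by rewrite -Ls; ring.
Qed.

Lemma direction_periodic u : direction G Lam (u + 1) = direction G Lam u.
Proof.
have [c [P [e g]]] := circuit_right cir u.
by rewrite (directionE g) (directionE (germ_periodic g)).
Qed.

Lemma normal_distance_periodic u : w (u + 1) = w u.
Proof. by rewrite !normal_distanceE direction_periodic (circuit_periodic cir). Qed.

Lemma up_periodic u : Up u -> Up (u + 1).
Proof.
move=> [e e0 he]; exists e; [exact: e0|move=> s hs].
have [|ws ht] := he (s - 1); first by rewrite -addrA -opprD [1 + u]addrC.
have es (a : R) : w a = w (a - 1) by rewrite -{1}[a](subrK 1) normal_distance_periodic.
have el (a : R) : Lam a = Lam (a - 1) + L by rewrite -{1}[a](subrK 1) (circuit_length cir).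
split; first by rewrite es.
move=> t tu st.
have tu' : `|t - 1 - u| < e by rewrite -addrA -opprD [1 + u]addrC.
have st' : s - 1 < t - 1 by rewrite ltrD2r.
have [h1 h2] := ht _ tu' st'.
by split; rewrite (es s) (es t) // (el s) (el t) opprD addrACA subrr addr0.
Qed.

Lemma rising_trans x y z : rising x y -> rising y z -> rising x z.
Proof. by move=> [a1 a2] [b1 b2]; split; [exact: lt_trans a1 b1|lra]. Qed.

Lemma up_rising s t : s < t -> (forall u, s <= u <= t -> Up u) -> rising s t.
Proof.
move=> st up; apply: (local_to_global rising_trans st) => u /up[e e0 he].
by exists e; [exact: e0|move=> x y xu yu xy; have [_] := he x xu; exact].
Qed.

Lemma up_open u : Up u -> exists2 e, 0 < e & forall s, `|s - u| < e -> Up s.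
Proof.
move=> [e e0 he]; exists e; [exact: e0|move=> s su].
exists (e - `|s - u|); first by rewrite subr_gt0.
have aux t : `|t - s| < e - `|s - u| -> `|t - u| < e.
  rewrite ltrBrDr; apply: le_lt_trans.
  by rewrite -(subrKA s t) ler_normD.
move=> t /aux tu; have [wt ht] := he t tu; split; first exact: wt.
by move=> t' /aux t'u tt'; apply: ht.
Qed.

Lemma length_lt s t : s < t -> Lam s < Lam t.
Proof.
have tr x y z : Lam x < Lam y -> Lam y < Lam z -> Lam x < Lam z by exact: lt_trans.
move=> st; apply: (local_to_global tr st) => u _.
have [cr [Pr [er gr]]] := circuit_right cir u.
have [cl [Pl [el gl]]] := circuit_left cir u.
have inc sg c P e x y : germ u sg c P e -> 0 <= x -> x < y -> y <= e -> P x < P y.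
  move=> [e0 sc dP hg] x0 xy ye.
  have dP' z : z \in `[x, y] -> is_derive z 1 P (enorm (derive1 c z)).
    rewrite in_itv /= => /andP[xz zy].
    by apply: dP; rewrite (le_trans x0 xz) (le_trans zy ye).
  apply: (derive_gt0_lt dP' _ xy) => z; rewrite in_itv /= => /andP[xz zy]; rewrite enorm_gt0.
  by have [|] := hg z; rewrite // (le_trans x0 xz) (le_trans zy ye).
have er0 : 0 < er by case: gr.
have el0 : 0 < el by case: gl.
apply: (glue_at er0 el0 tr) => x y.
  move=> ux xy ye; have [_ _ _ ->] := germ_right 0 gr ux (lt_trans xy ye).
  have [_ _ _ ->] := germ_right 0 gr (le_trans ux (ltW xy)) ye.
  by rewrite ltrD2l; apply: (inc _ _ _ _ _ _ gr); rewrite ?subr_ge0 ?ltrD2r // lerBlDl ltW.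
move=> ux xy yu; have [_ _ _ ->] := germ_left 0 gl ux (lt_le_trans xy yu).
have -> : Lam y = Lam u - Pl (u - y).
  move: yu; rewrite le_eqVlt => /predU1P[->|yu].
    by have [_] := germ0 gl; rewrite subrr mulN1r => ->; rewrite addr0.
  by have [] := germ_left 0 gl (lt_trans ux xy) yu.
rewrite ltrD2l ltrN2; apply: (inc _ _ _ _ _ _ gl); rewrite ?subr_ge0 //.
  by rewrite ltrD2l ltrN2.
by rewrite lerBlDr -lerBlDl ltW.
Qed.

Definition is_arc u a b := [/\ a < u < b, (forall s, a < s < b -> Up s),
  ~ Up a & ~ Up b].

(** Periodicity prevents [w] from rising over a whole period; this bounds the sets whose supremum
    and infimum are the ends of an arc. *)
Lemma up_bound u t : (forall s, u <= s <= t -> Up s) -> t < u + 1.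
Proof.
move=> up; rewrite ltNge; apply/negP => ut.
have [] := @up_rising u (u + 1); first by rewrite ltrDl.
  by move=> s /andP[us su]; apply: up; rewrite us (le_trans su ut).
by rewrite normal_distance_periodic ltxx.
Qed.

Lemma up_lt u : Up u -> `|w u| < r.
Proof. by move=> [e e0 he]; have [] := he u; rewrite ?subrr ?normr0. Qed.

(** If the left limit of [w] at the end [b] were smaller than [r] in absolute value, [w] would be
    monotone around [b]: rising contradicts the maximality of the arc, falling contradicts the rise
    just before [b]. *)
Lemma right_end u : Up u -> exists b, [/\ u < b, (forall s, u <= s < b -> Up s),
  ~ Up b & forall eta, 0 < eta -> exists2 s, u <= s < b & r - eta < w s].
Proof.
move=> upu.
pose E := [set t | u < t /\ forall s, u <= s <= t -> Up s].
have [e e0 he] := up_open upu.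
have half (x : R) : 0 < x -> x / 2 < x by move=> x0; rewrite ltr_pdivrMr // ltr_pMr // ltr1n.
have Ee : E (u + e / 2).
  split; first by rewrite ltrDl divr_gt0.
  move=> s /andP[us se]; apply: he; rewrite ger0_norm ?subr_ge0 //.
  by have := half e e0; lra.
have hasE : has_sup E.
  split; first by exists (u + e / 2).
  by exists (u + 1) => t [_ /up_bound/ltW].
pose b := sup E.
have ub : u < b.
  by apply: lt_le_trans (sup_upper_bound hasE Ee); rewrite ltrDl divr_gt0.
have upb s : u <= s < b -> Up s.
  move=> /andP[us sb]; have bs0 : 0 < b - s by rewrite subr_gt0.
  have [t [ut upt]] := sup_adherent bs0 hasE; rewrite -/b opprB addrC subrK => st.
  by apply: upt; rewrite us ltW.
have nupb : ~ Up b.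
  move=> /[dup] upb' /up_open[d d0 hd].
  have : E (b + d / 2).
    split; first by rewrite (lt_trans ub) // ltrDl divr_gt0.
    move=> s /andP[us sbd]; have [sb|bs] := ltP s b; first by apply: upb; rewrite us.
    apply: hd; rewrite ger0_norm ?subr_ge0 //.
    by have := half d d0; lra.
  by move=> /(sup_upper_bound hasE); rewrite -/b leNgt ltrDl divr_gt0.
exists b; split; [exact: ub|exact: upb|exact: nupb|move=> eta eta0].
have [cl [Pl [el gl]]] := circuit_left cir b.
have [el0 scl dPl hl] := gl.
have vl0 : derive1 cl 0 != 0 by case: (germ_branch cir gl).
have D := is_derive_tangential p scl vl0.
have ris s t : u <= s -> s < t -> t < b -> rising s t.
  move=> us st tb; apply: up_rising => // x /andP[sx xt].
  by apply: upb; rewrite (le_trans us sx) (le_lt_trans xt tb).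
have ndown : ~ Down b.
  move=> [d d0 hd].
  pose x := Num.min d (b - u).
  have x0 : 0 < x by rewrite lt_min d0 subr_gt0.
  have xd : x <= d by rewrite ge_min lexx.
  have xb : x <= b - u by rewrite ge_min lexx orbT.
  have h1 : `|b - x / 2 - b| < d by rewrite addrAC subrr sub0r normrN gtr0_norm; lra.
  have h2 : `|b - x / 3 - b| < d by rewrite addrAC subrr sub0r normrN gtr0_norm; lra.
  have h3 : b - x / 2 < b - x / 3 by lra.
  have [+ _] : rising (b - x / 2) (b - x / 3) by apply: ris; lra.
  by have := hd _ _ h1 h2 h3; rewrite ltNge => /negP + /ltW.
have big : r <= `|tangential p cl 0|.
  rewrite leNgt; apply/negP => small.
  by have [_ []] := up_or_down_left bK Kp cir rob gl small.
have wleft s : 0 < s -> s <= el -> w (b - s) = - tangential p cl s.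
  by move=> s0 se; have [|_ ->] := normal_distance_left p gl (s := s); rewrite ?s0.
(* The left limit of [w] at [b] is at least [w u > - r], hence it is at least
   [r]. *)
have wu := up_lt upu; rewrite ltr_norml in wu; have /andP[wu1 wu2] := wu.
pose eta' := Num.min eta (w u + r).
have eta'0 : 0 < eta' by rewrite lt_min eta0 /=; lra.
have C : tangential p cl t @[t --> 0] --> tangential p cl 0 := is_derive_continuous D.
have near0 : \forall t \near (0 : R), `|tangential p cl 0 - tangential p cl t| < eta'.
  by move/cvgrPdist_lt : C => /(_ eta' eta'0).
have [d /= d0 hd] := (nbhs_normP _ _).1 near0.
pose x := Num.min (Num.min d el) (b - u) / 2.
have x0 : 0 < x by rewrite divr_gt0 // !lt_min d0 el0 subr_gt0.
have : x < Num.min (Num.min d el) (b - u).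
  by apply: half; rewrite !lt_min d0 el0 subr_gt0.
rewrite !lt_min => /andP[/andP[xd xel] xbu].
have : `|tangential p cl 0 - tangential p cl x| < eta'.
  by apply: hd; rewrite /ball_ /= sub0r normrN gtr0_norm.
have wx := wleft x x0 (ltW xel).
have ubx : u < b - x by lra.
have [wux _] : rising u (b - x) by apply: ris; lra.
rewrite wx in wux.
rewrite ltr_norml !lt_min => /andP[h1 /andP[h2 h3]].
have h1' : - eta' < tangential p cl 0 - tangential p cl x by exact: h1.
exists (b - x); first by apply/andP; split; lra.
rewrite wx; have : eta' <= eta by rewrite ge_min lexx.
have : eta' <= w u + r by rewrite ge_min lexx orbT.
have [tp|tn] := leP 0 (tangential p cl 0).
  by rewrite ger0_norm // in big; lra.
by rewrite ltr0_norm // in big; lra.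
Qed.

(** The mirror image of [right_end], except that the value of [w] at [a] is already the limit from
    the side of the arc, so [up_or_down_right] suffices. *)
Lemma left_end u : Up u -> exists a, [/\ a < u, (forall s, a < s <= u -> Up s),
  ~ Up a & forall eta, 0 < eta -> exists2 s, a < s <= u & w s < - r + eta].
Proof.
move=> upu.
pose E := [set t | t < u /\ forall s, t <= s <= u -> Up s].
have [e e0 he] := up_open upu.
have half (x : R) : 0 < x -> x / 2 < x by move=> x0; rewrite ltr_pdivrMr // ltr_pMr // ltr1n.
have Ee : E (u - e / 2).
  split; first by rewrite gtrBl divr_gt0.
  move=> s /andP[us se]; apply: he; rewrite ler0_norm ?subr_le0 //.
  by have := half e e0; lra.
have hasE : has_inf E.
  split; first by exists (u - e / 2).
  by exists (u - 1) => t [_ /up_bound ut]; lra.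
pose a := inf E.
have au : a < u.
  by apply: le_lt_trans (ge_inf hasE.2 Ee) _; rewrite gtrBl divr_gt0.
have upa s : a < s <= u -> Up s.
  move=> /andP[us sb]; have bs0 : 0 < s - a by rewrite subr_gt0.
  have [t [ut upt]] := inf_adherent bs0 hasE; rewrite -/a addrC subrK => st.
  by apply: upt; rewrite sb ltW.
have nupa : ~ Up a.
  move=> /[dup] upa' /up_open[d d0 hd].
  have : E (a - d / 2).
    split; first by rewrite (lt_trans _ au) // gtrBl divr_gt0.
    move=> s /andP[us sbd]; have [sb|bs] := ltP a s; first by apply: upa; rewrite sb.
    apply: hd; rewrite ler0_norm ?subr_le0 //.
    by have := half d d0; lra.
  by move=> /(ge_inf hasE.2); rewrite -/a leNgt gtrBl divr_gt0.
exists a; split; [exact: au|exact: upa|exact: nupa|move=> eta eta0].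
have [cr [Pr [er gr]]] := circuit_right cir a.
have [er0 scr dPr hr] := gr.
have vr0 : derive1 cr 0 != 0 by case: (germ_branch cir gr).
have D := is_derive_tangential p scr vr0.
have ris s t : a < s -> s < t -> t <= u -> rising s t.
  move=> us st tb; apply: up_rising => // x /andP[sx xt].
  by apply: upa; rewrite (lt_le_trans us sx) (le_trans xt tb).
have wright s : 0 <= s -> s < er -> w (a + s) = tangential p cr s.
  by move=> s0 se; have [|_ ->] := normal_distance_right p gr (s := s); rewrite ?s0.
have ndown : ~ Down a.
  move=> [d d0 hd].
  pose x := Num.min d (u - a).
  have x0 : 0 < x by rewrite lt_min d0 subr_gt0.
  have xd : x <= d by rewrite ge_min lexx.
  have xb : x <= u - a by rewrite ge_min lexx orbT.
  have h1 : `|a + x / 2 - a| < d by rewrite addrAC subrr add0r gtr0_norm; lra.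
  have h2 : `|a + x / 3 - a| < d by rewrite addrAC subrr add0r gtr0_norm; lra.
  have h3 : a + x / 3 < a + x / 2 by lra.
  have [+ _] : rising (a + x / 3) (a + x / 2) by apply: ris; lra.
  by have := hd _ _ h2 h1 h3; rewrite ltNge => /negP + /ltW.
have big : r <= `|tangential p cr 0|.
  rewrite leNgt; apply/negP => small.
  have : `|w a| < r by rewrite -[a]addr0 wright.
  by move=> /(up_or_down_right bK Kp cir rob) [].
have wu := up_lt upu; rewrite ltr_norml in wu; have /andP[wu1 wu2] := wu.
(* The margin [r - w u] rules out a right limit of at least [r], because just after [a] the function
   [w] is below [w u]. *)
pose eta' := Num.min eta (r - w u).
have eta'0 : 0 < eta' by rewrite lt_min eta0 /=; lra.
have C : tangential p cr t @[t --> 0] --> tangential p cr 0 := is_derive_continuous D.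
have near0 : \forall t \near (0 : R), `|tangential p cr 0 - tangential p cr t| < eta'.
  by move/cvgrPdist_lt : C => /(_ eta' eta'0).
have [d /= d0 hd] := (nbhs_normP _ _).1 near0.
pose x := Num.min (Num.min d er) (u - a) / 2.
have x0 : 0 < x by rewrite divr_gt0 // !lt_min d0 er0 subr_gt0.
have : x < Num.min (Num.min d er) (u - a).
  by apply: half; rewrite !lt_min d0 er0 subr_gt0.
rewrite !lt_min => /andP[/andP[xd xel] xbu].
have : `|tangential p cr 0 - tangential p cr x| < eta'.
  by apply: hd; rewrite /ball_ /= sub0r normrN gtr0_norm.
have wx := wright x (ltW x0) xel.
have ubx : a + x < u by lra.
have [wux _] : rising (a + x) u by apply: ris; lra.
rewrite wx in wux.
rewrite ltr_norml !lt_min => /andP[h1 /andP[h2 h3]].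
have h1' : - eta' < tangential p cr 0 - tangential p cr x by exact: h1.
exists (a + x); first by apply/andP; split; lra.
rewrite wx; have : eta' <= eta by rewrite ge_min lexx.
have : eta' <= r - w u by rewrite ge_min lexx orbT.
have [tp|tn] := leP 0 (tangential p cr 0).
  by rewrite ger0_norm // in big; lra.
by rewrite ltr0_norm // in big; lra.
Qed.

Lemma arc_exists u : Up u -> exists a b, is_arc u a b.
Proof.
move=> upu; have [a [au upa nupa _]] := left_end upu.
have [b [ub upb nupb _]] := right_end upu; exists a, b; split => //.
  by rewrite au.
move=> s /andP[as_ sb]; have [us|su] := leP u s; first by apply: upb; rewrite us.
by apply: upa; rewrite as_ ltW.
Qed.

Lemma arc_unique u a b a' b' : is_arc u a b -> is_arc u a' b' -> a = a' /\ b = b'.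
Proof.
move=> [/andP[au ub] up na nb] [/andP[au' ub'] up' na' nb'].
split.
  case: (ltgtP a a') => // aa'.
    by case: na'; apply: up; rewrite aa' (lt_trans au' ub).
  by case: na; apply: up'; rewrite aa' (lt_trans au ub').
case: (ltgtP b b') => // bb'.
  by case: nb; apply: up'; rewrite bb' (lt_trans au' ub).
by case: nb'; apply: up; rewrite bb' (lt_trans au ub').
Qed.

Lemma up_periodic_pred u : Up (u + 1) -> Up u.
Proof.
move=> [e e0 he]; exists e; [exact: e0|move=> s hs].
have shift x : `|x - u| < e -> `|x + 1 - (u + 1)| < e.
  by rewrite opprD addrACA subrr addr0.
have [ws ht] := he _ (shift s hs); rewrite normal_distance_periodic in ws.
split; first exact: ws.
move=> t /shift tu st; have st' : s + 1 < t + 1 by rewrite ltrD2r.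
have [h1 h2] := ht _ tu st'.
move: h1 h2; rewrite !normal_distance_periodic !(circuit_length cir) => h1 h2.
by split; [exact: h1|lra].
Qed.

Lemma arc_periodic u a b : is_arc u a b -> is_arc (u + 1) (a + 1) (b + 1).
Proof.
move=> [/andP[au ub] up na nb]; split.
- by rewrite !ltrD2r au.
- move=> s /andP[sa sb]; rewrite -[s](subrK 1); apply/up_periodic/up.
  by rewrite ltrBrDr sa ltrBlDr.
- by move=> /up_periodic_pred.
- by move=> /up_periodic_pred.
Qed.

Lemma arc_up u a b : is_arc u a b -> Up u.
Proof. by move=> [au up _ _]; exact: up. Qed.

Lemma arc_rising u a b s t : is_arc u a b -> a < s -> s < t -> t < b -> rising s t.
Proof.
move=> [_ up _ _] as_ st tb; apply: up_rising => // x /andP[sx xt].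
by apply: up; rewrite (lt_le_trans as_ sx) (le_lt_trans xt tb).
Qed.

Lemma arc_left_limit u a b : is_arc u a b ->
  forall eta, 0 < eta -> exists2 s, a < s < b & w s < - r + eta.
Proof.
move=> arc eta eta0; have [/andP[au ub] up na nb] := arc.
have [a' [au' upa' na' lim]] := left_end (arc_up arc).
have ea : a' = a.
  case: (ltgtP a a') => // aa'; first by case: na'; apply: up; rewrite aa' (lt_trans au').
  by case: na; apply: upa'; rewrite aa' ltW.
have [s /andP[h1 h2] ws] := lim eta eta0; exists s => //.
by rewrite -ea h1 (le_lt_trans h2).
Qed.

Lemma arc_right_limit u a b : is_arc u a b ->
  forall eta, 0 < eta -> exists2 s, a < s < b & r - eta < w s.
Proof.
move=> arc eta eta0; have [/andP[au ub] up na nb] := arc.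
have [b' [ub' upb' nb' lim]] := right_end (arc_up arc).
have eb : b' = b.
  case: (ltgtP b b') => // bb'; first by case: nb; apply: upb'; rewrite bb' ltW.
  by case: nb'; apply: up; rewrite bb' (lt_trans au ub').
have [s /andP[h1 h2] ws] := lim eta eta0; exists s => //.
by rewrite -eb h2 (lt_le_trans au).
Qed.

(** Near [a] the function [w] comes arbitrarily close to [- r], and its rise between two points of
    the arc is at most the arc length. The estimate is split at [s] so that equality on the whole
    arc forces equality on every subarc. *)
Lemma arc_length_left u a b s : is_arc u a b -> a < s -> s < b ->
  w s + r <= Lam s - Lam a.
Proof.
move=> arc as_ sb; apply/ler_addgt0Pr => eta eta0.
have las := length_lt as_.
have [s' /andP[as' sb'] ws'] := arc_left_limit arc eta0.
have las' := length_lt as'.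
case: (ltgtP s s') => ss'.
- by have [h _] := arc_rising arc as_ ss' sb'; lra.
- by have [_ h] := arc_rising arc as' ss' sb; lra.
- by rewrite ss' in las *; lra.
Qed.

Lemma arc_length_right u a b s : is_arc u a b -> a < s -> s < b ->
  r - w s <= Lam b - Lam s.
Proof.
move=> arc as_ sb; apply/ler_addgt0Pr => eta eta0.
have las := length_lt sb.
have [s' /andP[as' sb'] ws'] := arc_right_limit arc eta0.
have las' := length_lt sb'.
case: (ltgtP s s') => ss'.
- by have [_ h] := arc_rising arc as_ ss' sb'; lra.
- by have [h _] := arc_rising arc as' ss' sb; lra.
- by rewrite ss' in las *; lra.
Qed.

Lemma arc_length_ge u a b : is_arc u a b -> 2 * r <= Lam b - Lam a.
Proof.
move=> arc; have [/andP[au ub] _ _ _] := arc.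
by have := arc_length_left arc au ub; have := arc_length_right arc au ub; lra.
Qed.

Lemma arc_length_tight u a b s t : is_arc u a b -> Lam b - Lam a = 2 * r ->
  a < s -> s < t -> t < b -> Lam t - Lam s = w t - w s.
Proof.
move=> arc e as_ st tb; have [_ h] := arc_rising arc as_ st tb.
have := arc_length_left arc as_ (lt_trans st tb).
have := arc_length_right arc (lt_trans as_ st) tb; lra.
Qed.

(** Were the arcs to overlap, their union would be an interval on which [w] rises strictly, and [w]
    could not take the same value twice. *)
Lemma arc_separate u a b u' a' b' : is_arc u a b -> is_arc u' a' b' ->
  u < u' -> w u = w u' -> b <= a'.
Proof.
move=> arc arc' uu' e; rewrite leNgt; apply/negP => ab.
have [/andP[au ub] up _ _] := arc; have [/andP[au' ub'] up' _ _] := arc'.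
have [] : rising u u'.
  apply: up_rising => // x /andP[ux xu'].
  have [xb|bx] := ltP x b; first by apply: up; rewrite (lt_le_trans au).
  by apply: up'; rewrite (lt_le_trans ab) //= (le_lt_trans xu').
by rewrite e ltxx.
Qed.

(* Index [S] repeats index 0 after one period. *)
Lemma arcs_sequence (S : nat) : (0 < S)%N -> stable K p #= `I_S ->
  exists t a b : nat -> R,
  [/\ forall k, (k <= S)%N -> w (t k) = 0 /\ is_arc (t k) (a k) (b k),
      forall k, (k < S)%N -> t k < t k.+1 /\ b k <= a k.+1,
      [/\ t S = t 0%N + 1, a S = a 0%N + 1 & b S = b 0%N + 1] &
      forall z : plane, stable K p z <-> exists2 k, (k < S)%N & z = G (t k)].
Proof.
move=> S0 /card_set_bijP[f bij_f].
have [g bij_g] : exists g : nat -> plane, set_bij `I_S (stable K p) g.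
  by apply/card_set_bijP; rewrite card_eq_sym; apply/card_set_bijP; exists f.
have [gS ginj gsurj] := bij_g.
have param k : exists t, (k < S)%N -> 0 <= t < 1 /\ G t = g k.
  have [kS|kS] := ltnP k S; last by exists 0.
  have [[bgk _] _ _] := gS k kS.
  have [t ht Gt] := circuit_onto cir 0 bgk.
  by exists t; rewrite add0r in ht.
have {param}[tau htau] := choice param.
have tau_inj : {in iota 0 S &, injective tau}.
  move=> i j; rewrite !mem_iota /= add0n => iS jS e.
  apply: ginj; rewrite ?inE //.
  by have [_ <-] := htau i iS; have [_ <-] := htau j jS; rewrite e.
(* The bijection lists the stable points in arbitrary order; sorting their parameters in [[0, 1[]
   recovers the cyclic order. *)
pose l := sort <=%R [seq tau k | k <- iota 0 S].
have szl : size l = S by rewrite size_sort size_map size_iota.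
have lsorted : sorted <%R l.
  rewrite lt_sorted_uniq_le sort_uniq map_inj_in_uniq // iota_uniq /=.
  exact: sort_le_sorted.
have lP x : x \in l -> exists2 k, (k < S)%N & x = tau k.
  by rewrite mem_sort => /mapP[k]; rewrite mem_iota => /= kS ->; exists k.
have nthP' k : (k < S)%N -> exists2 j, (j < S)%N & nth 0 l k = tau j.
  by move=> kS; apply: lP; rewrite mem_nth // szl.
pose t k := if (k < S)%N then nth 0 l k else nth 0 l 0 + 1.
have tS : t S = t 0%N + 1 by rewrite /t ltnn S0.
have stab k : (k <= S)%N -> stable K p (G (t k)).
  rewrite leq_eqVlt => /predU1P[->|kS].
    rewrite tS (circuit_periodic cir) /t S0.
    have [j jS ->] := nthP' 0%N S0; have [_ ->] := htau j jS; exact: gS.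
  rewrite /t kS.
  by have [j jS ->] := nthP' k kS; have [_ ->] := htau j jS; exact: gS.
have t_lt k : (k < S)%N -> t k < t k.+1.
  move=> kS; rewrite /t kS; case: ifP => k1S.
    by apply: (sorted_ltn_nth lt_trans) => //; rewrite inE szl.
  have [j jS ->] := nthP' k kS; have [/andP[_ j1] _] := htau j jS.
  have [i iS ->] := nthP' 0%N S0; have [/andP[i0 _] _] := htau i iS.
  lra.
have arcs k : exists ab : R * R, (k <= S)%N -> is_arc (t k) ab.1 ab.2.
  have [kS|kS] := leqP k S; last by exists (0, 0).
  have [upt _] := stable_up bK Kp cir r0 (stab k kS).
  by have [a [b arc]] := arc_exists upt; exists (a, b).
have {arcs}[ab hab] := choice arcs.
have wt k : (k <= S)%N -> w (t k) = 0.
  by move=> kS; have [_] := stable_up bK Kp cir r0 (stab k kS).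
exists t, (fun k => (ab k).1), (fun k => (ab k).2); split.
- by move=> k kS; split; [exact: wt|exact: hab].
- move=> k kS; split; first exact: t_lt.
  apply: (arc_separate (hab k (ltnW kS)) (hab k.+1 kS) (t_lt k kS)).
  by rewrite !wt // ltnW.
- have := hab S (leqnn S); rewrite tS => arcS.
  have [e1 e2] := arc_unique arcS (arc_periodic (hab 0%N (leq0n S))).
  by rewrite -e1 -e2.
- move=> z; split=> [sz|[k kS ->]]; last by apply: stab; exact: ltnW.
  have [k kS <-] := gsurj z sz; have [_ <-] := htau k kS.
  have : tau k \in l by rewrite mem_sort map_f // mem_iota.
  move=> /(nthP 0)[j]; rewrite szl => jS e; exists j => //.
  by rewrite /t jS e.
Qed.

(** Telescoping over one period, each step containing an arc. In case of equality no step exceeds 2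
    r, and a gap between consecutive arcs would have positive length because [Lam] is strictly
    increasing. *)
Lemma arcs_total (S : nat) (a b : nat -> R) : a S = a 0%N + 1 ->
  (forall k, (k < S)%N -> 2 * r <= Lam (b k) - Lam (a k)) ->
  (forall k, (k < S)%N -> b k <= a k.+1) ->
  2 * S%:R * r <= L /\ (L <= 2 * S%:R * r -> forall k, (k < S)%N ->
     b k = a k.+1 /\ Lam (b k) - Lam (a k) = 2 * r).
Proof.
move=> aS lab ba.
have mono s t : s <= t -> Lam s <= Lam t.
  by rewrite le_eqVlt => /predU1P[->//|/length_lt/ltW].
have step k : (k < S)%N -> 2 * r <= Lam (a k.+1) - Lam (a k).
  by move=> kS; have := lab k kS; have := mono _ _ (ba k kS); lra.
have tot j k : (j + k <= S)%N -> 2 * k%:R * r <= Lam (a (j + k)%N) - Lam (a j).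
  elim: k => [|k IHk] jkS; first by rewrite addn0 subrr mulr0 mul0r.
  rewrite addnS in jkS *; have := IHk (ltnW jkS); have := step _ jkS.
  rewrite -natr1; lra.
have LE : L = Lam (a S) - Lam (a 0%N) by rewrite aS (circuit_length cir); ring.
split; first by rewrite LE; exact: (tot 0%N S).
move=> Lle k kS.
(* The [k] steps before and the [S - k.+1] steps after step [k] take their share of the total, which
   leaves at most 2 r for step [k]. *)
have h1 : 2 * k%:R * r <= Lam (a k) - Lam (a 0%N).
  by apply: (tot 0%N k); exact: ltnW.
have h2 : 2 * (S - k.+1)%:R * r <= Lam (a S) - Lam (a k.+1).
  by have := tot k.+1 (S - k.+1)%N; rewrite subnKC //; apply.
have h3 : S%:R = k%:R + 1 + (S - k.+1)%:R :> R.
  by rewrite natr1 -natrD subnKC.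
rewrite h3 in Lle; have h4 := lab k kS; have h5 := mono _ _ (ba k kS).
have h6 : Lam (a k.+1) - Lam (a k) <= 2 * r by lra.
split; last by lra.
apply/eqP; rewrite eq_le ba //= leNgt; apply/negP => /length_lt; lra.
Qed.

Lemma length_ge (S : nat) : (0 < S)%N -> stable K p #= `I_S -> 2 * S%:R * r <= L.
Proof.
move=> S0 cS; have [t [a [b [arc ord [_ aS _] _]]]] := arcs_sequence S0 cS.
apply: (proj1 (@arcs_total S a b aS _ _)) => k kS; last by have [] := ord k kS.
by have [_ /arc_length_ge] := arc k (ltnW kS).
Qed.

End Arcs.

(** * Primitives and integrals of piecewise continuous functions *)

Section PiecewiseIntegral.
Variable R : realType.
Local Notation mu := (@lebesgue_measure R).
Implicit Types (f g F : R -> R) (a b x : R).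

(** The base point is meant to lie strictly to the left of the points of interest, so that a
    two-sided derivative is available also at the left end of a closed piece. *)
Lemma primitive_exists f a : continuous f ->
  exists F, forall x, a < x -> is_derive x 1 F (f x).
Proof.
move=> cf; exists (fun x => \int[mu]_(t in `[a, x]) f t) => x ax.
have intf : mu.-integrable `[a, x + 1] (EFin \o f).
  apply: continuous_compact_integrable; first exact: segment_compact.
  exact: continuous_subspaceT.
have x1 : x < x + 1 by rewrite ltrDl.
have [dF F'x] := continuous_FTC1_closed x1 intf ax (cf x).
by apply: DeriveDef; [exact: dF|rewrite -derive1E F'x].
Qed.

(** At a breakpoint the curve need not be differentiable, so its speed [f] is known only inside the
    interval; the end points form a null set. *)
Lemma integral_piece f g F a b : a < b -> continuous g ->
  (forall x, x \in `[a, b] -> is_derive x 1 F (g x)) ->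
  {in `]a, b[, f =1 g} ->
  measurable_fun `[a, b] f /\
  (\int[mu]_(x in `[a, b]) (f x)%:E = (F b - F a)%:E)%E.
Proof.
move=> ab cg dF fg.
have mg : measurable_fun `]a, b[ g.
  apply: (measurable_funS measurableT) => //; exact: continuous_measurable_fun.
have mf : measurable_fun `]a, b[ f.
  by apply: (eq_measurable_fun g) => // x; rewrite inE => xab; rewrite fg.
split.
  exact: (measurable_fun_itv_cc mf).
rewrite (eq_integral_itv_bounded _ _ mf mg fg) EFinB.
apply: continuous_FTC2 => //.
- exact: continuous_subspaceT.
- have cF x : x \in `[a, b] -> {for x, continuous F}.
    by move=> /dF D; exact: is_derive_continuous D.
  split.
  + move=> x xab; have := dF x (subset_itv_oo_cc xab); by case.
  + by apply: cvg_at_right_filter; apply: cF; rewrite in_itv /= lexx ltW.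
  + by apply: cvg_at_left_filter; apply: cF; rewrite in_itv /= lexx ltW.
- move=> x xab; rewrite derive1E.
  exact: (@derive_val _ _ _ _ _ _ _ (dF x (subset_itv_oo_cc xab))).
Qed.

Lemma integral_pieces f (n : nat) (tau : nat -> R) (g F : nat -> R -> R) :
  (forall x, 0 <= f x) ->
  (forall i, (i < n)%N -> tau i < tau i.+1 /\ continuous (g i)) ->
  (forall i, (i < n)%N -> {in `]tau i, tau i.+1[, f =1 g i}) ->
  (forall i x, (i < n)%N -> x \in `[tau i, tau i.+1] ->
     is_derive x 1 (F i) (g i x)) ->
  \int[mu]_(x in `[tau 0%N, tau n]) f x =
    \sum_(i < n) (F i (tau i.+1) - F i (tau i)).
Proof.
move=> f0 hg fg dF.
suff H k : (k <= n)%N -> [/\ tau 0%N <= tau k,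
    measurable_fun `[tau 0%N, tau k] f &
    (\int[mu]_(x in `[tau 0%N, tau k]) (f x)%:E =
     (\sum_(i < k) (F i (tau i.+1) - F i (tau i)))%:E)%E].
  by have [_ _] := H n (leqnn n); rewrite /Rintegral => ->.
elim: k => [_|k IHk kn].
  split => //; rewrite set_itv1; first exact: measurable_fun_set1.
  by rewrite integral_set1 big_ord0.
have [t0k mfk intk] := IHk (ltnW kn).
have [tk cg] := hg k kn.
have [mfk1 intk1] := integral_piece tk cg (fun x => dF k x kn) (fg k kn).
have t0k1 : tau 0%N <= tau k.+1 by rewrite (le_trans t0k) // ltW.
have U : `[tau 0%N, tau k.+1]%classic =
    (`[tau 0%N, tau k] `|` `]tau k, tau k.+1])%classic.
  by rewrite -itv_bndbnd_setU // bnd_simp // ltW.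
have mfk1' : measurable_fun `]tau k, tau k.+1] f.
  apply: measurable_funS mfk1 => //; exact: subset_itv_oc_cc.
have mU : measurable_fun (`[tau 0%N, tau k] `|` `]tau k, tau k.+1])%classic f.
  by apply/measurable_funU => //; split.
split => //; first by rewrite U.
rewrite U ge0_integral_setU //=; last 3 first.
- exact/measurable_EFinP.
- by move=> x _; rewrite lee_fin.
- apply/disj_setPS => x [] /=; rewrite !in_itv /= => /andP[_ xk] /andP[kx _].
  by move: xk; rewrite leNgt kx.
rewrite intk integral_itv_obnd_cbnd ?intk1 -?EFinD ?big_ord_recr //=.
exact/measurable_EFinP.
Qed.

End PiecewiseIntegral.

Section GermContinuity.
Variable R : realType.
Local Notation plane := 'rV[R]_2.
Implicit Types (c : R -> plane) (s t u e sg : R) (P : R -> R).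

Lemma curve_lipschitz_at c : smooth_curve c -> exists M d : R,
  [/\ 0 < M, 0 < d & forall h, `|h| < d -> enorm (c h - c 0) <= M * `|h|].
Proof.
move=> sc; have [d d0 hd] := curve_expansion 0 (smooth_curve_derive1 sc) (@ltr01 R).
exists (enorm (derive1 c 0) + 1), d; split; [by rewrite ltr_wpDl ?enorm_ge0|exact: d0|].
move=> h hh; have := hd h hh; rewrite add0r mul1r => a1.
rewrite -[c h - c 0](subrK (h *: derive1 c 0)).
apply: le_trans (enormD _ _) _; rewrite enormZ mulrDl mul1r addrC mulrC.
by rewrite lerD2l.
Qed.

Lemma germs_continuous (G : R -> plane) (Lam : R -> R) :
  (forall u, exists c P e, germ G Lam u 1 c P e) ->
  (forall u, exists c P e, germ G Lam u (-1) c P e) ->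
  forall u (eta : R), 0 < eta -> exists2 d, 0 < d & forall t, `|t - u| < d ->
    enorm (G t - G u) < eta.
Proof.
move=> right left u eta eta0.
have [cr [Pr [er [er0 scr _ hr]]]] := right u.
have [cl [Pl [el [el0 scl _ hl]]]] := left u.
have [Mr [dr [Mr0 dr0 hMr]]] := curve_lipschitz_at scr.
have [Ml [dl [Ml0 dl0 hMl]]] := curve_lipschitz_at scl.
pose d := Num.min (Num.min er el) (Num.min (Num.min dr dl)
  (Num.min (eta / Mr) (eta / Ml))).
have d0 : 0 < d by rewrite !lt_min er0 el0 dr0 dl0 !divr_gt0.
exists d; first exact: d0.
move=> t; rewrite distrC !lt_min.
move=> /andP[/andP[ter tel] /andP[/andP[tdr tdl] /andP[tMr tMl]]].
have [ut|tu] := leP u t.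
  have n1 : `|u - t| = t - u by rewrite distrC ger0_norm // subr_ge0.
  rewrite n1 in ter tdr tMr.
  have [|Gt _ _] := hr (t - u); first by apply/andP; split; lra.
  have [|Gu _ _] := hr 0; first by rewrite lexx ltW.
  rewrite mul1r [u + _]addrC subrK in Gt; rewrite mulr0 addr0 in Gu.
  have n2 : `|t - u| = t - u by rewrite distrC in n1.
  rewrite Gt Gu; apply: le_lt_trans (hMr _ _) _; rewrite n2 //.
  by rewrite mulrC -ltr_pdivlMr.
have n1 : `|u - t| = u - t by rewrite ger0_norm // subr_ge0 ltW.
rewrite n1 in tel tdl tMl.
have [|Gt _ _] := hl (u - t); first by apply/andP; split; lra.
have [|Gu _ _] := hl 0; first by rewrite lexx ltW.
have e1 : u + -1 * (u - t) = t by ring.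
rewrite e1 in Gt; rewrite mulr0 addr0 in Gu.
rewrite Gt Gu; apply: le_lt_trans (hMl _ _) _; rewrite n1 //.
by rewrite mulrC -ltr_pdivlMr.
Qed.

End GermContinuity.

(** * Periodic extension of a closed parametrization *)

Section PeriodicExtension.
Variable R : realType.
Local Notation plane := 'rV[R]_2.
Implicit Types (c : R -> plane) (s t u e sg : R) (P : R -> R) (m : int).
Variables (K : set plane) (gamma : R -> plane) (lam : R -> R) (L : R).
Hypotheses (bK : convex_body K)
  (g_inj : {in `[0, 1[ &, injective gamma}) (g01 : gamma 0 = gamma 1)
  (g_bd : gamma @` `[0, 1] = bd K) (lam01 : lam 1 = lam 0 + L)
  (g_right : forall t : R, 0 <= t < 1 -> exists c P e,
     germ gamma lam t 1 c P e /\ t + e <= 1)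
  (g_left : forall t : R, 0 < t <= 1 -> exists c P e,
     germ gamma lam t (-1) c P e /\ 0 <= t - e).

Definition periodic_curve u : plane := gamma (u - (Num.floor u)%:~R).
Definition periodic_length u : R := lam (u - (Num.floor u)%:~R) + L * (Num.floor u)%:~R.
Local Notation G := periodic_curve.
Local Notation Lam := periodic_length.

Lemma frac_itv u : 0 <= u - (Num.floor u)%:~R < 1.
Proof.
have /andP[h1 h2] := floor_itv u; rewrite subr_ge0 h1 /= ltrBlDl.
by rewrite intrD in h2.
Qed.

Lemma floor_shift m t : 0 <= t < 1 -> Num.floor (m%:~R + t) = m.
Proof.
move=> /andP[t0 t1]; apply: floor_def.
by rewrite intrD lerDl t0 ltrD2l.
Qed.

Lemma periodic_shift m t : 0 <= t <= 1 ->
  G (m%:~R + t) = gamma t /\ Lam (m%:~R + t) = lam t + L * m%:~R.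
Proof.
move=> /andP[t0]; rewrite le_eqVlt => /predU1P[->|t1].
  have z01 : 0 <= (0 : R) < 1 by rewrite lexx ltr01.
  have -> : m%:~R + 1 = (m + 1)%:~R + 0 :> R by rewrite intrD addr0.
  rewrite /G /Lam floor_shift // [_ + 0]addrC addrK g01 lam01 intrD.
  by split => //; ring.
have t01 : 0 <= t < 1 by rewrite t0.
by rewrite /G /Lam floor_shift // [_ + t]addrC addrK.
Qed.

Lemma frac_decomp u : u = (Num.floor u)%:~R + (u - (Num.floor u)%:~R).
Proof. by rewrite addrC subrK. Qed.

Lemma periodic_intr m u : G (m%:~R + u) = G u /\ Lam (m%:~R + u) = Lam u + L * m%:~R.
Proof.
have f01 : 0 <= u - (Num.floor u)%:~R <= 1.
  by have /andP[-> /ltW ->] := frac_itv u.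
rewrite (frac_decomp u); set k := Num.floor u in f01 *; set t := u - _ in f01 *.
rewrite addrA -intrD.
have [-> ->] := periodic_shift (m + k) f01; have [-> ->] := periodic_shift k f01.
by split => //; rewrite intrD; ring.
Qed.

Lemma periodic_right u : exists c P e, germ G Lam u 1 c P e.
Proof.
have /andP[t0 t1] := frac_itv u; rewrite (frac_decomp u).
set m := Num.floor u in t0 t1 *; set t := u - _ in t0 t1 *.
have t01 : 0 <= t < 1 by rewrite t0.
have [c [P [e [[e0 sc dP hg] te]]]] := g_right t01.
exists c, P, e; split; [exact: e0|exact: sc|exact: dP|move=> s hs].
have [g1 g2 g3] := hg s hs; have /andP[s0 se] := hs.
have st : 0 <= t + 1 * s <= 1 by rewrite mul1r; lra.
have t01' : 0 <= t <= 1 by rewrite t0 ltW.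
rewrite -addrA; have [-> ->] := periodic_shift m st.
have [_ ->] := periodic_shift m t01'; split; [exact: g1|exact: g2|].
by rewrite -g3; ring.
Qed.

Lemma periodic_left u : exists c P e, germ G Lam u (-1) c P e.
Proof.
(* At an integer the left germ has to be taken at the end 1 of the period, so the representative is
   chosen in []0, 1]]; the floor of [- u] provides it. *)
have [m [t [ut t01]]] : exists m t, u = m%:~R + t /\ 0 < t <= 1.
  have /andP[t0 t1] := frac_itv (- u).
  exists (- Num.floor (- u) - 1), (1 - (- u - (Num.floor (- u))%:~R)).
  split; last by rewrite subr_gt0 t1 lerBlDr lerDl.
  by rewrite intrB rmorphN /=; ring.
have /andP[t0 t1] := t01; rewrite ut.
have [c [P [e [[e0 sc dP hg] te]]]] := g_left t01.
exists c, P, e; split; [exact: e0|exact: sc|exact: dP|move=> s hs].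
have [g1 g2 g3] := hg s hs; have /andP[s0 se] := hs.
have st : 0 <= t + -1 * s <= 1 by lra.
have t01' : 0 <= t <= 1 by rewrite ltW.
rewrite -addrA; have [-> ->] := periodic_shift m st.
have [_ ->] := periodic_shift m t01'; split; [exact: g1|exact: g2|].
by rewrite -g3; ring.
Qed.

Lemma periodic_continuous : continuous G.
Proof.
move=> u; apply/(@cvgrPdist_lt R plane) => eta eta0.
have [d d0 hd] := germs_continuous periodic_right periodic_left u eta0.
apply/(@nbhs_normP R R^o); exists d; first exact: d0.
move=> t; rewrite /ball_ /= distrC => /hd; apply: le_lt_trans.
by rewrite enormC norm_le_enorm.
Qed.

Lemma periodic_inj s t : `|s - t| < 1 -> G s = G t -> s = t.
Proof.
move=> st Gst.
have fs := frac_itv s; have ft := frac_itv t.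
have e : s - (Num.floor s)%:~R = t - (Num.floor t)%:~R.
  by apply: g_inj => //; rewrite in_itv.
have e2 : s - t = (Num.floor s - Num.floor t)%:~R by rewrite intrB; lra.
set k := Num.floor s - Num.floor t in e2.
have k1 : `|k| < 1 by rewrite -(ltr_int R) intr_norm -e2.
have k0 : k = 0 by case: k k1 {e2} => [[|n]|n].
by apply/eqP; rewrite -subr_eq0 e2 k0.
Qed.

Lemma periodic_onto z u : bd K z -> exists2 t, u <= t < u + 1 & G t = z.
Proof.
rewrite -g_bd => -[t0 /= t001 <-].
have h01 : 0 <= t0 <= 1 by rewrite in_itv /= in t001.
have /andP[f0 f1] := frac_itv (t0 - u).
exists (u + (t0 - u - (Num.floor (t0 - u))%:~R)); first by rewrite lerDl f0 ltrD2l.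
have -> : u + (t0 - u - (Num.floor (t0 - u))%:~R) = (- Num.floor (t0 - u))%:~R + t0.
  by rewrite rmorphN /=; ring.
by have [] := periodic_shift (- Num.floor (t0 - u)) h01.
Qed.

Lemma periodic_circuit : circuit K G Lam L.
Proof.
split.
- by move=> u; rewrite addrC; have [+ _] := periodic_intr 1 u.
- by move=> u; rewrite addrC; have [_ +] := periodic_intr 1 u; rewrite mulr1.
- move=> u; rewrite -g_bd; exists (u - (Num.floor u)%:~R) => //=.
  by rewrite in_itv /=; have /andP[-> /ltW ->] := frac_itv u.
- exact: periodic_inj.
- move=> u e e0.
  pose d := Num.min e 1 / 4.
  have d0 : 0 < d by rewrite divr_gt0 // lt_min e0 ltr01.
  have de : d < e.
    by rewrite ltr_pdivrMr // gt_min; apply/orP; left; lra.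
  have d1 : d < 1 / 2.
    by rewrite ltr_pdivrMr // gt_min; apply/orP; right; lra.
  (* The rest of the period has a compact image which by injectivity avoids [G u], so boundary
     points close to [G u] have parameters close to [u]. *)
  have clC : closed (G @` `[u + d, u + 1 - d]).
    apply: compact_closed; first exact: norm_hausdorff.
    apply: continuous_compact; last exact: segment_compact.
    exact/continuous_subspaceT/periodic_continuous.
  have nC : (~` (G @` `[u + d, u + 1 - d])) (G u).
    move=> [t /=]; rewrite in_itv /= => /andP[t1 t2] Gt.
    have : t = u by apply: periodic_inj Gt; rewrite ltr_norml; lra.
    lra.
  have := open_nbhs_nbhs (conj (closed_openC clC) nC).
  apply: filterS => z nz bz.
  have [t /andP[t1 t2] Gt] := periodic_onto (u - d) bz.
  exists t => //; rewrite ltr_norml.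
  have [tu|ut] := ltP t (u + d); first by apply/andP; split; lra.
  by exfalso; apply: nz; exists t => //=; rewrite in_itv /= ut /=; lra.
- move=> z u; exact: periodic_onto.
- exact: periodic_right.
- exact: periodic_left.
Qed.

End PeriodicExtension.

(** * Arc length along a piecewise smooth boundary *)

Section BoundaryParametrization.
Variable R : realType.
Local Notation plane := 'rV[R]_2.
Implicit Types (K : set plane) (c gamma : R -> plane) (s t u e sg : R).

Lemma continuous_speed c : smooth_curve c -> continuous (fun t => enorm (derive1 c t)).
Proof.
move=> sc t; have D := is_derive_dot t (smooth_curve_derive2 sc) (smooth_curve_derive2 sc).
apply: (continuous_comp (is_derive_continuous D)); exact: sqrt_continuous.
Qed.

Lemma piece_right (n : nat) (tau : nat -> R) t :
  tau 0%N <= t < tau n -> exists2 i, (i < n)%N & tau i <= t < tau i.+1.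
Proof.
elim: n => [|n IHn] /andP[t0 tn]; first by move: tn; rewrite ltNge t0.
have [tn'|tn'] := ltP t (tau n); last by exists n; rewrite // tn'.
by have [|i iin hi] := IHn; [rewrite t0|exists i => //; exact: leqW].
Qed.

Lemma piece_left (n : nat) (tau : nat -> R) t :
  tau 0%N < t <= tau n -> exists2 i, (i < n)%N & tau i < t <= tau i.+1.
Proof.
elim: n => [|n IHn] /andP[t0 tn]; first by move: t0; rewrite ltNge tn.
have [tn'|tn'] := leP t (tau n); last by exists n; rewrite // tn'.
by have [|i iin hi] := IHn; [rewrite t0|exists i => //; exact: leqW].
Qed.

Lemma boundary_circuit K gamma : convex_body K -> boundary_param K gamma ->
  exists G Lam, circuit K G Lam (curve_length gamma).
Proof.
move=> bK [cg ginj g01 gbd [n [tau [tau0 taun hpiece]]]].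
have /choice[cc hcc] : forall i, exists c : R -> plane, (i < n)%N ->
    [/\ tau i < tau i.+1, smooth_curve c & forall t, t \in `[tau i, tau i.+1] ->
      gamma t = c t /\ derive1 c t != 0].
  move=> i; have [iin|iin] := ltnP i n; last by exists (cst 0).
  by have [ti [c sc hc]] := hpiece i iin; exists c.
pose g i t := enorm (derive1 (cc i) t).
have cgi i : (i < n)%N -> continuous (g i).
  by move=> /hcc[_ sc _]; exact: continuous_speed.
have /choice[F hF] : forall i, exists F : R -> R, (i < n)%N ->
    forall x, tau i - 1 < x -> is_derive x 1 F (g i x).
  move=> i; have [iin|iin] := ltnP i n; last by exists (cst 0).
  by have [F hF] := primitive_exists (tau i - 1) (cgi i iin); exists F.
have dF i x : (i < n)%N -> x \in `[tau i, tau i.+1] -> is_derive x 1 (F i) (g i x).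
  move=> iin; rewrite in_itv /= => /andP[ix _]; apply: hF => //.
  by rewrite (lt_le_trans _ ix) // gtrBl.
have tauS i : (i < n)%N -> tau i < tau i.+1 by move=> /hcc[].
have tau_le i j : (i <= j)%N -> (j <= n)%N -> tau i <= tau j.
  elim: j => [|j IHj]; first by rewrite leqn0 => /eqP ->.
  rewrite leq_eqVlt => /predU1P[->//|ij jn].
  by rewrite (le_trans (IHj ij (ltnW jn))) // ltW // tauS.
(* [F i (clamp i t)] is frozen outside the [i]-th piece, so on each piece [lam] has the increments
   of the single primitive [F i], and no constants have to be matched. *)
pose clamp i t := Num.max (tau i) (Num.min t (tau i.+1)).
pose lam t := \sum_(i < n) (F i (clamp i t) - F i (tau i)).
have lamD i s t : (i < n)%N -> tau i <= s <= tau i.+1 -> tau i <= t <= tau i.+1 ->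
    lam t - lam s = F i t - F i s.
  move=> iin /andP[s1 s2] /andP[t1 t2].
  rewrite /lam -sumrB (bigD1 (Ordinal iin)) //= big1 ?addr0.
    rewrite /clamp !min_l // !max_r //; ring.
  move=> j jNi.
  have [ji|ij] := ltnP j i.
    have h : tau j.+1 <= tau i by apply: tau_le => //; exact: ltnW.
    have -> : clamp j t = clamp j s.
      by rewrite /clamp !min_r // (le_trans h).
    by rewrite subrr.
  have {}ij : (i < j)%N by rewrite ltn_neqAle ij andbT; apply: contra jNi => /eqP e; apply/eqP/val_inj.
  have h : tau i.+1 <= tau j by apply: tau_le => //; exact: ltnW.
  have h2 : tau j <= tau j.+1 by rewrite ltW // tauS.
  have -> : clamp j t = clamp j s.
    rewrite /clamp !max_l // ge_min; apply/orP; left.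
      exact: le_trans s2 h.
    exact: le_trans t2 h.
  by rewrite subrr.
have lam0 : lam 0 = 0.
  rewrite /lam big1 // => i _; rewrite /clamp max_l ?subrr // ge_min -tau0.
  by rewrite tau_le // ltnW.
have lam1 : lam 1 = curve_length gamma.
  have -> : curve_length gamma = \sum_(i < n) (F i (tau i.+1) - F i (tau i)).
    rewrite /curve_length -{1}tau0 -taun.
    apply: (integral_pieces _ _ _ dF).
    - by move=> x; exact: enorm_ge0.
    - by move=> i iin; split; [exact: tauS|exact: cgi].
    - move=> i iin x; rewrite in_itv /= => /andP[ix xi].
      rewrite /g; congr enorm; rewrite !derive1E; apply: near_eq_derive.
      have : \forall y \near x, y \in `]tau i, tau i.+1[.
        by apply: near_in_itvoo; rewrite in_itv /= ix.
      apply: filterS => y yi; have [_ _ h] := hcc i iin.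
      by have [] := h y (subset_itv_oo_cc yi).
  apply: eq_bigr => i _; rewrite /clamp min_r ?max_r ?(ltW (tauS _ _)) //.
  by rewrite -taun tau_le.
exists (periodic_curve gamma), (periodic_length lam (curve_length gamma)).
apply: periodic_circuit => //.
- by rewrite lam0 add0r.
- move=> t ht; have [|i iin /andP[it ti]] := @piece_right n tau t.
    by rewrite tau0 taun.
  have [_ sc hc] := hcc i iin.
  have ti1 : tau i.+1 <= 1 by rewrite -taun tau_le.
  have inside s : 0 <= s -> s <= tau i.+1 - t -> tau i <= t + 1 * s <= tau i.+1.
    by move=> *; lra.
  have ht0 : tau i <= t <= tau i.+1 by rewrite it ltW.
  exists (fun s => cc i (t + 1 * s)), (fun s => F i (t + 1 * s) - F i t), (tau i.+1 - t).
  split; last by lra.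
  split.
  + by rewrite subr_gt0.
  + exact: smooth_curve_affine.
  + move=> s /andP[s0 se].
    have D := is_derive_affine (dF i (t + 1 * s) iin (inside s s0 se)).
    have D2 := is_deriveB D (is_derive_cst (F i t) s 1).
    apply: (is_derive_eq D2); rewrite (derive1_affine t 1 s sc) scale1r.
    by rewrite subr0 [LHS]mul1r.
  + move=> s /andP[s0 se]; have hs := inside s s0 se.
    have [gc vc] := hc _ hs.
    rewrite (derive1_affine t 1 s sc) scale1r; split; [exact: gc|exact: vc|].
    by rewrite (lamD i _ _ iin ht0 hs) [RHS]mul1r.
- move=> t ht; have [|i iin /andP[it ti]] := @piece_left n tau t.
    by rewrite tau0 taun.
  have [_ sc hc] := hcc i iin.
  have ti0 : 0 <= tau i by rewrite -tau0 tau_le // ltnW.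
  have inside s : 0 <= s -> s <= t - tau i -> tau i <= t + (-1) * s <= tau i.+1.
    by move=> *; lra.
  have ht0 : tau i <= t <= tau i.+1 by rewrite ti ltW.
  exists (fun s => cc i (t + (-1) * s)), (fun s => F i t - F i (t + (-1) * s)), (t - tau i).
  split; last by lra.
  split.
  + by rewrite subr_gt0.
  + exact: smooth_curve_affine.
  + move=> s /andP[s0 se].
    have D := is_derive_affine (dF i (t + (-1) * s) iin (inside s s0 se)).
    have D2 := is_deriveB (is_derive_cst (F i t) s 1) D.
    apply: (is_derive_eq D2); rewrite (derive1_affine t (-1) s sc) scaleN1r enormN /g.
    by ring.
  + move=> s /andP[s0 se]; have hs := inside s s0 se.
    have [gc vc] := hc _ hs.
    rewrite (derive1_affine t (-1) s sc) scaleN1r oppr_eq0.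
    split; [exact: gc|exact: vc|].
    by rewrite (lamD i _ _ iin ht0 hs); ring.
Qed.

End BoundaryParametrization.

(** * The equality case: arcs are segments *)

Section StraightArcs.
Variable R : realType.
Local Notation plane := 'rV[R]_2.
Implicit Types (c : R -> plane) (s t u e sg a b d : R) (P : R -> R).

Lemma derive0_const (f f1 : R -> R) a b :
  (forall t, t \in `[a, b] -> is_derive t 1 f (f1 t)) ->
  (forall t, t \in `[a, b] -> f1 t = 0) -> a <= b -> f b = f a.
Proof.
move=> df f10 ab; have [t tab e] := mean_value df ab.
by apply/eqP; rewrite -subr_eq0 e f10 // mul0r.
Qed.

Lemma right_const_derive0 (f : R -> R) (x l d : R) : is_derive x 1 f l -> 0 < d ->
  (forall h, 0 <= h < d -> f (x + h) = f x) -> l = 0.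
Proof.
move=> D d0 hf; apply/eqP/negPn/negP => l0.
have l20 : 0 < `|l| / 2 by rewrite divr_gt0 // normr_gt0.
have [d' d'0 hd] := is_derive_expansion D l20.
pose h := Num.min d d' / 2.
have h0 : 0 < h by rewrite divr_gt0 // lt_min d0.
have : h < Num.min d d' by rewrite ltr_pdivrMr ?ltr_pMr ?ltr1n // lt_min d0.
rewrite lt_min => /andP[hd1 hd2].
have := hd h; rewrite (gtr0_norm h0) => /(_ hd2).
rewrite hf ?(ltW h0) // subrr sub0r normrN normrM (gtr0_norm h0) ler_pM2r //.
have : 0 < `|l| by rewrite normr_gt0.
lra.
Qed.

Definition unit_tangent (v : plane) : plane := (enorm v)^-1 *: v.

Lemma unit_tangentZ (l : R) (v : plane) : 0 < l -> unit_tangent (l *: v) = unit_tangent v.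
Proof.
move=> l0; rewrite /unit_tangent enormZ gtr0_norm // scalerA.
by rewrite invfM mulrAC mulVf ?gt_eqF // mul1r.
Qed.

Lemma unit_tangentN (v : plane) : unit_tangent (- v) = - unit_tangent v.
Proof. by rewrite /unit_tangent enormN scalerN. Qed.

Lemma unit_tangent_dot (v : plane) : v != 0 -> dot (unit_tangent v) (unit_tangent v) = 1.
Proof.
move=> v0; rewrite /unit_tangent dotZl dotZr -enorm_sqr; field.
by rewrite enorm_eq0.
Qed.

Variables (K : set plane) (p : plane) (G : R -> plane) (Lam : R -> R) (L r : R).
Hypotheses (bK : convex_body K) (Kp : K° p) (cir : circuit K G Lam L).
Hypotheses (r0 : 0 < r) (rob : forall x : plane, enorm (x - p) < r -> only_nondegenerate K x).

Local Notation germ := (germ G Lam).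
Local Notation w := (normal_distance G Lam p).
Local Notation is_arc := (is_arc p G Lam r).

(* The speeds of the curve and of the foot of [p] differ by a positive multiple
   of the curvature, which therefore vanishes. *)
Lemma germ_straight u sg c P e d : germ u sg c P e -> 0 < d <= e ->
  (forall s t, 0 <= s -> s < t -> t < d ->
     P t - P s = tangential p c t - tangential p c s) ->
  forall t, 0 <= t < d -> unit_tangent (derive1 c t) = unit_tangent (derive1 c 0) /\
    c t - c 0 = (tangential p c t - tangential p c 0) *: unit_tangent (derive1 c 0).
Proof.
move=> g /andP[d0 de] hP t /andP[t0 td]; have [e0 sc dP hg] := g.
have d1 := smooth_curve_derive1 sc; have d2 := smooth_curve_derive2 sc.
have v0 s : 0 <= s < d -> derive1 c s != 0.
  by move=> /andP[s0 sd]; have [|] := hg s; rewrite // s0 /=; lra.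
(* Equal speeds make the product of the foot minus [c s] with the second derivative vanish; the
   first factor is nonzero and normal, so the second derivative is tangent. *)
have speed s : 0 <= s < d -> tangential_derive p c s = enorm (derive1 c s) /\
    exists l, derive1n 2 c s = l *: derive1 c s.
  move=> hs; have /andP[s0 sd] := hs.
  have hse : 0 <= s < e by rewrite s0; lra.
  have hse' : 0 <= s <= e by rewrite s0; lra.
  have D := is_deriveB (dP s hse') (is_derive_tangential p sc (v0 s hs)).
  have ds0 : 0 < d - s by rewrite subr_gt0.
  have e1 : enorm (derive1 c s) - tangential_derive p c s = 0.
    apply: (right_const_derive0 D ds0) => h /andP[h0 hd].
    change (P (s + h) - tangential p c (s + h) = P s - tangential p c s).
    have [->|hN0] := eqVneq h 0; first by rewrite addr0.
    have hgt0 : 0 < h by rewrite lt_def hN0.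
    have := hP s (s + h) s0; rewrite ltrDl -ltrBrDl hgt0 hd => /(_ isT isT).
    lra.
  split; first by lra.
  have [e2 _] := germ_speed_ge bK Kp cir g hse.
  have bs := germ_branch_shift cir g hse.
  have fN := foot_neq bK Kp bs; have [_ _ vs0 _] := bs.
  rewrite (derive1_affine s 1 0 sc) scale1r mulr0 addr0 in fN vs0.
  rewrite -subr_eq0 in fN.
  apply: (perp_collinear fN vs0 (foot_perp _ _ vs0)).
  rewrite e1 in e2; apply/eqP; move/eqP: e2; rewrite eq_sym mulf_eq0 invr_eq0.
  by rewrite enorm_eq0 (negPf vs0) orbF.
have sub s : s \in `[0, t] -> 0 <= s < d.
  by rewrite in_itv /= => /andP[-> st]; rewrite (le_lt_trans st).
have T_const s : 0 <= s <= t -> unit_tangent (derive1 c s) = unit_tangent (derive1 c 0).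
  move=> /andP[s0 st].
  suff H i : unit_tangent (derive1 c s) 0 i = unit_tangent (derive1 c 0) 0 i.
    by apply: row2P.
  pose f x := derive1 c x 0 i * (enorm (derive1 c x))^-1.
  have df x : x \in `[0, s] -> is_derive x 1 f 0.
    move=> xs; have hx : 0 <= x < d.
      by apply: sub; move: xs; rewrite !in_itv /= => /andP[-> xs]; rewrite (le_trans xs).
    have [_ [l el]] := speed x hx; have vx := v0 x hx.
    have vn : enorm (derive1 c x) != 0 by rewrite enorm_eq0.
    have D := is_deriveM (d2 x i) (is_derive_inv (f := fun s => enorm (derive1 c s)) vn
      (is_derive_enorm d2 vx)).
    apply: (is_derive_eq D); rewrite el mxE dotZr -enorm_sqr /GRing.scale /=.
    by field.
  have Ef x : unit_tangent (derive1 c x) 0 i = f x by rewrite /f mxE mulrC.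
  have fs := derive0_const df (fun _ _ => erefl) s0.
  exact: etrans (Ef s) (etrans fs (esym (Ef 0))).
split; first by apply: T_const; rewrite t0 lexx.
set T := unit_tangent (derive1 c 0) in T_const *.
suff H i : (c t - c 0) 0 i = ((tangential p c t - tangential p c 0) *: T) 0 i.
  by apply: row2P.
pose f x := c x 0 i - tangential p c x * T 0 i.
have df x : x \in `[0, t] -> is_derive x 1 f 0.
  move=> xt; have hx := sub x xt; have [e1 _] := speed x hx; have vx := v0 x hx.
  have D := is_deriveB (d1 x i)
    (is_deriveM (is_derive_tangential p sc vx) (is_derive_cst (T 0 i) x 1)).
  apply: (is_derive_eq D); rewrite /cst scaler0 add0r e1 /GRing.scale /=.
  rewrite in_itv /= in xt; rewrite -(T_const x xt) !mxE.
  by field; rewrite enorm_eq0.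
have Ef : f t - f 0 = (c t - c 0) 0 i -
    ((tangential p c t - tangential p c 0) *: T) 0 i.
  by rewrite /f !mxE; ring.
apply/eqP; rewrite -subr_eq0 -Ef subr_eq0; apply/eqP.
exact: (derive0_const df (fun _ _ => erefl) t0).
Qed.

Definition tangent u := unit_tangent (direction G Lam u).

Lemma direction_neq0 u : direction G Lam u != 0.
Proof.
have [c [P [e g]]] := circuit_right cir u; rewrite (directionE g).
by case: (germ_branch cir g).
Qed.

Lemma tangent_dot u : dot (tangent u) (tangent u) = 1.
Proof. exact/unit_tangent_dot/direction_neq0. Qed.

Lemma tangent_normal u : dot (G u - p) (tangent u) = w u.
Proof. by rewrite /tangent /unit_tangent dotZr normal_distanceE mulrC. Qed.

(** The relation is transitive, so it is enough to check it near a point [x] of the arc. There both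
    germs are straight, and their directions are opposite because the boundary is smooth at [x]. *)
Lemma arc_straight u a b : is_arc u a b ->
  (forall s t, a < s -> s < t -> t < b -> Lam t - Lam s = w t - w s) ->
  forall s t, a < s -> s < t -> t < b ->
    tangent s = tangent t /\ G t - G s = (w t - w s) *: tangent s.
Proof.
move=> arc tight s t as_ st tb; have [_ up _ _] := arc.
pose Q s t := tangent s = tangent t /\ G t - G s = (w t - w s) *: tangent s.
apply: (@local_to_global _ Q s t _ st).
  move=> x y z [e1 e2] [e3 e4]; split; first by rewrite e1.
  by rewrite -(subrKA (G y)) e4 e2 -e1 -scalerDl subrKA.
move=> x /andP[sx xt].
have ax : a < x by lra. have xb : x < b by lra.
have [cr [Pr [er gr]]] := circuit_right cir x.
have [cl [Pl [el gl]]] := circuit_left cir x.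
have [er0 scr dPr hr] := gr; have [el0 scl dPl hl] := gl.
have wx : w x = tangential p cr 0 := normal_distance_germ p gr.
have upx : Up p G Lam r x by apply: up; rewrite ax.
have wxr := up_lt upx.
have [|c0 [sg [lc0 _ _ hsg]]] := robust_smooth bK Kp cir rob gr; first by rewrite -wx.
have [wl _] := smooth_local bK Kp cir gr gl lc0 hsg.
have [l l0 el0'] := branches_opposite bK Kp lc0 (germ_branch cir gr) (germ_branch cir gl)
  (circuit_cover cir gr gl).
have [Gr _] := germ0 gr; have [Gl _] := germ0 gl.
have Tx : tangent x = unit_tangent (derive1 cr 0) by rewrite /tangent (directionE gr).
have Tl : unit_tangent (derive1 cl 0) = - tangent x.
  by rewrite el0' unit_tangentN unit_tangentZ // Tx.
pose dr := Num.min er (b - x); pose dl := Num.min el (x - a).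
have dr0 : 0 < dr by rewrite lt_min er0 subr_gt0.
have dl0 : 0 < dl by rewrite lt_min el0 subr_gt0.
have dre : dr <= er by rewrite ge_min lexx.
have dle : dl <= el by rewrite ge_min lexx.
have bx : x + dr <= b by rewrite -lerBrDl ge_min lexx orbT.
have ax' : a <= x - dl by rewrite lerBrDr -lerBrDl ge_min lexx orbT.
have exy y : x + y - x = y by rewrite addrC addKr.
have Pr_eq y z : 0 <= y -> y < z -> z < dr ->
    Pr z - Pr y = tangential p cr z - tangential p cr y.
  move=> y0 yz zd; have xy : x <= x + y by rewrite lerDl.
  have yz' : x + y < x + z by rewrite ltrD2l.
  have ze : x + z < x + er by rewrite ltrD2l (lt_le_trans zd).
  have := tight _ _ (lt_le_trans ax xy) yz' (lt_le_trans _ bx); rewrite ltrD2l => /(_ zd).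
  have [-> _ _ ->] := germ_right p gr xy (lt_trans yz' ze).
  have [-> _ _ ->] := germ_right p gr (le_trans xy (ltW yz')) ze.
  by rewrite !exy => <-; rewrite opprD addrACA subrr add0r.
have Pl_eq y z : 0 <= y -> y < z -> z < dl ->
    Pl z - Pl y = tangential p cl z - tangential p cl y.
  move=> y0 yz zd; have ye := lt_le_trans (lt_trans yz zd) dle.
  have ze := lt_le_trans zd dle.
  have := tight (x - z) (x - y); rewrite ltrD2l ltrN2 yz.
  have [wy Ly] : w (x - y) = - tangential p cl y /\ Lam (x - y) = Lam x - Pl y.
    have [->|yN0] := eqVneq y 0.
      by have [_] := germ0 gl; rewrite !subr0 mulN1r => ->; rewrite addr0.
    have [||-> _ _ ->] := germ_left p gl (s := x - y); first by rewrite ltrD2l ltrN2.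
      by rewrite gtrBl lt_def yN0.
    by rewrite opprB addrC subrK.
  have [||-> _ _ ->] := germ_left p gl (s := x - z); first by rewrite ltrD2l ltrN2.
    by rewrite gtrBl (le_lt_trans y0).
  have -> : x - (x - z) = z by rewrite opprB addrC subrK.
  rewrite wy Ly.
  have h1 : a < x - z by apply: le_lt_trans ax' _; rewrite ltrD2l ltrN2.
  have h2 : x - y < b by apply: le_lt_trans xb; rewrite gerBl.
  by move=> /(_ h1 isT h2); lra.
have dre' : 0 < dr <= er by rewrite dr0.
have dle' : 0 < dl <= el by rewrite dl0.
have SR := germ_straight gr dre' Pr_eq.
have SL := germ_straight gl dle' Pl_eq.
have QR y : x <= y -> y < x + dr ->
    tangent y = tangent x /\ G y - G x = (w y - w x) *: tangent x.
  move=> xy yd; have ye : y < x + er by apply: lt_le_trans yd _; rewrite lerD2l.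
  have [-> dE -> _] := germ_right p gr xy ye.
  have [|e1 e2] := SR (y - x); first by rewrite subr_ge0 xy ltrBlDl.
  split; first exact: etrans (congr1 unit_tangent dE) (etrans e1 (esym Tx)).
  by rewrite Gr wx Tx.
have QL y : x - dl < y -> y <= x ->
    tangent y = tangent x /\ G y - G x = (w y - w x) *: tangent x.
  move=> yd; rewrite le_eqVlt => /predU1P[->|yx]; first by rewrite !subrr scale0r.
  have ye : x - el < y by apply: le_lt_trans yd; rewrite lerD2l lerN2.
  have [-> dE -> _] := germ_left p gl ye yx.
  have [|e1 e2] := SL (x - y); first by rewrite subr_ge0 ltW // ltrBlDr -ltrBlDl.
  split.
    apply: (etrans (congr1 unit_tangent dE)).
    by rewrite unit_tangentN e1 Tl opprK.
  by rewrite Gl wl e2 Tl scalerN -scaleNr; congr (_ *: _); ring.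
exists (Num.min dr dl); first by rewrite lt_min dr0.
have near y : `|y - x| < Num.min dr dl ->
    tangent y = tangent x /\ G y - G x = (w y - w x) *: tangent x.
  rewrite lt_min !ltr_norml => /andP[/andP[_ h2] /andP[h3 _]].
  have [xy|yx] := leP x y; first by apply: QR => //; rewrite -ltrBlDl.
  by apply: QL (ltW yx); rewrite addrC -ltrBrDr.
move=> y z /near[e1 e2] /near[e3 e4] _; split; first by rewrite e1 e3.
have -> : G z - G y = (G z - G x) - (G y - G x) by rewrite opprB addrA subrK.
by rewrite e4 e2 e1 -scalerBl; congr (_ *: _); ring.
Qed.

Lemma arc_point u a b s : is_arc u a b -> w u = 0 ->
  (forall s t, a < s -> s < t -> t < b -> Lam t - Lam s = w t - w s) ->
  a < s -> s < b -> G s = G u + w s *: tangent u.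
Proof.
move=> arc wu tight as_ sb; have [/andP[au ub] _ _ _] := arc.
case: (ltgtP s u) => su; last by rewrite su wu scale0r addr0.
  have [-> e] := arc_straight arc tight as_ su ub.
  by rewrite wu sub0r scaleNr in e; rewrite -[G u](subrK (G s)) e addrAC addNr add0r.
have [_ e] := arc_straight arc tight au su sb.
by rewrite wu subr0 in e; rewrite -e addrC subrK.
Qed.

(** The ends of an arc do not belong to it; their position follows by continuity of [G] from points
    [s] of the arc that are close to [v] and have [w s] close to [sg * r]. *)
Let arc_end u a b v sg : is_arc u a b -> w u = 0 ->
  (forall s t, a < s -> s < t -> t < b -> Lam t - Lam s = w t - w s) ->
  (forall eta, 0 < eta ->
     exists s, [/\ a < s < b, `|s - v| < eta & `|w s - sg * r| < eta]) ->
  G v = G u + (sg * r) *: tangent u.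
Proof.
move=> arc wu tight lim.
apply/eqP; rewrite -subr_eq0 -enorm_eq0; apply/eqP/le_anti.
rewrite enorm_ge0 andbT; apply/ler_addgt0Pr => eta eta0.
have eta20 : 0 < eta / 2 by rewrite divr_gt0.
have [d d0 hd] := germs_continuous (circuit_right cir) (circuit_left cir) v eta20.
have [|s [/andP[as_ sb]]] := lim (Num.min d (eta / 2)); first by rewrite lt_min d0.
rewrite !lt_min => /andP[/hd Gs _] /andP[_ ws].
have -> : G v - (G u + (sg * r) *: tangent u) =
    - (G s - G v) + (w s - sg * r) *: tangent u.
  by rewrite (arc_point arc wu tight as_ sb); apply: row2P; rewrite !mxE; ring.
apply: le_trans (enormD _ _) _; rewrite enormN enormZ.
have -> : enorm (tangent u) = 1 by rewrite /enorm tangent_dot sqrtr1.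
by move: Gs ws; lra.
Qed.

Lemma arc_right_end u a b : is_arc u a b -> w u = 0 ->
  (forall s t, a < s -> s < t -> t < b -> Lam t - Lam s = w t - w s) ->
  G b = G u + r *: tangent u.
Proof.
move=> arc wu tight; have [/andP[au ub] up _ _] := arc.
rewrite -[r in RHS]mul1r; apply: (arc_end arc wu tight) => eta eta0; rewrite mul1r.
have [s /andP[as_ sb] ws] := arc_right_limit bK Kp cir rob arc eta0.
(* [arc_right_limit] does not place [s] near [b]; moving to the right does not decrease [w], which
   stays below [r]. *)
pose s' := Num.max s (b - eta / 2).
have ss' : s <= s' by rewrite le_max lexx.
have s'b : s' < b by rewrite gt_max sb gtrBl divr_gt0.
have s'd : b - eta / 2 <= s' by rewrite le_max lexx orbT.
have as' := lt_le_trans as_ ss'.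
have wss' : w s <= w s'.
  move: ss'; rewrite le_eqVlt => /predU1P[<-//|ss'].
  by have [/ltW] := arc_rising arc as_ ss' s'b.
have : `|w s'| < r by apply: up_lt; apply: up; rewrite as'.
rewrite ltr_norml => /andP[_ w2]; exists s'; split; first by rewrite as'.
  by rewrite ltr_norml; apply/andP; split; lra.
by rewrite ltr_norml; apply/andP; split; lra.
Qed.

Lemma arc_left_end u a b : is_arc u a b -> w u = 0 ->
  (forall s t, a < s -> s < t -> t < b -> Lam t - Lam s = w t - w s) ->
  G a = G u - r *: tangent u.
Proof.
move=> arc wu tight; have [/andP[au ub] up _ _] := arc.
rewrite -scaleNr -mulN1r; apply: (arc_end arc wu tight) => eta eta0; rewrite mulN1r.
have [s /andP[as_ sb] ws] := arc_left_limit bK Kp cir rob arc eta0.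
pose s' := Num.min s (a + eta / 2).
have ss' : s' <= s by rewrite ge_min lexx.
have as' : a < s' by rewrite lt_min as_ ltrDl divr_gt0.
have s'd : s' <= a + eta / 2 by rewrite ge_min lexx orbT.
have s'b := le_lt_trans ss' sb.
have wss' : w s' <= w s.
  move: ss'; rewrite le_eqVlt => /predU1P[->//|ss'].
  by have [/ltW] := arc_rising arc as' ss' sb.
have : `|w s'| < r by apply: up_lt; apply: up; rewrite as'.
rewrite ltr_norml => /andP[w1 _]; exists s'; split; first by rewrite as'.
  by rewrite ltr_norml; apply/andP; split; lra.
by rewrite ltr_norml; apply/andP; split; lra.
Qed.

(* [q k] and [T k] are the midpoint and the unit tangent of the [k]-th edge. *)
Lemma edges_of_equality (S : nat) : (1 < S)%N -> stable K p #= `I_S ->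
  L <= 2 * S%:R * r -> exists q T : nat -> plane,
  [/\ forall k, (k <= S)%N -> [/\ dot (T k) (T k) = 1, dot (q k - p) (T k) = 0,
        q k != p & forall z, K z -> 0 <= dot (p - q k) (z - q k)],
      forall k, (k < S)%N -> K (q k + r *: T k) /\
        q k + r *: T k = q k.+1 - r *: T k.+1,
      q S = q 0%N /\ T S = T 0%N,
      {in `I_S &, injective q} &
      forall z, bd K z -> exists k x, [/\ (k < S)%N, - r <= x <= r & z = q k + x *: T k]].
Proof.
move=> S1 cS L2; have S0 : (0 < S)%N by exact: ltnW.
have [t [a [b [arc ord [tS aS bS] stab]]]] := arcs_sequence bK Kp cir r0 rob S0 cS.
have [_ /(_ L2) eq] := arcs_total cir (r := r) aS
  (fun k kS => arc_length_ge bK Kp cir rob (proj2 (arc k (ltnW kS))))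
  (fun k kS => proj2 (ord k kS)).
have tight k : (k < S)%N -> forall s u, a k < s -> s < u -> u < b k ->
    Lam u - Lam s = w u - w s.
  move=> kS s u; have [_ e] := eq k kS.
  exact: (arc_length_tight bK Kp cir rob (proj2 (arc k (ltnW kS))) e).
have t_inc i j : (i < j)%N -> (j <= S)%N -> t i < t j.
  elim: j => // j IHj; rewrite ltnS leq_eqVlt => /predU1P[->|ij] jS.
    by have [] := ord j jS.
  by rewrite (lt_trans (IHj ij (ltnW jS))) //; have [] := ord j jS.
have GS : G (t S) = G (t 0%N) by rewrite tS (circuit_periodic cir).
have TS : tangent (t S) = tangent (t 0%N).
  by rewrite /tangent tS (direction_periodic cir).
have endr k : (k < S)%N -> G (b k) = G (t k) + r *: tangent (t k).
  move=> kS; have [wk arck] := arc k (ltnW kS).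
  exact: (arc_right_end arck wk (tight k kS)).
have endl k : (k < S)%N -> G (a k) = G (t k) - r *: tangent (t k).
  move=> kS; have [wk arck] := arc k (ltnW kS).
  exact: (arc_left_end arck wk (tight k kS)).
exists (fun k => G (t k)), (fun k => tangent (t k)); split => //.
- move=> k kS; have [wk arck] := arc k kS.
  have [cr [Pr [er gr]]] := circuit_right cir (t k).
  have bdq := circuit_bd cir (t k).
  have perp : dot (G (t k) - p) (tangent (t k)) = 0 by rewrite tangent_normal.
  have qNp : G (t k) != p by apply/eqP => e; have [_ []] := (bdE _ bK).1 bdq; rewrite e.
  split => //; first exact: tangent_dot.
  have br := germ_branch cir gr; have [_ _ vr0 _] := br.
  apply: (branch_support bK Kp br); last by rewrite dot_gt0 subr_eq0 eq_sym.
  move: perp; rewrite /tangent (directionE gr) /unit_tangent dotZr => /eqP.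
  rewrite mulf_eq0 invr_eq0 enorm_eq0 (negPf vr0) /= => /eqP perp.
  by rewrite -opprB dotNl perp oppr0.
- move=> k kS; rewrite -endr //; split; first exact: (bd_sub bK (circuit_bd cir _)).
  have [-> _] := eq k kS.
  move: kS; rewrite leq_eqVlt => /predU1P[e|k1S]; last exact: endl.
  by rewrite e aS (circuit_periodic cir) GS TS endl.
- move=> i j; rewrite !inE /= => iS jS e.
  have close i' j' : (i' < j')%N -> (j' < S)%N -> G (t i') != G (t j').
    move=> ij jS'; apply/eqP => /(circuit_inj cir) h.
    have l1 := t_inc _ _ ij (ltnW jS').
    have l2 : t j' < t S := t_inc _ _ jS' (leqnn S).
    have l3 : t 0%N <= t i'.
      by case: (i') ij => [|m] ij //; apply/ltW/t_inc => //; exact: ltnW (ltn_trans ij jS').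
    have : t i' = t j' by apply: h; rewrite ltr_norml; apply/andP; split; lra.
    by move=> e'; rewrite e' ltxx in l1.
  case: (ltngtP i j) => // ij; first by have := close _ _ ij jS; rewrite e eqxx.
  by have := close _ _ ij iS; rewrite e eqxx.
- move=> z bz; have [u hu <-] := circuit_onto cir (a 0%N) bz.
  rewrite -aS in hu; have [k kS /andP[ak uk]] := piece_right hu.
  have [wk arck] := arc k (ltnW kS); have [bk _] := eq k kS; rewrite -bk in uk.
  have [/andP[akt tbk] upk _ _] := arck.
  move: ak; rewrite le_eqVlt => /predU1P[<-|ak].
    exists k, (- r); split; [exact: kS| |by rewrite endl // scaleNr].
    by rewrite lexx (le_trans _ (ltW r0)) // oppr_le0 ltW.
  exists k, (w u); split => //.
    have : `|w u| < r by apply: up_lt; apply: upk; rewrite ak.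
    by rewrite ltr_norml => /andP[h1 h2]; apply/andP; split; apply: ltW.
  exact: (arc_point arck wk (tight k kS) ak uk).
Qed.

End StraightArcs.

(** * Angles and unit vectors *)

Section Trigonometry.
Variable R : realType.
Local Notation plane := 'rV[R]_2.
Implicit Types (x y a b theta : R).

Definition radial theta : plane := row2 (cos theta) (sin theta).

Lemma polarE (p : plane) (rho theta : R) : polar p rho theta = p + rho *: radial theta.
Proof. by []. Qed.

Lemma dot_radial a b : dot (radial a) (radial b) = cos (a - b).
Proof. by rewrite dotE !row2_0 !row2_1 cosB. Qed.

Lemma radial_norm a : dot (radial a) (radial a) = 1.
Proof. by rewrite dot_radial subrr cos0. Qed.

Lemma unit_polar x y : x ^+ 2 + y ^+ 2 = 1 -> exists theta, x = cos theta /\ y = sin theta.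
Proof.
move=> xy; have x2 : x ^+ 2 <= 1 by rewrite -xy lerDl sqr_ge0.
have x11 : -1 <= x <= 1.
  by rewrite -ler_norml -(@ler_pXn2r _ 2) ?nnegrE // expr1n real_normK ?num_real.
have s : Num.sqrt (1 - x ^+ 2) = `|y|.
  by rewrite -xy [_ + y ^+ 2]addrC addrK sqrtr_sqr.
have ca : cos (acos x) = x by apply: acosK; rewrite in_itv.
have [y0|y0] := leP 0 y.
  by exists (acos x); rewrite ca sin_acos // s ger0_norm.
by exists (- acos x); rewrite cosN ca sinN sin_acos // s ltr0_norm // opprK.
Qed.

Lemma vector_polar (v : plane) : exists theta, v = enorm v *: radial theta.
Proof.
have [->|v0] := eqVneq v 0; first by exists 0; rewrite enorm0 scale0r.
have n0 : enorm v != 0 by rewrite enorm_eq0.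
have [|theta [e0 e1]] := @unit_polar (v 0 0 / enorm v) (v 0 1 / enorm v).
  rewrite !expr_div_n -mulrDl !expr2 -dotE -enorm_sqr expr2 divff //.
  by rewrite mulf_neq0.
exists theta; apply: row2P; rewrite mxE ?row2_0 ?row2_1 -?e0 -?e1;
  by rewrite mulrC divfK.
Qed.

Lemma cosD2pin a n : cos (a + 2 * pi * n%:R) = cos a.
Proof.
have := periodicn (@cosD2pi R) n a; rewrite -[_ *+ n]mulr_natr -[pi *+ 2]mulr_natl.
by [].
Qed.

Lemma cos_lt1 x : 0 < x < 2 * pi -> cos x < 1.
Proof.
move=> /andP[x0 x2]; have [xpi|pix] := leP x pi.
  by rewrite -[ltRHS]cos0 ltr_cos // in_itv /= ?lexx ?pi_ge0 // (ltW x0).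
have -> : cos x = cos (2 * pi - x).
  by rewrite cosB mulr_natl cos2pi sin2pi mul1r mul0r addr0.
by rewrite -[ltRHS]cos0 ltr_cos // ?in_itv /= ?lexx ?pi_ge0 //; [lra|apply/andP; split; lra].
Qed.

Lemma cos_lt_abs x y : `|x| < y -> y <= pi -> cos y < cos x.
Proof.
move=> xy ypi; rewrite -(cos_norm x).
have hx : `|x| \in `[0, pi] by rewrite in_itv /= normr_ge0 (le_trans (ltW xy)).
have hy : y \in `[0, pi] by rewrite in_itv /= ypi (le_trans _ (ltW xy)).
by rewrite ltr_cos.
Qed.

(* Turning by [2 * b] at each step, the first return after [S] steps without
   a vertex beyond the first edge happens after exactly one turn. *)
Lemma one_turn (S : nat) b : (0 < S)%N -> 0 < b < pi / 2 ->
  cos (S%:R * (2 * b)) = 1 ->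
  (forall k, (0 < k < S)%N -> cos (k%:R * (2 * b)) != 1) ->
  (forall k, (k < S)%N -> cos ((2 * k%:R + 1) * b) <= cos b) ->
  S%:R * b = pi.
Proof.
move=> S0 /andP[b0 b2] cS ck sup.
have ex : exists k : nat, pi <= k.+1%:R * b.
  exists (Num.truncn (pi / b)).
  by rewrite -ler_pdivrMr // ltW // truncnS_gt.
(* [k.+1] is the first number of steps after which the accumulated angle reaches 2 pi. *)
have [k hk kmin] := ex_minnP ex.
have kb : k%:R * b < pi.
  case: k hk kmin => [|k] hk kmin; first by rewrite mul0r pi_gt0.
  by rewrite ltNge; apply/negP => /kmin; rewrite ltnn.
have kS : (k < S)%N.
  rewrite ltnNge; apply/negP => Sk.
  have : cos (S%:R * (2 * b)) < 1.
    apply: cos_lt1; apply/andP; split.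
      by rewrite !mulr_gt0 // ltr0n.
    have : S%:R * b <= k%:R * b by rewrite ler_pM2r // ler_nat.
    lra.
  by rewrite cS ltxx.
(* If that step overshot 2 pi, the vertex at angle [(2 * k + 1) * b] would be at angular distance
   less than [b] from 2 pi, beyond the line of the first edge. *)
move: hk; rewrite le_eqVlt => /predU1P[e|hk]; last first.
  have := sup k kS; rewrite leNgt => /negP[].
  have -> : (2 * k%:R + 1) * b = (2 * k%:R + 1) * b - 2 * pi + 2 * pi * 1%:R.
    by rewrite mulr1 subrK.
  rewrite cosD2pin; apply: cos_lt_abs; last by have := @pi_gt0 R; lra.
  rewrite -natr1 in hk; rewrite ltr_norml; apply/andP; split; lra.
move: kS; rewrite leq_eqVlt => /predU1P[<-//|kS].
have /ck/negP[] : (0 < k.+1 < S)%N by [].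
have -> : k.+1%:R * (2 * b) = 0 + 2 * pi * 1%:R by rewrite e; ring.
by rewrite cosD2pin cos0.
Qed.

End Trigonometry.

(** * Chords of convex bodies and convex hulls *)

Section ConvexHull.
Variable R : realType.
Local Notation plane := 'rV[R]_2.
Implicit Types (K : set plane) (p v z : plane).

Lemma ray_boundary K z v : convex_body K -> K z -> v != 0 ->
  exists2 t : R, 0 <= t & bd K (z + t *: v).
Proof.
move=> bK Kz v0; have [cptK _ _] := bK.
have clK : closed K by apply: compact_closed => //; exact: norm_hausdorff.
pose E := [set t : R | 0 <= t /\ K (z + t *: v)].
have E0 : E 0 by split => //; rewrite scale0r addr0.
have vn : 0 < enorm v by rewrite enorm_gt0.
have hasE : has_sup E.
  split; first by exists 0.
  have [M [Mreal hM]] := compact_bounded cptK.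
  have hM1 := hM (M + 1) (ltr_pwDr ltr01 (lexx M)).
  exists ((2 * (M + 1) + enorm z) / enorm v) => t [t0 Kt].
  rewrite ler_pdivlMr // -(ger0_norm t0) -enormZ.
  have -> : t *: v = (z + t *: v) - z by rewrite addrC addKr.
  apply: le_trans (enormD _ _) _; rewrite enormN lerD2r.
  apply: le_trans (enorm_le_norm _) _; rewrite ler_pM2l //; exact: hM1.
pose t := sup E; have t0 : 0 <= t := sup_upper_bound hasE E0.
exists t => //; apply/bdE => //; split.
  apply: contrapT => nK.
  have /nbhs_enormP[e e0 he] := open_nbhs_nbhs (conj (closed_openC clK) nK).
  have d0 : 0 < e / enorm v by rewrite divr_gt0.
  have [s [s0 Ks] st] := sup_adherent d0 hasE.
  have s_le : s <= t by apply: (sup_upper_bound hasE).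
  apply: (he (z + s *: v)) => //.
  have -> : z + s *: v - (z + t *: v) = (s - t) *: v.
    by rewrite opprD addrACA subrr add0r scalerBl.
  rewrite enormZ ler0_norm ?subr_le0 // -ltr_pdivlMr //.
  by rewrite -/t in st; lra.
move=> /interiorEP[e e0 he].
have d0 : 0 < e / 2 / enorm v by rewrite !divr_gt0.
have : E (t + e / 2 / enorm v).
  split; first by rewrite addr_ge0 // ltW.
  apply: he; rewrite opprD addrACA subrr add0r -scalerBl addrC addKr.
  by rewrite enormZ gtr0_norm // divfK ?gt_eqF //; lra.
by move=> /(sup_upper_bound hasE); rewrite -/t leNgt ltrDl d0.
Qed.

(** Every point of [K] lies on a chord with boundary end points; the direction [row2 1 0] of the
    chord is arbitrary. *)
Lemma convex_body_sub_boundary K (B : set plane) : convex_body K ->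
  convex_set (B : set (convex_lmodType plane)) -> bd K `<=` B -> K `<=` B.
Proof.
move=> bK cB KB z Kz.
have e0 : row2 1 0 != 0 :> plane.
  by apply/eqP => /matrixP/(_ 0 0); rewrite row2_0 mxE => /eqP; rewrite oner_eq0.
have [t t0 bt] := ray_boundary bK Kz e0.
have e0' : - row2 1 0 != 0 :> plane by rewrite oppr_eq0.
have [s s0 bs] := ray_boundary bK Kz e0'.
have [st0|st0] := eqVneq (s + t) 0.
  have t00 : t = 0 by lra.
  by apply: KB; move: bt; rewrite t00 scale0r addr0.
have stp : 0 < s + t by rewrite lt_def st0 addr_ge0.
have := convex_setE cB (KB _ bt) (KB _ bs) (l := s / (s + t)).
have -> : s / (s + t) *: (z + t *: row2 1 0) + (1 - s / (s + t)) *: (z + s *: - row2 1 0) = z.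
  by apply: row2P; rewrite !mxE; field.
by apply; rewrite divr_ge0 ?(ltW stp) //= ler_pdivrMr // mul1r lerDl.
Qed.

Lemma convex_hull_convex (A : set plane) :
  convex_set (convex_hull A : set (convex_lmodType plane)).
Proof.
apply: convexE_set => u v l Au Av l01 B [cB AB].
by apply: convex_setE => //; [exact: Au|exact: Av].
Qed.

Lemma convex_hull_sub (A : set plane) : A `<=` convex_hull A.
Proof. by move=> z Az B [_]; exact. Qed.

Lemma convex_hull_min (A B : set plane) :
  convex_set (B : set (convex_lmodType plane)) -> A `<=` B -> convex_hull A `<=` B.
Proof. by move=> cB AB z; apply; split. Qed.

End ConvexHull.

(** * The equality case: equal edges form a regular polygon *)

Section RegularEdges.
Variable R : realType.
Local Notation plane := 'rV[R]_2.
Implicit Types (k : nat).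
Variables (K : set plane) (p : plane) (r : R) (S : nat) (q T : nat -> plane).
Hypotheses (bK : convex_body K) (r0 : 0 < r) (S1 : (1 < S)%N)
  (edge : forall k, (k <= S)%N -> [/\ dot (T k) (T k) = 1, dot (q k - p) (T k) = 0,
        q k != p & forall z, K z -> 0 <= dot (p - q k) (z - q k)])
  (next : forall k, (k < S)%N -> K (q k + r *: T k) /\
     q k + r *: T k = q k.+1 - r *: T k.+1)
  (closed_up : q S = q 0%N /\ T S = T 0%N)
  (q_inj : {in `I_S &, injective q})
  (cover : forall z, bd K z -> exists k x,
     [/\ (k < S)%N, - r <= x <= r & z = q k + x *: T k]).

Let d := enorm (q 0%N - p).

(** Consecutive edges share a vertex. By Pythagoras its squared distance from [p] is r^2 plus that
    of the midpoint, for either edge. *)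
Lemma edge_distance k : (k <= S)%N -> enorm (q k - p) = d.
Proof.
elim: k => // k IHk kS; rewrite -(IHk (ltnW kS)).
have [TT1 qT1 _ _] := edge (ltnW kS); have [TT2 qT2 _ _] := edge kS.
congr Num.sqrt.
have h : dot (q k + r *: T k - p) (q k + r *: T k - p) =
         dot (q k.+1 - r *: T k.+1 - p) (q k.+1 - r *: T k.+1 - p).
  by have [_ ->] := next kS.
have e1 : q k + r *: T k - p = (q k - p) + r *: T k by rewrite addrAC.
have e2 : q k.+1 - r *: T k.+1 - p = (q k.+1 - p) - r *: T k.+1 by rewrite addrAC.
move: h; rewrite e1 e2; move: TT1 TT2 qT1 qT2.
move: (q k - p) (q k.+1 - p) (T k) (T k.+1) => u v t t' h1 h2 h3 h4.
rewrite !dotDl !dotDr !dotNl !dotNr !dotZl !dotZr h1 h2 (dotC t) (dotC t') h3 h4.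
lra.
Qed.

(** Each edge is given by the angle [th k] of its midpoint and an orientation [ep k]. A change of
    orientation would make consecutive midpoints coincide, so the midpoints turn by a constant
    angle; closing up without repetition and staying on the inner side of the first edge forces
    exactly one turn. *)
Lemma regular_edges : regular_polygon S p K.
Proof.
have S0 : (0 < S)%N := ltnW S1.
have d0 : 0 < d.
  by rewrite /d enorm_gt0 subr_eq0; have [] := edge (leq0n S).
(* [T k] is obtained by rotating the unit vector of [q k - p] by [eps * pi / 2]. *)
have /choice[th hth] : forall k, exists t : R, (k <= S)%N -> q k - p = d *: radial t.
  move=> k; have [t e] := vector_polar (q k - p).
  by exists t => /edge_distance <-.
have /choice[ep hep] : forall k, exists e : R, (k <= S)%N ->
    (e = 1 \/ e = -1) /\ T k = e *: row2 (- sin (th k)) (cos (th k)).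
  move=> k; have [kS|kS] := leqP k S; last by exists 0.
  have [TT qT _ _] := edge kS; move: qT; rewrite hth // dotZl => /eqP.
  rewrite mulf_eq0 gt_eqF //= => /eqP perp.
  set J := row2 _ _.
  have JJ : dot J J = 1 by rewrite dotE !row2_0 !row2_1 -(cos2Dsin2 (th k)); ring.
  have J0 : J != 0 by rewrite -dot_eq0 JJ oner_eq0.
  have r00 : radial (th k) != 0 by rewrite -dot_eq0 radial_norm oner_eq0.
  have perpJ : dot (radial (th k)) J = 0.
    by rewrite dotE !row2_0 !row2_1; ring.
  have [l e] := perp_collinear r00 J0 perpJ perp.
  exists l => _; split => //.
  move: TT; rewrite e dotZl dotZr JJ mulr1 => /eqP.
  by rewrite -expr2 sqrf_eq1 => /orP[/eqP|/eqP]; [left|right].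
(* [rho] is the distance of the vertices from [p], and [b] below is half the angle under which an
   edge is seen from [p]. *)
pose rho := Num.sqrt (d ^+ 2 + r ^+ 2).
have dr0 : 0 < d ^+ 2 + r ^+ 2 by rewrite addr_gt0 // exprn_gt0.
have rho0 : 0 < rho by rewrite sqrtr_gt0.
have rho2 : rho ^+ 2 = d ^+ 2 + r ^+ 2 by rewrite sqr_sqrtr // ltW.
pose b := acos (d / rho).
have drho : d / rho < 1.
  rewrite ltr_pdivrMr // mul1r -(@ltr_pXn2r _ 2) ?nnegrE ?(ltW d0) ?(ltW rho0) //.
  by rewrite rho2 ltrDl exprn_gt0.
have drho0 : 0 < d / rho by rewrite divr_gt0.
have in11 : -1 <= d / rho <= 1 by apply/andP; split; lra.
have cb : cos b = d / rho by apply: acosK; rewrite in_itv.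
have sb : sin b = r / rho.
  rewrite sin_acos // expr_div_n.
  have -> : 1 - d ^+ 2 / rho ^+ 2 = (r / rho) ^+ 2.
    by rewrite expr_div_n rho2; field; rewrite -rho2 sqrf_eq0 gt_eqF.
  by rewrite sqrtr_sqr gtr0_norm // divr_gt0.
have b0 : 0 < b by apply: acos_gt0; apply/andP; split; lra.
have bpi : b < pi.
  by apply: acos_ltpi; apply/andP; split; lra.
have b2 : b < pi / 2.
  rewrite ltNge; apply/negP => h.
  have : cos b <= cos (pi / 2).
    have hb : b \in `[0, pi] by rewrite in_itv /= !ltW.
    have hp : pi / 2 \in `[0, (pi : R)].
      by rewrite in_itv /=; have := @pi_gt0 R => h0; apply/andP; split; lra.
    by rewrite leNgt ltr_cos // -leNgt.
  by rewrite cos_pihalf cb leNgt drho0.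
have dE : d = rho * cos b by rewrite cb mulrC divfK // gt_eqF.
have rE : r = rho * sin b by rewrite sb mulrC divfK // gt_eqF.
have vR k : (k <= S)%N -> q k + r *: T k = p + rho *: radial (th k + ep k * b).
  move=> kS; have [e1 e2] := hep k kS.
  have -> : q k = p + d *: radial (th k) by rewrite -hth // addrC subrK.
  rewrite e2 {1}dE {1}rE; case: e1 => ->; apply: row2P;
    rewrite !mxE /= ?mulN1r ?mul1r ?cosD ?sinD ?cosN ?sinN; ring.
have vL k : (k <= S)%N -> q k - r *: T k = p + rho *: radial (th k - ep k * b).
  move=> kS; have [e1 e2] := hep k kS.
  have -> : q k = p + d *: radial (th k) by rewrite -hth // addrC subrK.
  rewrite e2 {1}dE {1}rE; case: e1 => ->; apply: row2P;
    rewrite !mxE /= ?mulN1r ?mul1r ?opprK ?cosD ?sinD ?cosN ?sinN; ring.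
have step k : (k < S)%N -> radial (th k + ep k * b) = radial (th k.+1 - ep k.+1 * b).
  move=> kS; have [_] := next kS; rewrite vR ?vL //; last exact: ltnW.
  by move=> /addrI/(scalerI (lt0r_neq0 rho0)).
(* Angles are known only modulo 2 pi, so equalities between them are carried by [radial]. *)
have rot (a x y : R) : radial x = radial y -> radial (x + a) = radial (y + a).
  move=> e; have := congr1 (fun u : plane => u 0 0) e; have := congr1 (fun u : plane => u 0 1) e.
  rewrite !row2_0 !row2_1 => es ec.
  by rewrite /radial !cosD !sinD es ec.
have next_neq k : (k < S)%N -> q k.+1 != q k.
  move=> kS; apply/eqP; move: (kS); rewrite leq_eqVlt => /predU1P[e|k1S].
    rewrite e (proj1 closed_up) => /q_inj; rewrite !inE /= => h.
    by have k0 := h S0 kS; move: S1; rewrite -e -k0.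
  by move=> /q_inj; rewrite !inE /= => /(_ k1S kS) /eqP; rewrite eqn_leq ltnn.
have ep_const k : (k <= S)%N -> ep k = ep 0%N.
  elim: k => // k IHk kS; rewrite -(IHk (ltnW kS)).
  have [e1 _] := hep k (ltnW kS); have [e2 _] := hep k.+1 kS.
  have [//|neq] := eqVneq (ep k.+1) (ep k).
  have eN : ep k.+1 = - ep k.
    by case: e1 e2 neq => -> [] ->; rewrite ?eqxx ?opprK.
  have := rot (- (ep k * b)) _ _ (step k kS); rewrite eN mulNr opprK !addrK => e.
  have := next_neq k kS; rewrite -(inj_eq (addIr (- p))) !hth ?(ltnW kS) //.
  by rewrite e eqxx.
set e := ep 0%N in ep_const; have e1 : e = 1 \/ e = -1 by have [] := hep 0%N (leq0n S).
have th_rad k : (k <= S)%N -> radial (th k) = radial (th 0%N + k%:R * (2 * (e * b))).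
  elim: k => [_|k IHk kS]; first by rewrite mul0r addr0.
  have := rot (e * b) _ _ (step k kS); rewrite !ep_const ?(ltnW kS) // subrK => <-.
  rewrite -addrA (rot _ _ _ (IHk (ltnW kS))); congr radial.
  by rewrite -natr1; ring.
have ce x : cos (x * (2 * (e * b))) = cos (x * (2 * b)).
  case: e1 => ->; rewrite ?mul1r //.
  by rewrite mulN1r mulrN mulrN cosN.
have ce' x : cos (x * (e * b)) = cos (x * b).
  by case: e1 => ->; rewrite ?mul1r // mulN1r mulrN cosN.
have vertexE k : (k < S)%N ->
    q k + r *: T k = p + rho *: radial (th 0%N + (2 * k%:R + 1) * (e * b)).
  move=> kS; rewrite vR ?ep_const ?(ltnW kS) // (rot _ _ _ (th_rad k (ltnW kS))).
  by congr (_ + _ *: radial _); ring.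
have q0E : q 0%N = p + d *: radial (th 0%N) by rewrite -hth // addrC subrK.
have dot_th k : (k <= S)%N ->
    dot (radial (th k)) (radial (th 0%N)) = cos (k%:R * (2 * b)).
  by move=> kS; rewrite th_rad // dot_radial [_ + _ * _]addrC addrK ce.
(* The conditions of [one_turn] come from closing up, from the injectivity of [q], and from the
   supporting line at the first edge applied to the vertices. *)
have Sb : S%:R * b = pi.
  apply: one_turn => //; first by rewrite b0.
  - rewrite -dot_th // -[RHS](radial_norm (th 0%N)); congr dot.
    have := hth S (leqnn S); rewrite (proj1 closed_up) hth //.
    by move=> /(scalerI (lt0r_neq0 d0)).
  - move=> k /andP[k0 kS]; apply: contraTneq k0 => ck.
    suff : k = 0%N by move=> ->.
    apply: q_inj; rewrite ?inE //=.
    apply: (addIr (- p)); rewrite !hth ?(ltnW kS) //; congr (_ *: _).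
    apply/eqP; rewrite -subr_eq0 -dot_eq0 dotBl !dotBr !radial_norm.
    by rewrite [dot _ (radial (th k))]dotC dot_th ?(ltnW kS) // ck; apply/eqP; ring.
  - move=> k kS; have [_ _ _ sup] := edge (leq0n S).
    have := sup _ (proj1 (next kS)); rewrite vertexE // q0E.
    have -> : p - (p + d *: radial (th 0%N)) = - (d *: radial (th 0%N)).
      by rewrite opprD addrA subrr sub0r.
    have rad_cos : dot (radial (th 0%N)) (radial (th 0%N + (2 * k%:R + 1) * (e * b))) =
        cos ((2 * k%:R + 1) * b).
      by rewrite dot_radial opprD addrA subrr sub0r cosN ce'.
    rewrite opprD addrACA subrr add0r dotNl dotBr !dotZl !dotZr radial_norm rad_cos.
    by rewrite mulr1 oppr_ge0 subr_le0 ler_pM2l // {1}dE ler_pM2l.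
have SN0 : S%:R != 0 :> R by rewrite pnatr_eq0 -lt0n.
have bE : b = pi / S%:R by rewrite -Sb mulrC mulKf.
pose V := [set q k + r *: T k | k in `I_S].
have K_hull : K = convex_hull V.
  apply/seteqP; split.
    apply: convex_body_sub_boundary => //; first exact: convex_hull_convex.
    move=> z /cover[k [x [kS /andP[x1 x2] ->]]].
    have Vk : convex_hull V (q k + r *: T k) by apply: convex_hull_sub; exists k.
    have Vk' : convex_hull V (q k - r *: T k).
      apply: convex_hull_sub; case: k kS {Vk} => [|k] kS.
        have SS : (S.-1 < S)%N by rewrite prednK.
        exists S.-1; first exact: SS.
        have [_ ->] := next SS.
        by rewrite prednK // (proj1 closed_up) (proj2 closed_up).
      by exists k; [exact: ltnW|have [_] := next (ltnW kS)].
    have := convex_setE (@convex_hull_convex _ V) Vk Vk' (l := (r + x) / (2 * r)).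
    have -> : (r + x) / (2 * r) *: (q k + r *: T k) +
        (1 - (r + x) / (2 * r)) *: (q k - r *: T k) = q k + x *: T k.
      by apply: row2P; rewrite !mxE; field; rewrite gt_eqF.
    apply; rewrite divr_ge0 ?mulr_ge0 ?(ltW r0) //=; last lra.
    by rewrite ler_pdivrMr ?mulr_gt0 //; lra.
  have [_ cK _] := bK; apply: convex_hull_min => //.
  by move=> _ [k kS <-]; have [] := next kS.
case: e1 => eE; rewrite eE in vertexE.
  exists rho, (th 0%N + b); split => //; rewrite K_hull; congr convex_hull.
  have pE k : (k < S)%N ->
      polar p rho (th 0%N + b + 2 * pi * k%:R / S%:R) = q k + r *: T k.
    move=> kS; rewrite vertexE // polarE; congr (_ + _ *: radial _).
    by rewrite bE; field.
  by apply/seteqP; split=> _ [k kS <-]; exists k => //; rewrite pE.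
(* For negative orientation the vertices run clockwise; the counterclockwise list starts at the last
   one and reverses the indices. *)
exists rho, (th 0%N - b - 2 * pi * (S.-1)%:R / S%:R); split => //.
rewrite K_hull; congr convex_hull.
have pE k : (k < S)%N ->
    polar p rho (th 0%N - b - 2 * pi * (S.-1)%:R / S%:R + 2 * pi * k%:R / S%:R) =
    q (S.-1 - k)%N + r *: T (S.-1 - k)%N.
  move=> kS; have k1 : (k <= S.-1)%N by rewrite -ltnS prednK.
  rewrite vertexE ?(leq_ltn_trans (leq_subr _ _)) ?prednK // polarE.
  by congr (_ + _ *: radial _); rewrite bE natrB //; field.
have S1lt k : (S.-1 - k < S)%N by rewrite (leq_ltn_trans (leq_subr _ _)) ?prednK.
apply/seteqP; split=> _ [k kS <-]; exists (S.-1 - k)%N => //=.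
  by rewrite pE // subKn // -ltnS prednK.
by rewrite pE.
Qed.

End RegularEdges.

(** Finitely many strict inequalities leave a common margin; this is where the finiteness of the
    number of edges enters. *)
Lemma finite_gap (R : realType) (n : nat) (P : pred nat) (f : nat -> R) (d : R) :
  (forall j, (j < n)%N -> P j -> f j < d) ->
  exists2 e : R, 0 < e & forall j, (j < n)%N -> P j -> f j + e <= d.
Proof.
elim: n => [|n IHn] hf; first by exists 1.
have [e e0 he] := IHn (fun j jn => hf j (leqW jn)).
have [Pn|nPn] := boolP (P n); last first.
  exists e => // j; rewrite ltnS leq_eqVlt => /predU1P[->|jn]; last exact: he.
  by rewrite (negPf nPn).
exists (Num.min e (d - f n)); first by rewrite lt_min e0 subr_gt0 hf.
move=> j; rewrite ltnS leq_eqVlt => /predU1P[->|jn] Pj.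
  by rewrite -lerBrDl ge_min lexx orbT.
by apply: le_trans (he j jn Pj); rewrite lerD2l ge_min lexx.
Qed.

(** * Regular polygons as intersections of half-planes; their equilibria *)

Section RegularPolygon.
Variable R : realType.
Local Notation plane := 'rV[R]_2.
Implicit Types (i j k m : nat) (z : plane) (x y : R).
Variables (K : set plane) (p : plane) (S : nat) (rho theta : R).
Hypotheses (S3 : (2 < S)%N) (rho0 : 0 < rho) (bK : convex_body K) (Kp : K° p)
  (KE : K = convex_hull [set polar p rho (theta + 2 * pi * k%:R / S%:R) | k in `I_S]).

(** [b] is half the central angle of an edge, [d] the apothem, [r] half the side; [A k] is the angle
    of the midpoint of edge [k], with outer normal [u k] and counterclockwise direction [T k].
    Indices range over all natural numbers and matter only modulo [S], so the last edge is no
    special case. *)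
Let b : R := pi / S%:R.
Let d := rho * cos b.
Let r := rho * sin b.
Let A k : R := theta + (2 * k%:R + 1) * b.
Let u k : plane := radial (A k).
Let T k : plane := row2 (- sin (A k)) (cos (A k)).
Let vertex k : plane := p + d *: u k + r *: T k.

Let S0 : 0 < S%:R :> R.
Proof. by rewrite ltr0n; exact: ltn_trans S3. Qed.

Let b_gt0 : 0 < b.
Proof. by rewrite divr_gt0 ?pi_gt0. Qed.

Let SbE : S%:R * b = pi.
Proof. by rewrite /b mulrC divfK // gt_eqF. Qed.

Let b3 : 3 * b <= pi.
Proof. by rewrite -SbE ler_pM2r // ler_nat. Qed.

Let sb0 : 0 < sin b.
Proof. by apply: sin_gt0_pi; have := b_gt0; have := b3; lra. Qed.

Let cb0 : 0 < cos b.
Proof. by apply: cos_gt0_pihalf; have := b_gt0; have := b3; lra. Qed.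

Let s2b0 : 0 < sin (2 * b).
Proof. by apply: sin_gt0_pi; have := b_gt0; have := b3; lra. Qed.

Lemma apothem_gt0 : 0 < d. Proof. exact: mulr_gt0. Qed.

Lemma half_side_gt0 : 0 < r. Proof. exact: mulr_gt0. Qed.

Let uu k : dot (u k) (u k) = 1.
Proof. exact: radial_norm. Qed.

Let TT k : dot (T k) (T k) = 1.
Proof. by rewrite dotE !row2_0 !row2_1 -(cos2Dsin2 (A k)); ring. Qed.

Let uT k : dot (u k) (T k) = 0.
Proof. by rewrite dotE !row2_0 !row2_1; ring. Qed.

Let uuj j i : dot (u j) (u i) = cos (A j - A i).
Proof. exact: dot_radial. Qed.

Let uTj j i : dot (u j) (T i) = sin (A j - A i).
Proof. by rewrite dotE !row2_0 !row2_1 sinB; ring. Qed.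

Let decomp k (z : plane) : z = dot (u k) z *: u k + dot (T k) z *: T k.
Proof.
have h := cos2Dsin2 (A k).
apply: row2P; rewrite !mxE !dotE !row2_0 !row2_1.
  by rewrite -[LHS]mul1r -{1}h /=; ring.
by rewrite -[LHS]mul1r -{1}h /=; ring.
Qed.

Let coords k (x y : R) : p + x *: u k + y *: T k - p = x *: u k + y *: T k.
Proof. by rewrite [LHS]addrC -addrA addKr. Qed.

Let edge_dot k x y : dot (u k) (p + x *: u k + y *: T k - p) = x.
Proof. by rewrite coords dotDr !dotZr uu uT mulr1 mulr0 addr0. Qed.

Let edge_dotT k x y : dot (T k) (p + x *: u k + y *: T k - p) = y.
Proof. by rewrite coords dotDr !dotZr TT dotC uT mulr1 mulr0 add0r. Qed.

Let edge_dotj j k x y : dot (u j) (p + x *: u k + y *: T k - p) =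
  x * cos (A j - A k) + y * sin (A j - A k).
Proof. by rewrite coords dotDr !dotZr uuj uTj. Qed.

Let AB j k : A j - A k = 2 * (j%:R - k%:R) * b.
Proof. by rewrite /A; ring. Qed.

Let sinD2pin (a : R) n : sin (a + 2 * pi * n%:R) = sin a.
Proof.
by have := periodicn (@sinD2pi R) n a; rewrite -[_ *+ n]mulr_natr -[pi *+ 2]mulr_natl.
Qed.

Let A_mod k : A k = A (k %% S) + 2 * pi * (k %/ S)%:R.
Proof. by rewrite {1}(divn_eq k S) /A natrD natrM -SbE; ring. Qed.

Let u_mod k : u k = u (k %% S).
Proof. by rewrite /u /radial (A_mod k) cosD2pin sinD2pin. Qed.

Let T_mod k : T k = T (k %% S).
Proof. by rewrite /T (A_mod k) cosD2pin sinD2pin. Qed.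

Let vertexE k : vertex k = p + rho *: radial (theta + 2 * k.+1%:R * b).
Proof.
have -> : theta + 2 * k.+1%:R * b = A k + b by rewrite /A -natr1; ring.
by apply: row2P; rewrite /vertex /d /r !mxE /= ?(cosD (A k) b) ?(sinD (A k) b); ring.
Qed.

Let vertex_next k : vertex k = p + d *: u k.+1 - r *: T k.+1.
Proof.
rewrite vertexE; have -> : theta + 2 * k.+1%:R * b = A k.+1 - b by rewrite /A; ring.
by apply: row2P; rewrite /d /r !mxE /= ?(cosB (A k.+1) b) ?(sinB (A k.+1) b); ring.
Qed.

Let vertex_prev k : vertex (k + S.-1) = p + d *: u k + (- r) *: T k.
Proof.
rewrite vertex_next -addnS prednK; last exact: ltn_trans S3.
by rewrite scaleNr u_mod T_mod modnDr -u_mod -T_mod.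
Qed.

Let cos_outside_lt (y : R) : b < y < 2 * pi - b -> cos y < cos b.
Proof.
move=> /andP[y1 y2]; have bpi : b <= pi by have := b_gt0; have := b3; lra.
have hb : b \in `[0, pi] by rewrite in_itv /= bpi ltW.
suff [y' [hy' -> by']] : exists y', [/\ y' \in `[0, pi], cos y = cos y' & b < y'].
  by rewrite ltr_cos.
have [ypi|piy] := leP y pi.
  by exists y; split => //; rewrite in_itv /= ypi (le_trans (ltW b_gt0)) // ltW.
exists (2 * pi - y); split; [|by rewrite cosB mulr_natl cos2pi sin2pi mul1r mul0r addr0|lra].
by rewrite in_itv /=; have b0' := b_gt0; apply/andP; split; lra.
Qed.

Let cos_outside (y : R) : b <= y <= 2 * pi - b -> cos y <= cos b.
Proof.
rewrite le_eqVlt => /andP[/predU1P[<-//|y1]]; rewrite le_eqVlt => /predU1P[->|y2].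
  by rewrite cosB mulr_natl cos2pi sin2pi mul1r mul0r addr0.
by apply/ltW/cos_outside_lt/andP.
Qed.

Let odd_mod m : cos ((2 * m%:R + 1) * b) = cos ((2 * (m %% S)%:R + 1) * b).
Proof.
rewrite {1}(divn_eq m S) natrD natrM.
have -> : (2 * ((m %/ S)%:R * S%:R + (m %% S)%:R) + 1) * b =
  (2 * (m %% S)%:R + 1) * b + 2 * pi * (m %/ S)%:R by rewrite -SbE; ring.
exact: cosD2pin.
Qed.

Let odd_range m : (m < S)%N -> b <= (2 * m%:R + 1) * b <= 2 * pi - b.
Proof.
move=> mS; have h : (m%:R + 1) * b <= pi by rewrite -SbE ler_pM2r // natr1 ler_nat.
have h2 : 0 <= m%:R * b by rewrite mulr_ge0 // ltW.
by apply/andP; split; lra.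
Qed.

(** Modulo 2 pi the odd multiples of [b] lie between [b] and [2 * pi - b], where the cosine does not
    exceed its value at the ends. *)
Let cos_odd m : cos ((2 * m%:R + 1) * b) <= cos b.
Proof.
rewrite odd_mod; apply: cos_outside; apply: odd_range.
by rewrite ltn_mod (ltn_trans _ S3).
Qed.

Let vertex_le j k : dot (u j) (vertex k - p) <= d.
Proof.
rewrite vertexE addrC addKr dotZr dot_radial /d ler_pM2l //.
have -> : A j - (theta + 2 * k.+1%:R * b) = (2 * (j%:R - k%:R) - 1) * b.
  by rewrite /A -natr1; ring.
have [jk|kj] := leqP j k.
  rewrite -cosN; have -> : - ((2 * (j%:R - k%:R) - 1) * b) = (2 * (k - j)%:R + 1) * b.
    by rewrite natrB //; ring.
  exact: cos_odd.
have -> : (2 * (j%:R - k%:R) - 1) * b = (2 * (j - k.+1)%:R + 1) * b.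
  by rewrite natrB // -natr1; ring.
exact: cos_odd.
Qed.

(** Equality in [vertex_le] needs the odd multiple of [b] to be [b] or [2 * pi - b] modulo 2 pi,
    that is [m] congruent to 0 or [S.-1]: these cases are the two edges that meet at the vertex. *)
Let vertex_lt j k : (j %% S != k %% S)%N -> (j %% S != k.+1 %% S)%N ->
  dot (u j) (vertex k - p) < d.
Proof.
move=> jk jk1; rewrite vertexE addrC addKr dotZr dot_radial /d ltr_pM2l //.
have S0' : (0 < S)%N by exact: ltn_trans S3.
pose m := (j + S - (k.+1 %% S))%N.
have kS : (k.+1 %% S < S)%N by rewrite ltn_mod.
have kj : (k.+1 %% S <= j + S)%N by rewrite (leq_trans (ltnW kS)) // leq_addl.
have mE : m%:R = j%:R + S%:R - (k.+1 %% S)%:R :> R by rewrite /m natrB // natrD.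
have kE : k.+1%:R = (k.+1 %/ S)%:R * S%:R + (k.+1 %% S)%:R :> R.
  by rewrite -natrM -natrD -divn_eq.
have -> : A j - (theta + 2 * k.+1%:R * b) =
    (2 * m%:R + 1) * b - 2 * pi * (1 + k.+1 %/ S)%:R.
  by rewrite /A mE kE natrD -SbE; ring.
rewrite -(cosD2pin _ (1 + k.+1 %/ S)) subrK odd_mod.
have jm : (j + S = m + k.+1 %% S)%N by rewrite subnK.
have m0 : (m %% S != 0)%N.
  apply: contra jk1 => /eqP e.
  by rewrite -(modnDr j S) jm -modnDm e add0n !modn_mod.
have m1 : (m %% S != S.-1)%N.
  apply: contra jk => /eqP e.
  have mS0 : (m.+1 %% S = 0)%N by rewrite -addn1 -modnDml e addn1 prednK // modnn.
  have : (j + 1 = k + 1 %[mod S])%N.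
    by rewrite !addn1 -(modnDr j.+1 S) addSn jm -addSn -modnDml mS0 add0n modn_mod.
  by move/eqP; rewrite eqn_modDr.
have mS : (m %% S < S)%N by rewrite ltn_mod.
have m2 : ((m %% S).+2 <= S)%N.
  move: mS; rewrite leq_eqVlt => /predU1P[e|//].
  by move: m1; rewrite -(congr1 predn e) eqxx.
have h1 : 1 <= (m %% S)%:R :> R by rewrite ler1n lt0n.
have h2 : ((m %% S)%:R + 2) * b <= pi.
  by rewrite -SbE ler_pM2r // -natrD ler_nat addn2.
have h3 : b <= (m %% S)%:R * b by rewrite -{1}[b]mul1r ler_pM2r.
by apply: cos_outside_lt; have b0' := b_gt0; apply/andP; split; lra.
Qed.

Let vertex_in k : K (vertex k).
Proof.
rewrite KE; apply: convex_hull_sub; exists (k.+1 %% S)%N.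
  by rewrite /= ltn_mod (ltn_trans _ S3).
rewrite vertexE polarE; congr (_ + _ *: _).
have -> : theta + 2 * k.+1%:R * b =
    theta + 2 * pi * (k.+1 %% S)%:R / S%:R + 2 * pi * (k.+1 %/ S)%:R.
  by rewrite {1}(divn_eq k.+1 S) natrD natrM -SbE; field; rewrite gt_eqF.
by rewrite /radial cosD2pin sinD2pin.
Qed.

Let halfplane z j : K z -> dot (u j) (z - p) <= d.
Proof.
rewrite {1}KE; move: z; apply: convex_hull_min.
  apply: convexE_set => z z' l hz hz' /andP[l0 l1].
  have -> : l *: z + (1 - l) *: z' - p = l *: (z - p) + (1 - l) *: (z' - p).
    by apply: row2P; rewrite !mxE; ring.
  rewrite dotDr !dotZr.
  have h1 : l * dot (u j) (z - p) <= l * d by rewrite ler_wpM2l.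
  have h2 : (1 - l) * dot (u j) (z' - p) <= (1 - l) * d by rewrite ler_wpM2l // subr_ge0.
  lra.
move=> _ [k kS <-]; rewrite /= polarE.
have -> : theta + 2 * pi * k%:R / S%:R = theta + 2 * k%:R * b by rewrite /b; ring.
(* The generator of index [k] is the start of edge [k], hence the vertex preceding [vertex k], and
   [k + S.-1] stands for [k - 1] modulo [S]. *)
have := vertex_le j (k + S.-1).
rewrite vertexE -addnS prednK; last exact: ltn_trans S3.
suff -> : radial (theta + 2 * (k + S)%:R * b) = radial (theta + 2 * k%:R * b) by [].
have -> : theta + 2 * (k + S)%:R * b = theta + 2 * k%:R * b + 2 * pi * 1%:R.
  by rewrite natrD -SbE; ring.
by rewrite /radial cosD2pin sinD2pin.
Qed.

(* A point of the intersection of the half-planes lies in the triangle spanned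
   by [p] and an edge. *)
Let halfplanes_in z : (forall j, dot (u j) (z - p) <= d) -> K z.
Proof.
move=> hz; have [_ cK _] := bK; have Kp' : K p := interior_subset Kp.
have [psi0 e0] := vector_polar (z - p); set s := enorm _ in e0.
have b0 := b_gt0.
have pi0 := @pi_gt0 R.
(* Full turns are added so that the angle is at least [theta] and the sector index [k] below is a
   natural number. *)
pose N := (Num.truncn (`|theta - psi0| / (2 * pi))).+1.
pose psi := psi0 + 2 * pi * N%:R.
have e : z - p = s *: radial psi by rewrite {1}e0 /psi /radial cosD2pin sinD2pin.
have psi_ge : theta <= psi.
  have h : `|theta - psi0| / (2 * pi) <= N%:R by rewrite ltW // truncnS_gt.
  rewrite ler_pdivrMr in h; last lra.
  have := ler_norm (theta - psi0); rewrite /psi; lra.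
pose k := Num.truncn ((psi - theta) / (2 * b)).
have hk : k%:R <= (psi - theta) / (2 * b) < k.+1%:R.
  by apply: truncn_itv; rewrite divr_ge0 ?subr_ge0 //; lra.
pose dl := psi - A k.
have dl_itv : - b <= dl <= b.
  move: hk; rewrite ler_pdivlMr ?ltr_pdivrMr; [|lra|lra].
  by rewrite -natr1 /dl /A => /andP[h1 h2]; apply/andP; split; lra.
have /andP[dl1 dl2] := dl_itv.
pose x := s * cos dl; pose y := s * sin dl.
have s_ge0 : 0 <= s by exact: enorm_ge0.
have zE : z = p + x *: u k + y *: T k.
  have -> : z = p + s *: radial psi by rewrite -e addrC subrK.
  have -> : psi = A k + dl by rewrite /dl addrC subrK.
  by apply: row2P; rewrite /x /y !mxE /= ?(cosD (A k) dl) ?(sinD (A k) dl); ring.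
have b3' := b3; have d0 := apothem_gt0; have r0 := half_side_gt0.
have cdl : 0 < cos dl by apply: cos_gt0_pihalf; apply/andP; split; lra.
have x0 : 0 <= x by rewrite mulr_ge0 // ltW.
have xd : x <= d by have := hz k; rewrite zE edge_dot.
have yx1 : d * y <= x * r.
  have : 0 <= sin (b - dl) by apply: sin_ge0_pi; apply/andP; split; lra.
  rewrite sinB /d /r /x /y => h.
  have : 0 <= rho * s * (sin b * cos dl - cos b * sin dl) by rewrite !mulr_ge0 // ltW.
  lra.
have yx2 : - (x * r) <= d * y.
  have : 0 <= sin (b + dl) by apply: sin_ge0_pi; apply/andP; split; lra.
  rewrite sinD /d /r /x /y => h.
  have : 0 <= rho * s * (sin b * cos dl + cos b * sin dl) by rewrite !mulr_ge0 // ltW.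
  lra.
have y1 : y / r <= x / d.
  rewrite ler_pdivrMr //; have -> : x / d * r = x * r / d by ring.
  by rewrite ler_pdivlMr // [y * d]mulrC.
have y2 : - (x / d) <= y / r.
  rewrite ler_pdivlMr //; have -> : - (x / d) * r = - (x * r) / d by ring.
  by rewrite ler_pdivrMr // [y * d]mulrC.
have xd1 : x / d <= 1 by rewrite ler_pdivrMr // mul1r.
have xd0 : 0 <= x / d by rewrite divr_ge0 // ltW.
have [/eqP x00|xN0] := boolP (x / d == 0).
  have x00' : x = 0 by rewrite -[x](divfK (lt0r_neq0 d0)) x00 mul0r.
  have y00 : y / r = 0 by lra.
  have y00' : y = 0 by rewrite -[y](divfK (lt0r_neq0 r0)) y00 mul0r.
  by rewrite zE x00' y00' !scale0r !addr0.
have xdp : 0 < x / d by rewrite lt_def xN0.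
pose vp := vertex k; pose vm := p + d *: u k + (- r) *: T k.
have Kvm : K vm by rewrite /vm -vertex_prev; exact: vertex_in.
(* [l] locates the point where the ray from [p] through [z] meets the edge; [z] lies at the fraction
   [x / d] of the way from [p] to it. *)
pose l := (x / d + y / r) / 2 / (x / d).
have Km : K (l *: vp + (1 - l) *: vm).
  apply: convex_setE => //; first exact: vertex_in.
  by rewrite divr_ge0 //= ?ler_pdivrMr // ?mul1r; lra.
have := convex_setE cK Km Kp' (l := x / d).
rewrite xd0 xd1 => /(_ isT).
suff -> : x / d *: (l *: vp + (1 - l) *: vm) + (1 - x / d) *: p = z by [].
rewrite zE /vp /vm /vertex /l.
have x0' : x != 0 by apply: contraNneq xN0 => ->; rewrite mul0r.
apply: row2P; rewrite !mxE /=; field; by rewrite x0' !gt_eqF.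
Qed.

(** If all half-plane inequalities were strict at [z], they would hold with a common margin, and a
    ball around [z] would lie in [K]. *)
Let bd_halfplane z : bd K z -> exists2 k, (k < S)%N & dot (u k) (z - p) = d.
Proof.
move=> bz; apply: contrapT => nex.
have [Kz nKz] := (bdE _ bK).1 bz; apply: nKz.
have lt_d j : dot (u j) (z - p) < d.
  rewrite lt_neqAle halfplane // andbT; apply/eqP => e; apply: nex.
  by exists (j %% S)%N; rewrite -?u_mod // ltn_mod (ltn_trans _ S3).
have [e e0 he] := @finite_gap _ S predT _ d (fun j _ _ => lt_d j).
apply/interiorEP; exists e => // z' hz'; apply: halfplanes_in => j.
rewrite u_mod; set i := (j %% S)%N.
have iS : (i < S)%N by rewrite ltn_mod (ltn_trans _ S3).
have -> : z' - p = (z' - z) + (z - p) by rewrite subrKA.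
rewrite dotDr addrC; apply: le_trans (he i iS isT); rewrite lerD2l.
apply: le_trans (dot_le_enorm _ _) _.
by rewrite {1}/enorm uu sqrtr1 mul1r ltW.
Qed.

Let halfplane_bd z k : K z -> dot (u k) (z - p) = d -> bd K z.
Proof.
move=> Kz zd; apply/bdE => //; split=> // /interiorEP[e e0 he].
have h : enorm (z + (e / 2) *: u k - z) < e.
  rewrite addrC addKr enormZ /enorm uu sqrtr1 mulr1 gtr0_norm; lra.
have := halfplane k (he _ h).
rewrite addrAC dotDr dotZr uu zd mulr1; lra.
Qed.

(** The half-planes of the two neighbouring edges cut the line of edge [k] at distance
    [d * tan b = r] from its midpoint. *)
Let on_edge z k : K z -> dot (u k) (z - p) = d ->
  exists y, `|y| <= r /\ z = p + d *: u k + y *: T k.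
Proof.
move=> Kz zd; pose y := dot (T k) (z - p).
have zE : z = p + d *: u k + y *: T k.
  by rewrite -addrA -zd -decomp addrC subrK.
exists y; split => //; rewrite ler_norml.
have h1 := halfplane k.+1 Kz; rewrite zE edge_dotj in h1.
have h2 := halfplane (k + S.-1) Kz; rewrite zE edge_dotj in h2.
have e1 : A k.+1 - A k = 2 * b by rewrite /A -natr1; ring.
have e2 : A (k + S.-1) - A k = - (2 * b) + 2 * pi * 1%:R.
  rewrite AB natrD -SbE; have -> : S.-1%:R = S%:R - 1 :> R.
    by rewrite -[X in X%:R - _]prednK ?(ltn_trans _ S3) // -natr1 addrK.
  by ring.
rewrite e1 in h1; rewrite e2 cosD2pin sinD2pin cosN sinN in h2.
have c2 : d * (1 - cos (2 * b)) = r * sin (2 * b).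
  by rewrite /d /r mulr_natl cos_mulr2n sin_mulr2n -[1](cos2Dsin2 b); ring.
have s2 := s2b0.
by apply/andP; split; rewrite -(ler_pM2r s2) ?mulNr -c2; lra.
Qed.

(** The product is affine in [y], at most [d] at [y = r] and [y = - r], and less than [d] at
    [y = 0], because edge [j] has another normal. *)
Let open_edge_lt j k y : `|y| < r -> (j %% S != k %% S)%N ->
  dot (u j) (p + d *: u k + y *: T k - p) < d.
Proof.
move=> yr jk; have r0 := half_side_gt0; have d0 := apothem_gt0.
have Kz1 := vertex_in k.
have Kz2 : K (p + d *: u k + (- r) *: T k) by rewrite -vertex_prev; exact: vertex_in.
have h1 := halfplane j Kz1; have h2 := halfplane j Kz2.
rewrite /vertex edge_dotj in h1; rewrite !edge_dotj in h2 *.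
have c1 : cos (A j - A k) < 1.
  rewrite AB; have S0' : (0 < S)%N by exact: ltn_trans S3.
  pose m := (j + S - (k %% S))%N.
  have kS : (k %% S < S)%N by rewrite ltn_mod.
  have kj : (k %% S <= j + S)%N by rewrite (leq_trans (ltnW kS)) // leq_addl.
  have mE : m%:R = j%:R + S%:R - (k %% S)%:R :> R by rewrite /m natrB // natrD.
  have kE : k%:R = (k %/ S)%:R * S%:R + (k %% S)%:R :> R by rewrite -natrM -natrD -divn_eq.
  have jm : (j + S = m + k %% S)%N by rewrite subnK.
  have m0 : (m %% S != 0)%N.
    apply: contra jk => /eqP e.
    by rewrite -(modnDr j S) jm -modnDm e add0n !modn_mod.
  have -> : 2 * (j%:R - k%:R) * b = 2 * m%:R * b - 2 * pi * (1 + k %/ S)%:R.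
    by rewrite mE kE natrD -SbE; ring.
  rewrite -(cosD2pin _ (1 + k %/ S)) subrK (divn_eq m S) natrD natrM.
  have -> : 2 * ((m %/ S)%:R * S%:R + (m %% S)%:R) * b =
      2 * (m %% S)%:R * b + 2 * pi * (m %/ S)%:R by rewrite -SbE; ring.
  rewrite cosD2pin; apply: cos_lt1; apply/andP; split.
    by apply: mulr_gt0 => //; apply: mulr_gt0 => //; rewrite ltr0n lt0n.
  by rewrite -SbE -mulrA ltr_pM2l // ltr_pM2r // ltr_nat ltn_mod.
have dc : d * cos (A j - A k) < d by rewrite -[ltRHS]mulr1 ltr_pM2l.
move: yr; rewrite ltr_norml => /andP[y1 y2].
set c := cos _ in h1 h2 dc *; set s := sin _ in h1 h2 *.
have [s0|s0] := leP 0 s.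
  have [y0|y0] := leP 0 y; last first.
    have : y * s <= 0 by rewrite mulr_le0_ge0 // ltW.
    lra.
  have [->|sN0] := eqVneq s 0; first by rewrite mulr0 addr0.
  have : y * s < r * s by rewrite ltr_pM2r // lt_def sN0.
  lra.
have : y * s < - r * s by rewrite ltr_nM2r.
lra.
Qed.

Let edge_dist j z z' : dot (u j) (z' - p) <= dot (u j) (z - p) + enorm (z' - z).
Proof.
have -> : z' - p = (z' - z) + (z - p) by rewrite subrKA.
rewrite dotDr addrC lerD2l; apply: le_trans (dot_le_enorm _ _) _.
by rewrite {1}/enorm uu sqrtr1 mul1r.
Qed.

Let dotB_p (n z z' : plane) : dot n (z - z') = dot n (z - p) - dot n (z' - p).
Proof. by rewrite -dotBr opprB subrKA. Qed.

Lemma polygon_bd_cases z : bd K z ->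
  (exists k y, `|y| < r /\ z = p + d *: u k + y *: T k) \/ exists k, z = vertex k.
Proof.
move=> bz; have [k kS zd] := bd_halfplane bz.
have [y [yr ->]] := on_edge (bd_sub bK bz) zd.
move: yr; rewrite le_eqVlt => /predU1P[yr|yr]; last by left; exists k, y.
right; have [y0|y0] := leP 0 y.
  by exists k; rewrite /vertex -yr ger0_norm.
by exists (k + S.-1)%N; rewrite vertex_prev -yr ltr0_norm // opprK.
Qed.

Lemma open_edge_bd k y : `|y| < r -> bd K (p + d *: u k + y *: T k).
Proof.
move=> yr; apply: (@halfplane_bd _ k); last exact: edge_dot.
apply: halfplanes_in => j; have [e|jk] := eqVneq (j %% S)%N (k %% S)%N.
  by rewrite u_mod e -u_mod edge_dot.
by apply: ltW; apply: open_edge_lt.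
Qed.

Lemma open_edge_near k y : `|y| < r ->
  exists2 e : R, 0 < e & forall z, enorm (z - (p + d *: u k + y *: T k)) < e ->
    bd K z -> exists y', [/\ `|y'| < r, z = p + d *: u k + y' *: T k &
      `|y' - y| <= enorm (z - (p + d *: u k + y *: T k))].
Proof.
move=> yr; set z0 := p + _ + _.
have [e e0 he] := @finite_gap _ S (fun j => j %% S != k %% S)%N
  (fun j => dot (u j) (z0 - p)) d (fun j _ => open_edge_lt yr).
exists (Num.min e (r - `|y|)); first by rewrite lt_min e0 subr_gt0.
move=> z; rewrite lt_min => /andP[ze zy] bz.
have [j jS zd] := bd_halfplane bz.
have [ejk|jk] := eqVneq (j %% S)%N (k %% S)%N; last first.
  by have := he j jS jk; have := edge_dist j z0 z; rewrite zd; lra.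
rewrite u_mod ejk -u_mod in zd.
have [y' [_ zE]] := on_edge (bd_sub bK bz) zd.
have yy' : `|y' - y| <= enorm (z - z0).
  have -> : z - z0 = (y' - y) *: T k.
    by rewrite zE /z0 opprD addrACA subrr add0r scalerBl.
  by rewrite enormZ {1}/enorm TT sqrtr1 mulr1.
exists y'; split => //.
rewrite -(subrK y y'); apply: le_lt_trans (ler_normD _ _) _.
by move: yy' zy; lra.
Qed.

Let open_edge_local_param k y : `|y| < r ->
  local_param K (p + d *: u k + y *: T k) (fun t => p + d *: u k + y *: T k + t *: T k).
Proof.
move=> yr; set z0 := p + _ + _; split.
- exact: smooth_line.
- by rewrite scale0r addr0.
- by rewrite derive1_line -dot_eq0 TT oner_eq0.
- apply/(@nbhs_normP R R^o); exists (r - `|y|); first by rewrite /= subr_gt0.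
  move=> t; rewrite /ball_ /= sub0r normrN => ty.
  rewrite /z0 -[p + _ + _ + _]addrA -scalerDl; apply: open_edge_bd.
  by apply: le_lt_trans (ler_normD _ _) _; move: ty; lra.
- move=> e e0; apply/nbhs_enormP.
  have [e' e'0 he'] := open_edge_near k yr.
  exists (Num.min e e'); first by rewrite lt_min e0.
  move=> z; rewrite lt_min => /andP[ze ze'] bz.
  have [y' [_ zE yy']] := he' z ze' bz.
  exists (y' - y); first exact: le_lt_trans yy' ze.
  by rewrite /z0 -[p + _ + _ + _]addrA -scalerDl [y + _]addrC subrK.
Qed.

Let AS k : A k.+1 - A k = 2 * b.
Proof. by rewrite /A -natr1; ring. Qed.

Let vertex_halfplane k z : bd K z -> 0 <= dot (- u k) (z - vertex k).
Proof.
move=> bz; have h := halfplane k (bd_sub bK bz).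
by rewrite dotNl oppr_ge0 dotB_p /vertex edge_dot subr_le0.
Qed.

Let vertex_halfplane' k z : bd K z -> 0 <= dot (- u k.+1) (z - vertex k).
Proof.
move=> bz; have h := halfplane k.+1 (bd_sub bK bz).
by rewrite dotNl oppr_ge0 dotB_p vertex_next -scaleNr edge_dot subr_le0.
Qed.

(** A tangent vector of a smooth boundary would be orthogonal to the two independent normals of the
    edges at the vertex. *)
Lemma vertex_nonsmooth k : ~ smooth_at K (vertex k).
Proof.
move=> [c lc]; have [_ _ v0 _ _] := lc; set w := derive1 c 0 in v0.
have h1 : dot (- u k) w = 0.
  by apply: (local_param_support lc) => z; exact: vertex_halfplane.
have h2 : dot (- u k.+1) w = 0.
  by apply: (local_param_support lc) => z; exact: vertex_halfplane'.
move: h1 h2; rewrite !dotNl => /eqP; rewrite oppr_eq0 => /eqP h1 /eqP.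
rewrite oppr_eq0 (decomp k w) h1 scale0r add0r dotZr uTj AS mulf_eq0.
rewrite (gt_eqF s2b0) orbF => /eqP h2.
by move: v0; rewrite (decomp k w) h1 h2 !scale0r addr0 eqxx.
Qed.

(** A boundary curve leaving the vertex strictly inside the half-planes of both adjacent edges would
    contradict [bd_halfplane], since the other half-planes hold with a margin near the vertex. Hence
    [w] is parallel to an edge, and the half-plane of the other edge fixes its sign. *)
Lemma vertex_tangent k (w : plane) : tangent_direction K (vertex k) w ->
  (exists2 C : R, 0 < C & w = - (C *: T k)) \/ (exists2 D : R, 0 < D & w = D *: T k.+1).
Proof.
move=> [w0 [c [sc c0 c1 hc]]].
have [e0 /= e00 he0] := (nbhs_normP _ _).1 hc.
have bdc t : 0 < t -> t < e0 -> bd K (c t).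
  by move=> t0 te; apply: he0 => //; rewrite /ball_ /= sub0r normrN gtr0_norm.
pose n1 := u k; pose n2 := u k.+1.
have pick (e : R) (n : plane) : 0 < e -> 0 < dot w n ->
    exists2 d' : R, 0 < d' & forall h, 0 < h -> h < d' -> 0 < dot (c h - vertex k) n.
  move=> e_gt0 wn; have [|d' d'0 hd'] := @curve_direction _ c n sc; first by rewrite c1.
  exists d' => // h h0 hd; rewrite -c0; apply: (proj1 (hd' h _)) => //.
  by rewrite gtr0_norm.
have half (x y : R) : 0 < x -> 0 < y -> exists h, [/\ 0 < h, h < x & h < y].
  move=> x0 y0; exists (Num.min x y / 2).
  have m0 : 0 < Num.min x y by rewrite lt_min x0.
  have : Num.min x y / 2 < Num.min x y by rewrite ltr_pdivrMr // ltr_pMr // ltr1n.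
  by rewrite lt_min => /andP[h1 h2]; split => //; rewrite divr_gt0.
have A_le0 : dot n1 w <= 0.
  rewrite leNgt; apply/negP; rewrite dotC => /(pick 1 _ ltr01)[d' d'0 hd'].
  have [h [h0 h1 h2]] := half _ _ e00 d'0.
  by have := vertex_halfplane k (bdc h h0 h1); have := hd' h h0 h2; rewrite dotC dotNl; lra.
have B_le0 : dot n2 w <= 0.
  rewrite leNgt; apply/negP; rewrite dotC => /(pick 1 _ ltr01)[d' d'0 hd'].
  have [h [h0 h1 h2]] := half _ _ e00 d'0.
  by have := vertex_halfplane' k (bdc h h0 h1); have := hd' h h0 h2; rewrite dotC dotNl; lra.
have AB0 : dot n1 w = 0 \/ dot n2 w = 0.
  have [|A0] := eqVneq (dot n1 w) 0; first by left.
  have [|B0] := eqVneq (dot n2 w) 0; first by right.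
  exfalso.
  have {A0}A_lt0 : 0 < dot w (- n1) by rewrite dotNr dotC oppr_gt0 lt_neqAle A0.
  have {B0}B_lt0 : 0 < dot w (- n2) by rewrite dotNr dotC oppr_gt0 lt_neqAle B0.
  have [d1 d10 hd1] := pick 1 _ ltr01 A_lt0.
  have [d2 d20 hd2] := pick 1 _ ltr01 B_lt0.
  have [eg eg0 heg] := @finite_gap _ S
    (fun j => (j %% S != k %% S) && (j %% S != k.+1 %% S))%N
    (fun j => dot (u j) (vertex k - p)) d
    (fun j _ h => vertex_lt (proj1 (andP h)) (proj2 (andP h))).
  have [M [d3 [M0 d30 hd3]]] := curve_lipschitz_at sc.
  have eM0 : 0 < eg / M by rewrite divr_gt0.
  have [h1 [h10 h1e h1d]] := half _ _ e00 d10.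
  have [h2 [h20 h2e h2d]] := half _ _ d20 d30.
  have [h3 [h30 h31 h32]] := half _ _ h10 h20.
  have [h [h0 hh3 hM]] := half _ _ h30 eM0.
  have bh := bdc h h0 (lt_trans hh3 (lt_trans h31 h1e)).
  have a1 := hd1 h h0 (lt_trans hh3 (lt_trans h31 h1d)).
  have a2 := hd2 h h0 (lt_trans hh3 (lt_trans h32 h2e)).
  have a3 : enorm (c h - vertex k) < eg.
    rewrite -c0; apply: le_lt_trans (hd3 h _) _; rewrite gtr0_norm //.
      exact: lt_trans hh3 (lt_trans h32 h2d).
    by rewrite mulrC -ltr_pdivlMr.
  have [j jS jd] := bd_halfplane bh.
  have eq_d i : dot (c h - vertex k) (- u i) = dot (u i) (vertex k - p) - dot (u i) (c h - p).
    by rewrite dotNr dotC dotB_p opprB.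
  have [ejk|jk] := eqVneq (j %% S)%N (k %% S)%N.
    move: a1; rewrite eq_d /n1 (u_mod k) -ejk -u_mod jd.
    by have := vertex_le j k; lra.
  have [ejk1|jk1] := eqVneq (j %% S)%N (k.+1 %% S)%N.
    move: a2; rewrite eq_d /n2 (u_mod k.+1) -ejk1 -u_mod jd.
    by have := vertex_le j k; lra.
  have := heg j jS; rewrite jk jk1 => /(_ isT).
  by have := edge_dist j (vertex k) (c h); rewrite jd; lra.
have AS' : A k - A k.+1 = - (2 * b) by rewrite -(AS k); ring.
have s2 := s2b0.
case: AB0 => h0.
  have wE : w = dot (T k) w *: T k by rewrite {1}(decomp k w) h0 scale0r add0r.
  left; exists (- dot (T k) w); last by rewrite scaleNr opprK.
  have C0 : dot (T k) w != 0 by apply: contra_neq w0 => C0; rewrite wE C0 scale0r.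
  rewrite oppr_gt0 lt_neqAle C0 /=.
  move: B_le0; rewrite /n2 {1}wE dotZr uTj AS => h.
  by rewrite -(ler_pM2r s2) mul0r.
have wE : w = dot (T k.+1) w *: T k.+1 by rewrite {1}(decomp k.+1 w) h0 scale0r add0r.
right; exists (dot (T k.+1) w) => //.
have C0 : dot (T k.+1) w != 0 by apply: contra_neq w0 => C0; rewrite wE C0 scale0r.
rewrite lt_def C0 /=.
move: A_le0; rewrite /n1 {1}wE dotZr uTj AS' sinN mulrN oppr_le0 => h.
by rewrite -(ler_pM2r s2) mul0r.
Qed.

Let edge_foot (x : plane) k : plane := p + d *: u k + dot (T k) (x - p) *: T k.

Let foot_small (x : plane) k : enorm (x - p) < r -> `|dot (T k) (x - p)| < r.
Proof.
apply: le_lt_trans; apply: le_trans (cauchy_schwarz _ _) _.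
by rewrite {1}/enorm TT sqrtr1 mul1r.
Qed.

Let open_edge_equilibrium (x : plane) k y : `|y| < r ->
  equilibrium K x (p + d *: u k + y *: T k) -> y = dot (T k) (x - p).
Proof.
move=> yr [bq [_ hq]]; set q := p + _ + _ in bq hq.
have lc := open_edge_local_param k yr.
have perp : dot (q - x) (T k) = 0.
  have -> : T k = derive1 (fun t : R => q + t *: T k) 0 by rewrite derive1_line.
  case: hq => hq.
    apply/eqP; rewrite -oppr_eq0 -dotNl opprB; apply/eqP.
    apply: (local_param_support lc) => z /(bd_sub bK) /hq.
    by rewrite -(opprB x) dotNl oppr_le0.
  by apply: (local_param_support lc) => z /(bd_sub bK) /hq.
by move: perp; rewrite dotC dotB_p edge_dotT => /subr0_eq.
Qed.

(** Along a straight edge only the squared speed survives in the second derivative. The first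
    alternative does occur for [S = 3], where [r] exceeds the apothem and [x] may lie on an edge. *)
Let open_edge_deriv2 (x : plane) k y : `|y| < r -> y = dot (T k) (x - p) ->
  p + d *: u k + y *: T k = x \/
  0 < dist_deriv2 x (fun t => p + d *: u k + y *: T k + t *: T k).
Proof.
move=> yr ye; set q := p + _ + _.
have [|qx] := eqVneq q x; first by left.
right; set c := fun t => _.
have c0 : c 0 = q by rewrite /c scale0r addr0.
have c1 : derive1 c 0 = T k by rewrite /c derive1_line.
have c2 : derive1n 2 c 0 = 0.
  rewrite -[derive1n 2 c]/(derive1n 1.+1 c) derive1nS derive1n1.
  have -> : derive1 c = cst (T k) by apply/funext => t; rewrite /c derive1_line.
  by rewrite derive1_cst.
have perp : dot (q - x) (T k) = 0 by rewrite dotC dotB_p edge_dotT -ye subrr.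
rewrite dist_deriv2E ?c0 ?c1 ?c2 //; last exact: smooth_line.
by rewrite dot0r addr0 TT divr_gt0 // enorm_gt0 subr_eq0.
Qed.

Let foot_is_equilibrium (x : plane) k : enorm (x - p) < r ->
  equilibrium K x (edge_foot x k).
Proof.
move=> xr; have bq := open_edge_bd k (foot_small k xr); split => //.
split; first exact: bd_sub bq.
have qx : edge_foot x k - x = (d - dot (u k) (x - p)) *: u k.
  have -> : edge_foot x k - x = (edge_foot x k - p) - (x - p) by rewrite opprB subrKA.
  rewrite /edge_foot coords {2}(decomp k (x - p)) opprD addrACA subrr addr0.
  by rewrite scalerBl.
have le0 z : K z -> dot (u k) (z - edge_foot x k) <= 0.
  by move=> /(halfplane k) h; rewrite dotB_p edge_dot subr_le0.
(* For [S = 3] the disc of radius [r] is larger than the inscribed one, so [x] may lie beyond the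
   line of the edge; hence the two signs. *)
rewrite qx; set l := d - _; have [l0|l0] := leP 0 l.
  by left => z /le0 h; rewrite dotZl mulr_ge0_le0.
by right => z /le0 h; rewrite dotZl mulr_le0 // ltW.
Qed.

Let foot_mod (x : plane) k : edge_foot x k = edge_foot x (k %% S).
Proof. by rewrite /edge_foot u_mod T_mod. Qed.

(** At a vertex both angles are acute because the projections of [x] to the lines of the two
    adjacent edges are interior to these edges. *)
Lemma polygon_nondegenerate (x : plane) : enorm (x - p) < r -> only_nondegenerate K x.
Proof.
move=> xr q eq; have [bq _] := eq.
have [[k [y [yr qE]]]|[k qE]] := polygon_bd_cases bq; rewrite qE in eq *.
  left; have lc := open_edge_local_param k yr.
  split; first by exists (fun t => p + d *: u k + y *: T k + t *: T k).
  have [h|h] := open_edge_deriv2 yr (open_edge_equilibrium yr eq); first by left.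
  by right; exists (fun t => p + d *: u k + y *: T k + t *: T k) => //; rewrite gt_eqF.
right; split; first exact: vertex_nonsmooth.
move=> w /vertex_tangent[[C C0 ->]|[D D0 ->]].
  have h := foot_small k xr; rewrite ltr_norml in h; have /andP[h1 h2] := h.
  rewrite dotNr dotZr dotC dotB_p /vertex edge_dotT -mulrN opprB.
  by rewrite mulr_gt0 // subr_gt0.
have h := foot_small k.+1 xr; rewrite ltr_norml in h; have /andP[h1 h2] := h.
rewrite dotZr dotC dotB_p vertex_next -scaleNr edge_dotT opprK.
by rewrite mulr_gt0 //; lra.
Qed.

Lemma polygon_stable (x : plane) : enorm (x - p) < r -> stable K x #= `I_S.
Proof.
move=> xr; rewrite card_eq_sym; apply/card_set_bijP; exists (edge_foot x); split.
- move=> k kS; have h := foot_small k xr.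
  have lc := open_edge_local_param k h.
  split; first exact: foot_is_equilibrium.
    by exists (fun t => edge_foot x k + t *: T k).
  have [e|e] := open_edge_deriv2 h erefl; first by left.
  by right; exists (fun t => edge_foot x k + t *: T k).
- move=> i j; rewrite !inE /= => iS jS e.
  have [//|ij] := eqVneq i j.
  have := @open_edge_lt i j _ (foot_small j xr); rewrite !modn_small // => /(_ ij).
  by rewrite -/(edge_foot x j) -e edge_dot ltxx.
- move=> q [eq sq _]; have [bq _] := eq.
  have [[k [y [yr qE]]]|[k qE]] := polygon_bd_cases bq; rewrite qE in eq sq *.
    exists (k %% S)%N; first by rewrite /= ltn_mod (ltn_trans _ S3).
    by rewrite -foot_mod /edge_foot -(open_edge_equilibrium yr eq).
  by case: (vertex_nonsmooth sq).
Qed.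

(** * Length of a regular polygon along an arbitrary parametrization *)

Section PolygonLength.
Variables (G : R -> plane) (Lam : R -> R) (L : R).
Hypothesis cir : circuit K G Lam L.
Implicit Types (c : R -> plane) (P : R -> R) (s t e v sg : R).

Local Notation germ := (germ G Lam).
Local Notation w := (normal_distance G Lam p).
Local Notation Up := (Up p G Lam r).
Local Notation is_arc := (is_arc p G Lam r).

Let rob (x : plane) : enorm (x - p) < r -> only_nondegenerate K x := @polygon_nondegenerate x.
Let r0 : 0 < r := half_side_gt0.

Let near_line v k y : `|y| < r -> G v = p + d *: u k + y *: T k ->
  exists2 dl : R, 0 < dl & forall s, `|s - v| < dl -> dot (u k) (G s - p) = d.
Proof.
move=> yr Gv; have [e e0 he] := open_edge_near k yr.
have [dl dl0 hdl] := germs_continuous (circuit_right cir) (circuit_left cir) v e0.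
exists dl => // s /hdl; rewrite Gv => /he /(_ (circuit_bd cir s)).
by move=> [y' [_ -> _]]; rewrite edge_dot.
Qed.

(** On an edge the curve stays on a line, so its second derivative is orthogonal to [u k] and the
    curvature term vanishes; [tangential] and the arc length then grow at the same rate. *)
Let germ_flat v sg c P e k y : germ v sg c P e -> sg = 1 \/ sg = -1 ->
  `|y| < r -> G v = p + d *: u k + y *: T k ->
  [/\ dot (u k) (derive1 c 0) = 0, tangential_derive p c 0 = enorm (derive1 c 0) &
    exists2 dl, 0 < dl <= e & forall s t, 0 <= s -> s < t -> t < dl ->
      P t - P s = tangential p c t - tangential p c s].
Proof.
move=> g sg1 yr Gv; have [e0 sc dP hg] := g.
have [dl0 dl00 hdl] := near_line yr Gv.
pose dl := Num.min e dl0.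
have dl_gt0 : 0 < dl by rewrite lt_min e0.
have line s : 0 <= s < dl -> dot (u k) (c s - p) = d.
  rewrite lt_min => /and3P[s_ge0 se sd].
  have [|<- _ _] := hg s; first by rewrite s_ge0 ltW.
  have sg_norm : `|sg| = 1 by case: sg1 => ->; rewrite ?normrN normr1.
  by apply: hdl; rewrite addrC addKr normrM sg_norm mul1r ger0_norm.
have d1 := smooth_curve_derive1 sc; have d2 := smooth_curve_derive2 sc.
have lin1 s : 0 <= s < dl -> dot (u k) (derive1 c s) = 0.
  move=> /andP[s_ge0 sd].
  have D := is_derive_dot s (is_curve_derive_cst (u k)) (is_curve_deriveB p d1).
  have : dot (cst 0 s) (c s - p) + dot (cst (u k) s) (derive1 c s) = 0.
    apply: (right_const_derive0 D (d := dl - s)); first by rewrite subr_gt0.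
    move=> h /andP[h0 hd]; rewrite /cst !line ?s_ge0 //.
    by apply/andP; split; lra.
  by rewrite /cst dot0l add0r.
have lin2 s : 0 <= s < dl -> dot (u k) (derive1n 2 c s) = 0.
  move=> /andP[s_ge0 sd].
  have D := is_derive_dot s (is_curve_derive_cst (u k)) d2.
  have : dot (cst 0 s) (derive1 c s) + dot (cst (u k) s) (derive1n 2 c s) = 0.
    apply: (right_const_derive0 D (d := dl - s)); first by rewrite subr_gt0.
    move=> h /andP[h0 hd]; rewrite /cst !lin1 ?s_ge0 //.
    by apply/andP; split; lra.
  by rewrite /cst dot0l add0r.
have u0 : u k != 0 by rewrite -dot_eq0 uu oner_eq0.
have speed s : 0 <= s < dl -> tangential_derive p c s = enorm (derive1 c s).
  move=> hs; have /andP[s_ge0 sd] := hs.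
  have hse : 0 <= s < e by rewrite s_ge0; move: sd; rewrite lt_min => /andP[].
  have [_ _ v0 _] := germ_branch_shift cir g hse.
  rewrite (derive1_affine s 1 0 sc) scale1r mulr0 addr0 in v0.
  have perp1 : dot (derive1 c s) (u k) = 0 by rewrite dotC lin1.
  have perp2 : dot (derive1 c s) (foot p (c s) (derive1 c s) - c s) = 0.
    by rewrite dotC foot_perp.
  have [l e1] := perp_collinear v0 u0 perp1 perp2.
  have [e2 _] := germ_speed_ge bK Kp cir g hse.
  rewrite e1 dotZl lin2 // mulr0 mul0r in e2.
  by move: e2; lra.
have z0 : 0 <= (0 : R) < dl by rewrite lexx.
split; [exact: lin1|exact: speed|exists dl; first by rewrite dl_gt0 ge_min lexx].
move=> s t s_ge0 st td.
have df x : x \in `[s, t] -> is_derive x 1 (fun x => P x - tangential p c x)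
    (enorm (derive1 c x) - tangential_derive p c x).
  rewrite in_itv /= => /andP[sx xt].
  have xe : x < e by have := le_lt_trans xt td; rewrite lt_min => /andP[].
  have hx : 0 <= x <= e by rewrite (le_trans s_ge0 sx) ltW.
  have vx : derive1 c x != 0 by have [] := hg x hx.
  exact: (is_deriveB (dP x hx) (is_derive_tangential p sc vx)).
have f0 x : x \in `[s, t] -> enorm (derive1 c x) - tangential_derive p c x = 0.
  rewrite in_itv /= => /andP[sx xt]; rewrite speed ?subrr //.
  by rewrite (le_trans s_ge0 sx) (le_lt_trans xt td).
have := derive0_const df f0 (ltW st).
lra.
Qed.

Let edge_up v k y : `|y| < r -> G v = p + d *: u k + y *: T k -> Up v.
Proof.
move=> yr Gv; have [cr [Pr [er gr]]] := circuit_right cir v.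
have [cl [Pl [el gl]]] := circuit_left cir v.
have [perp speed _] := germ_flat gr (or_introl erefl) yr Gv.
have br := germ_branch cir gr; have [scr crv v0 _] := br.
have er0 : 0 < er by case: gr.
have wv : w v = tangential p cr 0 := normal_distance_germ p gr.
have T0 : T k != 0 by rewrite -dot_eq0 TT oner_eq0.
have u0 : u k != 0 by rewrite -dot_eq0 uu oner_eq0.
have [l cE] := perp_collinear u0 T0 (uT k) perp.
have l0 : l != 0 by apply: contra_neq v0 => l0; rewrite cE l0 scale0r.
have tr : `|tangential p cr 0| < r.
  rewrite tangentialE crv cE dotZr enormZ {1}/enorm TT sqrtr1 mulr1 dotC Gv edge_dotT.
  rewrite !normrM normfV normr_id mulrAC divff ?mul1r //.
  by rewrite normr_eq0.
have [c0 [sg [lc0 sg1 _ hsg]]] := robust_smooth bK Kp cir rob gr tr.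
have wr : `|w v| < r by rewrite wv.
have [h1 _] := smooth_up_down bK Kp cir gr gl lc0 wr hsg.
apply: h1; case: sg1 => // sgE; have := hsg _ br.
by rewrite speed sgE mulN1r oppr_gt0 ltNge enorm_ge0.
Qed.

Let up_edge v : Up v -> exists k y, `|y| < r /\ G v = p + d *: u k + y *: T k.
Proof.
move=> upv; have [//|[k Gv]] := polygon_bd_cases (circuit_bd cir v).
have [cr [Pr [er gr]]] := circuit_right cir v.
have er0 : 0 < er by case: gr.
have wv : w v = tangential p cr 0 := normal_distance_germ p gr.
have tr : `|tangential p cr 0| < r by rewrite -wv; exact: up_lt.
have [c0 [sg [lc0 _ _ _]]] := robust_smooth bK Kp cir rob gr tr.
by case: (@vertex_nonsmooth k); exists c0; rewrite -Gv.
Qed.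

Let flat_local v : Up v -> exists2 e, 0 < e & forall s t, `|s - v| < e ->
  `|t - v| < e -> s < t -> Lam t - Lam s = w t - w s.
Proof.
move=> upv; have [k [y [yr Gv]]] := up_edge upv.
have [cr [Pr [er gr]]] := circuit_right cir v.
have [cl [Pl [el gl]]] := circuit_left cir v.
have [_ _ [dr /andP[dr0 drer] PR]] := germ_flat gr (or_introl erefl) yr Gv.
have [_ _ [dl /andP[dl0 dlel] PL]] := germ_flat gl (or_intror erefl) yr Gv.
have [|c0 [sg [lc0 _ _ hsg]]] := robust_smooth bK Kp cir rob gr.
  by rewrite -(normal_distance_germ p gr); exact: up_lt.
have [wl _] := smooth_local bK Kp cir gr gl lc0 hsg.
have [_ Pl0] := germ0 gl.
apply: (glue_at dr0 dl0) => [x y' z|s t us st td|s t us st tu]; first lra.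
  have te : t < v + er by apply: lt_le_trans td _; rewrite lerD2l.
  have [-> _ _ ->] := germ_right p gr us (lt_trans st te).
  have [-> _ _ ->] := germ_right p gr (le_trans us (ltW st)) te.
  have := PR (s - v) (t - v); rewrite subr_ge0 ltrD2r ltrBlDl => /(_ us st td) <-.
  by rewrite opprD addrACA subrr add0r.
have es : v - el < s by apply: le_lt_trans us; rewrite lerD2l lerN2.
have [-> _ _ ->] := germ_left p gl es (lt_le_trans st tu).
have [-> ->] : w t = - tangential p cl (v - t) /\ Lam t = Lam v - Pl (v - t).
  move: tu; rewrite le_eqVlt => /predU1P[->|tu].
    by move: Pl0; rewrite subrr mulN1r => ->; rewrite addr0.
  by have [] := germ_left p gl (lt_trans es st) tu.
have := PL (v - t) (v - s); rewrite subr_ge0 ltrD2l ltrN2 ltrBlDr -ltrBlDl => /(_ tu st us).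
by set a1 := tangential _ _ _; set a2 := tangential _ _ _; lra.
Qed.

Let arc_flat v a a' s t : is_arc v a a' -> a < s -> s < t -> t < a' ->
  Lam t - Lam s = w t - w s.
Proof.
move=> [_ up _ _] as_ st ta.
apply: (@local_to_global _ (fun s t => Lam t - Lam s = w t - w s) s t _ st) => [x y z|x].
  lra.
move=> /andP[sx xt]; apply: flat_local; apply: up.
by rewrite (lt_le_trans as_ sx) (le_lt_trans xt ta).
Qed.

Let length_continuous v (eta : R) : 0 < eta ->
  exists2 dl, 0 < dl & forall t, `|t - v| < dl -> `|Lam t - Lam v| < eta.
Proof.
move=> eta0.
have [cr [Pr [er gr]]] := circuit_right cir v; have [er0 _ dPr _] := gr.
have [cl [Pl [el gl]]] := circuit_left cir v; have [el0 _ dPl _] := gl.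
have near0 P e (c : R -> plane) : 0 < e ->
    (forall s, 0 <= s <= e -> is_derive s 1 P (enorm (derive1 c s))) ->
    exists2 dl, 0 < dl & forall s, 0 <= s < dl -> `|P s - P 0| < eta.
  move=> e0 dP; have z0 : 0 <= (0 : R) <= e by rewrite lexx ltW.
  have C : P t @[t --> 0] --> P 0 := is_derive_continuous (dP 0 z0).
  have n0 : \forall t \near (0 : R), `|P 0 - P t| < eta.
    by move/cvgrPdist_lt : C => /(_ eta eta0).
  have [dl /= dl0 hdl] := (nbhs_normP _ _).1 n0.
  exists dl => // s /andP[s0 sd]; rewrite distrC; apply: hdl.
  by rewrite /ball_ /= sub0r normrN ger0_norm.
have [dr dr0 hdr] := near0 _ _ _ er0 dPr.
have [dl dl0 hdl] := near0 _ _ _ el0 dPl.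
have [[_ Pr0] [_ Pl0]] := (germ0 gr, germ0 gl).
rewrite mul1r in Pr0; move: Pl0; rewrite mulN1r => /eqP; rewrite oppr_eq0 => /eqP Pl0.
exists (Num.min (Num.min er el) (Num.min dr dl)); first by rewrite !lt_min er0 el0 dr0.
move=> t; rewrite !lt_min => /andP[/andP[t1 t2] /andP[t3 t4]].
have [vt|tv] := leP v t.
  rewrite ger0_norm ?subr_ge0 // in t1 t3; rewrite ltrBlDl in t1.
  have [_ _ _ ->] := germ_right p gr vt t1; rewrite addrC addKr.
  by have := hdr (t - v); rewrite Pr0 subr0 subr_ge0 vt => /(_ t3).
rewrite distrC ger0_norm ?subr_ge0 ?(ltW tv) // in t2 t4; rewrite ltrBlDr -ltrBlDl in t2.
have [_ _ _ ->] := germ_left p gl t2 tv; rewrite addrC addKr normrN.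
by have := hdl (v - t); rewrite Pl0 subr0 subr_ge0 ltW // => /(_ t4).
Qed.

(** Inside the arc the length equals the rise of [w], which is below 2 r; continuity of [Lam]
    extends the bound to the ends. The reverse inequality holds for every arc. *)
Let arc_length_flat v a a' : is_arc v a a' -> Lam a' - Lam a = 2 * r.
Proof.
move=> arc; have [/andP[av va] up _ _] := arc.
apply/le_anti; rewrite (arc_length_ge bK Kp cir rob arc) andbT.
apply/ler_addgt0Pr => eta eta0.
have eta20 : 0 < eta / 2 by rewrite divr_gt0.
have [d1 d10 h1] := length_continuous a eta20.
have [d2 d20 h2] := length_continuous a' eta20.
pose x := Num.min d1 (v - a) / 2; pose y := Num.min d2 (a' - v) / 2.
have m1 : 0 < Num.min d1 (v - a) by rewrite lt_min d10 subr_gt0.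
have m2 : 0 < Num.min d2 (a' - v) by rewrite lt_min d20 subr_gt0.
have half (z : R) : 0 < z -> 0 < z / 2 /\ z / 2 < z by move=> z0; split; lra.
have [x0 xlt] := half _ m1; have [y0 ylt] := half _ m2.
rewrite -/x in x0 xlt; rewrite -/y in y0 ylt.
move: xlt ylt; rewrite !lt_min => /andP[x1 x2] /andP[y1 y2].
have l1 : `|Lam (a + x) - Lam a| < eta / 2 by apply: h1; rewrite addrC addKr gtr0_norm.
have l2 : `|Lam (a' - y) - Lam a'| < eta / 2.
  by apply: h2; rewrite addrC addKr normrN gtr0_norm.
have e : Lam (a' - y) - Lam (a + x) = w (a' - y) - w (a + x).
  by apply: (arc_flat arc); lra.
have w1 : `|w (a + x)| < r by apply: up_lt; apply: up; apply/andP; split; lra.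
have w2 : `|w (a' - y)| < r by apply: up_lt; apply: up; apply/andP; split; lra.
move: l1 l2 w1 w2; rewrite !ltr_norml => /andP[_ l1] /andP[l2 _] /andP[w1 _] /andP[_ w2].
lra.
Qed.

(** An intermediate value argument in which [w] inherits its continuity on the arc from [Lam]:
    without a zero its sign would be locally constant, although [w] approaches both [- r] and
    [r]. *)
Let arc_zero v a a' : is_arc v a a' -> exists2 t, a < t < a' & w t = 0.
Proof.
move=> arc; apply: contrapT => nz.
have [s1 /andP[as1 s1a] ws1] := arc_left_limit bK Kp cir rob arc r0.
have [s2 /andP[as2 s2a] ws2] := arc_right_limit bK Kp cir rob arc r0.
rewrite addNr in ws1; rewrite subrr in ws2.
have s12 : s1 < s2.
  case: (ltgtP s1 s2) => // [s21|e]; last by move: ws1 ws2; rewrite e; lra.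
  by have [h _] := arc_rising arc as2 s21 s1a; lra.
have : (w s1 < 0 -> w s2 < 0).
  apply: (@local_to_global _ (fun s t => w s < 0 -> w t < 0) s1 s2 _ s12).
    by move=> x y z h1 h2 h3; exact/h2/h1.
  move=> x /andP[sx xs].
  have ax : a < x by lra. have xa : x < a' by lra.
  have wx0 : w x != 0 by apply/eqP => e; apply: nz; exists x; rewrite // ax.
  have nwx : 0 < `|w x| by rewrite normr_gt0.
  have [d1 d10 h1] := length_continuous x nwx.
  exists (Num.min d1 (Num.min (x - a) (a' - x))); first by rewrite !lt_min d10 !subr_gt0 ax.
  have close (z : R) : `|z - x| < Num.min d1 (Num.min (x - a) (a' - x)) -> `|w z - w x| < `|w x|.
    rewrite !lt_min => /and3P[z1 z2 z3].
    rewrite ltr_norml in z2; rewrite ltr_norml in z3.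
    move: z2 z3 => /andP[z2 z2'] /andP[z3 z3'].
    have := h1 z z1.
    case: (ltgtP z x) => zx; last by rewrite zx !subrr normr0.
      rewrite distrC (@arc_flat _ _ _ z x arc) 1?distrC //; lra.
    by rewrite (@arc_flat _ _ _ x z arc) //; lra.
  move=> s t /close cs /close ct st.
  have [wp|wn] := ltP 0 (w x).
    rewrite (gtr0_norm wp) !ltr_norml in cs ct; move: cs => /andP[c1 c2]; lra.
  rewrite (ler0_norm wn) !ltr_norml in cs ct; move: ct => /andP[c1 c2] _; lra.
by move=> /(_ ws1); lra.
Qed.

Let vertex_mod k : vertex k = vertex (k %% S).
Proof. by rewrite /vertex u_mod T_mod. Qed.

(** Arcs take the place of edges: each has length 2 r, and a gap between consecutive arcs could
    contain only vertices, which are too few to fill an interval. *)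
Lemma polygon_length : L = 2 * S%:R * r.
Proof.
have pr : enorm (p - p) < r by rewrite subrr enorm0.
have S0' : (0 < S)%N by exact: ltn_trans S3.
have [t [a [a' [arc ord [tS aS bS] stab]]]] :=
  arcs_sequence bK Kp cir r0 rob S0' (polygon_stable pr).
have t_inc i j : (i <= j)%N -> (j <= S)%N -> t i <= t j.
  elim: j => [|j IHj]; first by rewrite leqn0 => /eqP ->.
  rewrite leq_eqVlt => /predU1P[->//|ij] jS.
  by apply: le_trans (IHj ij (ltnW jS)) _; apply: ltW; have [] := ord j jS.
(* The arc of such a point would contain a zero of [w], hence a stable point strictly between two
   consecutive ones. *)
have no_up k v : (k < S)%N -> a' k < v -> v < a k.+1 -> ~ Up v.
  move=> kS kv vk upv.
  have [c1 [c2 arcv]] := arc_exists bK Kp cir rob upv.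
  have [/andP[c1v vc2] upc nc1 nc2] := arcv.
  have [_ arck] := arc k (ltnW kS); have [_ arck1] := arc k.+1 kS.
  have [/andP[ak tk] upk nak nbk] := arck.
  have [/andP[ak1 tk1] upk1 nak1 nbk1] := arck1.
  have c1_ge : a' k <= c1.
    by rewrite leNgt; apply/negP => h; apply: nbk; apply: upc; rewrite h (lt_trans kv vc2).
  have c2_le : c2 <= a k.+1.
    by rewrite leNgt; apply/negP => h; apply: nak1; apply: upc; rewrite h (lt_trans c1v vk).
  have [t' /andP[ct' tc'] wt'] := arc_zero arcv.
  have upt' : Up t' by apply: upc; rewrite ct' tc'.
  have /stab[j jS Gt'] := up_stable bK Kp cir r0 rob upt' wt'.
  have l1 : t k < t' by lra. have l2 : t' < t k.+1 by lra.
  have t0k := t_inc 0%N k (leq0n k) (ltnW kS).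
  have tk1S := t_inc k.+1 S kS (leqnn S).
  have t0j := t_inc 0%N j (leq0n j) (ltnW jS).
  have tjS : t j < t 0%N + 1.
    have [tj1 _] := ord j jS; have := t_inc j.+1 S jS (leqnn S).
    by rewrite tS; lra.
  have e : t' = t j.
    by apply: (circuit_inj cir) Gt'; rewrite ltr_norml; rewrite tS in tk1S; lra.
  have [jk|kj] := leqP j k.
    by have := t_inc j k jk (ltnW kS); lra.
  by have := t_inc k.+1 j kj (ltnW jS); lra.
have next k : (k < S)%N -> a' k = a k.+1.
  move=> kS; have [_ le] := ord k kS.
  apply/eqP; rewrite eq_le le /= leNgt; apply/negP => gap.
  (* Pigeonhole: these [S.+1] distinct parameters in the gap would be sent injectively to the [S]
     vertices. *)
  pose pt (m : 'I_S.+1) : R := a' k + (m.+1)%:R / S.+2%:R * (a k.+1 - a' k).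
  have S2 : 0 < S.+2%:R :> R by rewrite ltr0n.
  have gap0 : 0 < a k.+1 - a' k by rewrite subr_gt0.
  have pt_in (m : 'I_S.+1) : a' k < pt m < a k.+1.
    have h1 : 0 < (m.+1)%:R / S.+2%:R :> R by rewrite divr_gt0 // ltr0n.
    have h2 : (m.+1)%:R / S.+2%:R < 1 :> R by rewrite ltr_pdivrMr // mul1r ltr_nat ltnS.
    rewrite /pt ltrDl mulr_gt0 //=.
    by rewrite -ltrBrDl gtr_pMl.
  have /choice[f hf] : forall m : 'I_S.+1, exists i : 'I_S, G (pt m) = vertex i.
    move=> m; have /andP[h1 h2] := pt_in m.
    have [[i [y [yr Gm]]]|[i Gm]] := polygon_bd_cases (circuit_bd cir (pt m)).
      by case: (no_up k (pt m) kS h1 h2); exact: edge_up yr Gm.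
    have iS : (i %% S < S)%N by rewrite ltn_mod.
    by exists (Ordinal iS); rewrite Gm vertex_mod.
  have inj_f : injective f.
    move=> m1 m2 e12; have [h1 h2] := (andP (pt_in m1)); have [h3 h4] := (andP (pt_in m2)).
    have lk : a k.+1 - a' k < 1.
      have [_ arck] := arc k (ltnW kS); have [_ arck1] := arc k.+1 kS.
      have [/andP[x1 x2] _ _ _] := arck; have [/andP[x3 x4] _ _ _] := arck1.
      have := t_inc 0%N k (leq0n k) (ltnW kS); have := t_inc k.+1 S kS (leqnn S).
      by rewrite tS; lra.
    have : pt m1 = pt m2.
      apply: (circuit_inj cir); last by rewrite !hf e12.
      by rewrite ltr_norml; apply/andP; split; lra.
    move=> /addrI/(mulIf (lt0r_neq0 gap0))/(mulIf _) h.
    apply/val_inj/eqP; rewrite -eqSS -(eqr_nat R); apply/eqP; apply: h.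
    by rewrite invr_eq0 gt_eqF.
  by have := leq_card f inj_f; rewrite !card_ord ltnn.
have tot k : (k <= S)%N -> Lam (a k) - Lam (a 0%N) = 2 * k%:R * r.
  elim: k => [_|k IHk kS]; first by rewrite subrr mulr0 mul0r.
  have := IHk (ltnW kS); have [_ arck] := arc k (ltnW kS).
  have := arc_length_flat arck; rewrite (next k kS) -natr1; lra.
have := tot S (leqnn S); rewrite aS (circuit_length cir); lra.
Qed.

End PolygonLength.
End RegularPolygon.

(** * The robustness radius and the conclusion *)

Section RobustnessRadius.
Variables (R : realType).
Local Notation plane := 'rV[R]_2.
Variables (K : set plane) (p : plane).

Definition robustness_radius : R :=
  inf [set enorm (q - p) | q in ~` robustness_region K p].

Let distances_lbound :
  has_lbound [set enorm (q - p) | q in ~` robustness_region K p].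
Proof. by exists 0 => _ [q _ <-]; exact: enorm_ge0. Qed.

Lemma robustness_radius_ge0 : 0 <= robustness_radius.
Proof.
rewrite /robustness_radius.
have [/eqP ->|] := boolP ([set enorm (q - p) | q in ~` robustness_region K p] == set0).
  by rewrite inf0.
by move=> /set0P ne; apply: lb_le_inf => // _ [q _ <-]; exact: enorm_ge0.
Qed.

Lemma ball_robust (x : plane) : enorm (x - p) < robustness_radius ->
  robustness_region K p x.
Proof.
move=> xr; apply: contrapT => nx; move: xr; apply/negP; rewrite -leNgt.
by apply: ge_inf => //; exists x.
Qed.

(** Nonemptiness of the complement is required because the infimum of the empty set is 0 by
    convention. *)
Lemma robustness_radius_ge (r : R) :
  ~` robustness_region K p !=set0 ->
  (forall x : plane, enorm (x - p) < r -> robustness_region K p x) ->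
  r <= robustness_radius.
Proof.
move=> [x nx] rob; apply: lb_le_inf; first by exists (enorm (x - p)), x.
by move=> _ [y ny <-]; rewrite leNgt; apply/negP => /rob.
Qed.

End RobustnessRadius.

(** A value chosen from a nonempty set of lengths belongs to it, so a single parametrization
    realizing the perimeter is enough for the whole argument. *)
Lemma perimeter_attained (R : realType) (K : set 'rV[R]_2) :
  (exists gamma, boundary_param K gamma) ->
  exists2 gamma, boundary_param K gamma & perimeter K = curve_length gamma.
Proof.
move=> [g hg]; have : [set curve_length gamma | gamma in boundary_param K] (perimeter K).
  by apply: xgetPex; exists (curve_length g), g.
by move=> [gamma hgamma <-]; exists gamma.
Qed.

Theorem theorem2 (R : realType) (K : set 'rV[R]_2) (p : 'rV[R]_2) (S : nat) :
  piecewise_smooth_body K -> K° p -> only_nondegenerate K p ->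
  stable K p #= `I_S -> (3 <= S)%N ->
  internal_robustness K p <= 1 / (2 * S%:R) /\
  (internal_robustness K p = 1 / (2 * S%:R) <-> regular_polygon S p K).
Proof.
move=> [bK /perimeter_attained[gamma hgamma perE]] Kp _ stS S3.
have [G [Lam cir]] := boundary_circuit bK hgamma.
rewrite -perE in cir; rewrite /internal_robustness -/(robustness_radius K p).
set L := perimeter K in cir *; set rho := robustness_radius K p.
have S_gt0 : (0 < S)%N by exact: ltn_trans S3.
have SR : 0 < 2 * S%:R :> R by rewrite mulr_gt0 // ltr0n.
have bound (r : R) : 0 < r ->
    (forall x : 'rV[R]_2, enorm (x - p) < r -> robustness_region K p x) ->
    2 * S%:R * r <= L.
  move=> r0 rob; apply: (length_ge bK Kp cir r0 _ S_gt0 stS).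
  by move=> x /rob[].
have ratio (r : R) : 0 < L -> r / L <= 1 / (2 * S%:R) <-> 2 * S%:R * r <= L.
  by move=> L0; rewrite ler_pdivrMr // mul1r mulrC ler_pdivlMr // mulrC.
have L_gt0 : 0 < rho -> 0 < L.
  move=> rho0; apply: lt_le_trans (bound rho rho0 (@ball_robust _ K p)).
  by rewrite mulr_gt0.
(* For radius 0 the quotient vanishes whatever the perimeter; for a positive radius the length bound
   itself makes the perimeter positive. *)
have le_rho : rho / L <= 1 / (2 * S%:R).
  have := robustness_radius_ge0 K p; rewrite -/rho le_eqVlt => /predU1P[<-|rho0].
    by rewrite mul0r ltW // divr_gt0.
  by apply/(ratio _ (L_gt0 rho0)); exact: bound rho0 (@ball_robust _ K p).
split=> //; split=> [eq_rho|[a [theta [a0 KE]]]].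
  have rho0 : 0 < rho.
    rewrite lt_neqAle (robustness_radius_ge0 K p) andbT; apply/eqP => rho0.
    move: eq_rho; rewrite -rho0 mul0r => /esym/eqP.
    by rewrite gt_eqF // divr_gt0.
  have LE : L <= 2 * S%:R * rho.
    have -> : rho = 1 / (2 * S%:R) * L by rewrite -eq_rho divfK // gt_eqF ?L_gt0.
    by rewrite mul1r mulVKf // gt_eqF.
  have rob (x : 'rV[R]_2) : enorm (x - p) < rho -> only_nondegenerate K x.
    by move=> /ball_robust[].
  have [q [T [edge next closed_up q_inj cover]]] :=
    edges_of_equality bK Kp cir rho0 rob (ltnW S3) stS LE.
  exact: regular_edges bK rho0 (ltnW S3) edge next closed_up q_inj cover.
have LE := polygon_length S3 a0 bK Kp KE cir.
have r0 : 0 < a * sin (pi / S%:R) := half_side_gt0 S3 a0.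
have rob (x : 'rV[R]_2) : enorm (x - p) < a * sin (pi / S%:R) ->
    robustness_region K p x.
  move=> xr; split; first exact: (polygon_nondegenerate S3 a0 bK Kp KE xr).
  by apply: card_eq_trans (polygon_stable S3 a0 bK Kp KE xr) _; exact: card_esym.
have L0 : 0 < L by rewrite LE mulr_gt0.
(* If the region were the whole plane, the length bound would apply to every radius, in particular
   to [L], and would give [2 * S * L <= L]. *)
have ne : ~` robustness_region K p !=set0.
  apply: contrapT => all; have : 2 * S%:R * L <= L.
    apply: bound L0 _ => x _; apply: contrapT => nx; apply: all; by exists x.
  rewrite ger_pMl // leNgt => /negP; apply.
  by rewrite -natrM ltr1n; move: S3; case: (S) => // n _; rewrite mulnS.
apply/le_anti; rewrite le_rho /=.
have := robustness_radius_ge ne rob; rewrite -/rho => rho_ge.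
by rewrite ler_pdivlMr // LE mul1r mulKf // gt_eqF.
Qed.
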